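(* Fix $\beta>0$ and finite-dimensional systems with Hamiltonians. The channel free energy $f=F^\beta$ satisfies all of the following properties, and for every $\alpha\in(1,\infty)$ the sandwiched Rényi free energy $f=F^\beta_\alpha$ satisfies (A1)–(A5) together with quasi-convexity: $F^\beta_\alpha[\sum_x p_x\mathcal N^x]\le\max_x F^\beta_\alpha[\mathcal N^x]$ for any probability distribution $\{p_x\}$ and channels $\mathcal N^x:A'\to A$. (A1) For every Gibbs-preserving superchannel $\Theta$ from $\mathrm{Ch}(A',A)$ to $\mathrm{Ch}(B',B)$ and every $\mathcal N\in\mathrm{Ch}(A',A)$, $f[\Theta(\mathcal N)]\le f[\mathcal N]$. (A2) For every replacer channel $\mathcal R^\omega_{A'\to A}(Y)=\operatorname{tr}[Y]\omega$ with $\omega\in\mathrm{St}(A)$, $f[\mathcal R^\omega]$ equals the corresponding state free energy of $\omega$, i.e. $F^\beta[\mathcal R^\omega]=\beta^{-1}D(\omega\|\gamma^\beta_A)$ and $F^\beta_\alpha[\mathcal R^\omega]=\beta^{-1}D_\alpha(\omega\|\gamma^\beta_A)$. (A3) $f[\mathcal N]\ge0$ for all $\mathcal N\in\mathrm{Ch}(A',A)$, with equality if and only if $\mathcal N=\mathcal T^\beta_{A'\to A}$. (A4) (Uniform continuity) $\sup\{|f[\mathcal N]-f[\mathcal M]|:\mathcal N,\mathcal M\in\mathrm{Ch}(A',A),\ \tfrac12\|\mathcal N-\mathcal M\|_\diamond\le\varepsilon\}\to0$ as $\varepsilon\to0$. (A5) (Additivity) For channels $\mathcal N_{A_1'\to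 A_1}$, $\mathcal M_{A_2'\to A_2}$ with noninteracting output Hamiltonian $\widehat H_{A_1A_2}=\widehat H_{A_1}\otimes\mathbb 1_{A_2}+\mathbb 1_{A_1}\otimes\widehat H_{A_2}$, $f[\mathcal N\otimes\mathcal M]=f[\mathcal N]+f[\mathcal M]$. (A6) (Convexity; asserted for $f=F^\beta$) $F^\beta[p\mathcal N+(1-p)\mathcal M]\le pF^\beta[\mathcal N]+(1-p)F^\beta[\mathcal M]$ for $p\in[0,1]$.
   Context: All Hilbert spaces are finite-dimensional. For a system $X$ with Hamiltonian $\widehat H_X$ and $\beta>0$, $\gamma^\beta_X=e^{-\beta\widehat H_X}/Z^\beta_X$, $Z^\beta_X=\operatorname{tr}e^{-\beta\widehat H_X}$; the absolutely thermal channel is $\mathcal T^\beta_{A'\to A}(Y)=\operatorname{tr}[Y]\gamma^\beta_A$. $D$ is the Umegaki relative entropy and $D_\alpha(\rho\|\sigma)=\frac1{\alpha-1}\ln\operatorname{tr}[(\sigma^{\frac{1-\alpha}{2\alpha}}\rho\,\sigma^{\frac{1-\alpha}{2\alpha}})^\alpha]$ the sandwiched Rényi relative entropy (both $+\infty$ if $\operatorname{supp}\rho\not\subseteq\operatorname{supp}\sigma$). For any such state divergence $\mathbf D$, the channel divergence is $\mathbf D[\mathcal N\|\mathcal M]=\sup_{\psi\in\mathrm{St}(RA')}\mathbf D((\mathrm{id}_R\otimes\mathcal N)(\psi)\|(\mathrm{id}_R\otimes\mathcal M)(\psi))$ over all reference systems $R$. $F^\beta[\mathcal N]=\beta^{-1}D[\mathcal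 N\|\mathcal T^\beta]$, $F^\beta_\alpha[\mathcal N]=\beta^{-1}D_\alpha[\mathcal N\|\mathcal T^\beta]$. A superchannel $\Theta:\mathrm{Ch}(A',A)\to\mathrm{Ch}(B',B)$ is a map of the form $\Theta(\mathcal N)=\mathcal Q_{EA\to B}\circ(\mathrm{id}_E\otimes\mathcal N)\circ\mathcal P_{B'\to EA'}$ with quantum channels $\mathcal P,\mathcal Q$; it is Gibbs-preserving if $\Theta(\mathcal T^\beta_{A'\to A})=\mathcal T^\beta_{B'\to B}$. $\|\cdot\|_\diamond$ is the diamond norm. *)

(* Defs.v *)
From HB Require Import structures.
From mathcomp Require Import all_boot all_order all_algebra.
From mathcomp Require Import all_classical all_reals all_analysis.
From mathcomp Require Import complex mxtens.

Set Implicit Arguments.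
Unset Strict Implicit.
Unset Printing Implicit Defensive.

Import Order.TTheory GRing.Theory Num.Theory.
Local Open Scope ring_scope.

(* Finite-dimensional quantum systems: a system of dimension n is C^n, with
   C = R[i] the complex numbers over a real type R.  Operators are n x n
   complex matrices. *)

Section Quantum.
Variable R : realType.
Local Notation C := R[i].

Definition rC (x : R) : C := Complex x 0.

Definition adjmx {m n} (A : 'M[C]_(m, n)) : 'M[C]_(n, m) := (map_mx (@conjc R) A)^T.

Definition hermitian {n} (A : 'M[C]_n) : Prop := adjmx A = A.

(* positive semidefinite: Hermitian with nonnegative quadratic form
   (0 <= z in C means z is a nonnegative real) *)
Definition psd {n} (A : 'M[C]_n) : Prop :=
  hermitian A /\ forall v : 'rV[C]_n, 0 <= (v *m A *m adjmx v) 0 0.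

Definition unitary {n} (U : 'M[C]_n) : Prop := U *m adjmx U = 1%:M.

Definition rtrace {n} (A : 'M[C]_n) : R := complex.Re (\tr A).

Definition is_state {n} (rho : 'M[C]_n) : Prop := psd rho /\ \tr rho = 1.

Definition spec_decomp {n} (A : 'M[C]_n) (Ud : 'M[C]_n * 'rV[R]_n) : Prop :=
  unitary Ud.1 /\ A = Ud.1 *m diag_mx (map_mx rC Ud.2) *m adjmx Ud.1.

(* functional calculus f(A) for Hermitian A (value 0 if A has no spectral
   decomposition, i.e. is not Hermitian; independent of the chosen
   decomposition for Hermitian A) *)
Definition fcalc {n} (f : R -> R) (A : 'M[C]_n) : 'M[C]_n :=
  let Ud := xget (0, 0) (spec_decomp A) in
  Ud.1 *m diag_mx (map_mx (fun x => rC (f x)) Ud.2) *m adjmx Ud.1.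

(* Umegaki relative entropy D(rho||sigma) = tr[rho ln rho] - tr[rho ln sigma],
   +oo unless supp rho <= supp sigma (row spaces; for Hermitian matrices
   the row space is the support).  Conventions 0 ln 0 = 0 and ln restricted
   to the support of sigma (ln 0 = 0 in mathcomp-analysis). *)
Definition relent {n} (rho sigma : 'M[C]_n) : \bar R :=
  if (rho <= sigma)%MS then
    (rtrace (fcalc (fun x => x * ln x) rho) - rtrace (rho *m fcalc (@ln R) sigma))%:E
  else +oo%E.

(* real matrix powers A^t of a PSD matrix, with 0^t = 0 for t < 0
   (generalized inverse power on the support) *)
Definition mpow {n} (t : R) (A : 'M[C]_n) : 'M[C]_n := fcalc (fun x => x `^ t) A.

Definition sandwiched {n} (alpha : R) (rho sigma : 'M[C]_n) : \bar R :=
  if (rho <= sigma)%MS then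
    let s := (1 - alpha) / (2 * alpha) in
    ((alpha - 1)^-1 * ln (rtrace (mpow alpha (mpow s sigma *m rho *m mpow s sigma))))%:E
  else +oo%E.

Definition gibbs {n} (beta : R) (H : 'M[C]_n) : 'M[C]_n :=
  let E := fcalc (fun x => expR (- beta * x)) H in
  rC ((rtrace E)^-1) *: E.

Definition lin_map {m n} (N : 'M[C]_m -> 'M[C]_n) : Prop :=
  forall (a : C) X Y, N (a *: X + Y) = a *: N X + N Y.

(* N (x) M on matrix units, extended linearly; composite index (i,k) of
   C^m1 (x) C^m2 is mxtens_index (i, k), matching the Kronecker product *t *)
Definition tensmap {m1 n1 m2 n2} (N : 'M[C]_m1 -> 'M[C]_n1)
    (M : 'M[C]_m2 -> 'M[C]_n2) : 'M[C]_(m1 * m2) -> 'M[C]_(n1 * n2) :=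
  fun X => \sum_(i < m1) \sum_(j < m1) \sum_(k < m2) \sum_(l < m2)
    X (mxtens_index (i, k)) (mxtens_index (j, l)) *:
      (N (delta_mx i j) *t M (delta_mx k l)).

Definition idtens {k m n} (N : 'M[C]_m -> 'M[C]_n) : 'M[C]_(k * m) -> 'M[C]_(k * n) :=
  tensmap (fun X : 'M[C]_k => X) N.

Definition is_channel {m n} (N : 'M[C]_m -> 'M[C]_n) : Prop :=
  [/\ lin_map N,
      (forall k (X : 'M[C]_(k * m)), psd X -> psd (@idtens k m n N X))
    & forall X, \tr (N X) = \tr X].

Definition thermal {m n} (beta : R) (H : 'M[C]_n) : 'M[C]_m -> 'M[C]_n :=
  fun Y => \tr Y *: gibbs beta H.

Definition replacer {m n} (omega : 'M[C]_n) : 'M[C]_m -> 'M[C]_n :=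
  fun Y => \tr Y *: omega.

Definition chdiv (Dv : forall n, 'M[C]_n -> 'M[C]_n -> \bar R) {m n}
    (N M : 'M[C]_m -> 'M[C]_n) : \bar R :=
  ereal_sup [set x | exists k (psi : 'M[C]_(k * m)), is_state psi /\
     x = Dv _ (@idtens k m n N psi) (@idtens k m n M psi)].

Definition Fch (beta : R) {m n} (H : 'M[C]_n) (N : 'M[C]_m -> 'M[C]_n) : \bar R :=
  ((beta^-1)%:E * chdiv (fun k => @relent k) N (thermal beta H))%E.

Definition Fch_alpha (alpha beta : R) {m n} (H : 'M[C]_n) (N : 'M[C]_m -> 'M[C]_n)
  : \bar R :=
  ((beta^-1)%:E * chdiv (fun k => @sandwiched k alpha) N (thermal beta H))%E.

Definition tnorm {m} (X : 'M[C]_m) : R := rtrace (fcalc Num.sqrt (adjmx X *m X)).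

Definition diamond {m n} (D : 'M[C]_m -> 'M[C]_n) : \bar R :=
  ereal_sup [set x | exists k (X : 'M[C]_(k * m)), tnorm X <= 1 /\
     x = (tnorm (@idtens k m n D X))%:E].

Definition supmap {e m' m n' n} (P : 'M[C]_n' -> 'M[C]_(e * m'))
    (Q : 'M[C]_(e * m) -> 'M[C]_n) (N : 'M[C]_m' -> 'M[C]_m) : 'M[C]_n' -> 'M[C]_n :=
  fun X => Q (@idtens e m' m N (P X)).

(* A candidate free energy: input dim m, output dim n, output Hamiltonian,
   channel.  (Input Hamiltonians play no role in any of the notions.) *)
Definition fe_t := forall m n, 'M[C]_n -> ('M[C]_m -> 'M[C]_n) -> \bar R.

Definition prop_A1 (f : fe_t) (beta : R) : Prop :=
  forall m' m n' n (HA : 'M[C]_m) (HB : 'M[C]_n),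
  (0 < m')%N -> (0 < m)%N -> (0 < n')%N -> (0 < n)%N ->
  hermitian HA -> hermitian HB ->
  forall e (P : 'M[C]_n' -> 'M[C]_(e * m')) (Q : 'M[C]_(e * m) -> 'M[C]_n),
  is_channel P -> is_channel Q ->
  supmap P Q (thermal beta HA) = thermal beta HB ->
  forall N : 'M[C]_m' -> 'M[C]_m, is_channel N ->
  (f _ _ HB (supmap P Q N) <= f _ _ HA N)%E.

Definition prop_A2 (f : fe_t) (Dst : forall n, 'M[C]_n -> 'M[C]_n -> \bar R)
    (beta : R) : Prop :=
  forall m n (H : 'M[C]_n), (0 < m)%N -> (0 < n)%N -> hermitian H ->
  forall omega : 'M[C]_n, is_state omega ->
  f m n H (replacer omega) = ((beta^-1)%:E * Dst n omega (gibbs beta H))%E.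

Definition prop_A3 (f : fe_t) (beta : R) : Prop :=
  forall m n (H : 'M[C]_n), (0 < m)%N -> (0 < n)%N -> hermitian H ->
  forall N : 'M[C]_m -> 'M[C]_n, is_channel N ->
  (0 <= f m n H N)%E /\ (f m n H N = 0%E <-> N = thermal beta H).

Definition prop_A4 (f : fe_t) : Prop :=
  forall m n (H : 'M[C]_n), (0 < m)%N -> (0 < n)%N -> hermitian H ->
  forall eps : R, 0 < eps -> exists2 delta : R, 0 < delta &
  forall N M : 'M[C]_m -> 'M[C]_n, is_channel N -> is_channel M ->
  (diamond (fun X => (N X - M X)%R) <= (2 * delta)%R%:E)%E ->
  (`|f m n H N - f m n H M| <= eps%:E)%E.

Definition prop_A5 (f : fe_t) : Prop :=
  forall m1 n1 m2 n2 (H1 : 'M[C]_n1) (H2 : 'M[C]_n2),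
  (0 < m1)%N -> (0 < n1)%N -> (0 < m2)%N -> (0 < n2)%N ->
  hermitian H1 -> hermitian H2 ->
  forall (N : 'M[C]_m1 -> 'M[C]_n1) (M : 'M[C]_m2 -> 'M[C]_n2),
  is_channel N -> is_channel M ->
  f _ _ (H1 *t (1%:M : 'M[C]_n2) + (1%:M : 'M[C]_n1) *t H2) (tensmap N M)
  = (f _ _ H1 N + f _ _ H2 M)%E.

Definition prop_A6 (f : fe_t) : Prop :=
  forall m n (H : 'M[C]_n), (0 < m)%N -> (0 < n)%N -> hermitian H ->
  forall (N M : 'M[C]_m -> 'M[C]_n), is_channel N -> is_channel M ->
  forall p : R, 0 <= p <= 1 ->
  (f m n H (fun X => (rC p *: N X + rC (1 - p) *: M X)%R)
   <= p%:E * f m n H N + (1 - p)%R%:E * f m n H M)%E.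

Definition prop_quasiconvex (f : fe_t) : Prop :=
  forall m n (H : 'M[C]_n), (0 < m)%N -> (0 < n)%N -> hermitian H ->
  forall (X : finType) (p : X -> R), (forall x, 0 <= p x) -> \sum_(x : X) p x = 1 ->
  forall Ns : X -> ('M[C]_m -> 'M[C]_n), (forall x, is_channel (Ns x)) ->
  (f m n H (fun Y => (\sum_(x : X) rC (p x) *: Ns x Y)%R)
   <= \big[maxe/-oo%E]_(x : X) f m n H (Ns x))%E.

End Quantum.

(* Main.v *)
Require Import Defs.
From HB Require Import structures.
From mathcomp Require Import all_boot all_order all_algebra.
From mathcomp Require Import all_classical all_reals all_analysis.
From mathcomp Require Import complex mxtens spectral ring lra.

(** The formula [tr f(A) g(B) = sum_ij |<u_i, v_j>|^2 f(a_i) g(b_j)], with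
    [u_i, v_j] eigenvectors of [A, B], reduces trace inequalities to scalar ones.

    (1) Interpolation (Uhlmann): if a linear map [J] satisfies
    [tr J(X)^* J(X) B <= tr X^* X B'] and [tr J(X)^* A J(X) <= tr X^* A' X] for
    all [X], then [tr J(X)^* A^t J(X) B^(1-t) <= tr X^* A'^t X B'^(1-t)] for
    [0 < t < 1].  The functions [phi(a, b)] that have such a monotonicity
    property are closed under sums, parallel sums and limits; the
    arithmetic-harmonic iteration then yields geometric means, and bisection
    all exponents.

    (2) The data-processing inequality follows.  For the relative entropy,
    differentiate (1) at [t = 0].  For the sandwiched divergences (Frank and
    Lieb), write [tr (s^(-p/2) r s^(-p/2))^alpha], with [p = (alpha - 1)/alpha],
    as a supremum over [H >= 0] of
    [alpha tr H r - (alpha - 1) tr (H^(1/2) s^p H^(1/2))^(1/p)] by Young's trace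
    inequality, and control the last term by (1).

    (3) Additivity.  For the relative entropy this is a chain rule.  For the
    sandwiched divergences, the substitution [psi = Y_R^((alpha-1)/2) Y
    Y_R^((alpha-1)/2)] turns the channel divergence into the best constant in
    [|| gamma^s N(Y) gamma^s ||_alpha <= C || Y_R ||_alpha], [Y >= 0], which is
    submultiplicative under composition.

    (4) Continuity.  A small diamond distance gives [N <= M + e T] in the
    completely positive order; convexity and monotonicity then bound the
    difference of the divergences independently of the reference system. *)

Set Implicit Arguments.
Unset Strict Implicit.
Unset Printing Implicit Defensive.

Import Order.TTheory GRing.Theory Num.Theory.
Import Defs numFieldNormedType.Exports.
Local Open Scope classical_set_scope.
Local Open Scope ring_scope.

(** * Matrices, adjoints and functional calculus *)

Notation "X ^h" := (adjmx X) (at level 8, format "X ^h").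
Notation specd A U d := (spec_decomp A (U, d)).

(** The reference system of a channel divergence has unbounded dimension, and this shapes every
    estimate: constants may depend on the dimensions of the channel and on the Gibbs state, never on
    the reference. Because the Gibbs state has full rank, every channel output is bounded by a fixed
    multiple of the thermal output on the same input, so all suprema are finite and support
    conditions hold automatically. The inputs themselves may have any rank; negative powers and
    logarithms therefore live on supports, and each formula has to check that the kernel contributes
    nothing.

    In the interpolation step [A] and [B] do not commute, but left multiplication by [A] and right
    multiplication by [B] do, which is why functions of two scalars suffice.

    (A1)-(A5) rest on a short list of facts about state divergences, collected in [divergence], and
    are proved once from that list. Its unusual entry is [div_chain]: a tensor product of channels
    can be probed with entangled inputs, so additivity on product states alone does not bound it
    from above. *)

Section Basics.
Variable R : realType.
Local Notation C := R[i].

Lemma rC_is_zmod_morphism : zmod_morphism (@rC R).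
Proof. exact: (@real_complex_is_additive R). Qed.
Lemma rC_is_monoid_morphism : monoid_morphism (@rC R).
Proof. by split=> //; move=> x y; rewrite /rC; simpc. Qed.
HB.instance Definition _ := GRing.isZmodMorphism.Build R C (@rC R) rC_is_zmod_morphism.
HB.instance Definition _ := GRing.isMonoidMorphism.Build R C (@rC R) rC_is_monoid_morphism.

Lemma rC1 : rC (1 : R) = 1. Proof. by []. Qed.
Lemma rCM (x y : R) : rC (x * y) = rC x * rC y.
Proof. exact: (rmorphM (@rC R)). Qed.
Lemma rCD (x y : R) : rC (x + y) = rC x + rC y.
Proof. exact: (rmorphD (@rC R)). Qed.
Lemma rCB (x y : R) : rC (x - y) = rC x - rC y.
Proof. exact: (rmorphB (@rC R)). Qed.
Lemma rCZ m n (x y : R) (A : 'M[C]_(m, n)) : rC x *: (rC y *: A) = rC (x * y) *: A.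
Proof. by rewrite scalerA -rCM. Qed.

Lemma conj_rC (x : R) : conjc (rC x) = rC x.
Proof. by rewrite /rC /= oppr0. Qed.

Lemma Re_rCM (x : R) (z : C) : complex.Re (rC x * z) = x * complex.Re z.
Proof. by case: z => a b /=; rewrite mul0r subr0. Qed.

Lemma ReD (y z : C) : complex.Re (y + z) = complex.Re y + complex.Re z.
Proof. by case: y z => a b [c d]. Qed.

Lemma Re_sum (I : Type) (r : seq I) (P : pred I) (F : I -> C) :
  complex.Re (\sum_(i <- r | P i) F i) = \sum_(i <- r | P i) complex.Re (F i).
Proof. by apply: big_morph => // x y; exact: ReD. Qed.

Lemma Re_conj (z : C) : complex.Re (conjc z) = complex.Re z.
Proof. by case: z. Qed.

Definition nsq (z : C) : R := complex.Re z ^+ 2 + complex.Im z ^+ 2.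

Lemma nsq_ge0 z : 0 <= nsq z.
Proof. by rewrite addr_ge0 ?sqr_ge0. Qed.

Lemma nsq_eq0 z : (nsq z == 0) = (z == 0).
Proof.
case: z => a b; rewrite /nsq /= paddr_eq0 ?sqr_ge0// !sqrf_eq0.
by rewrite eq_complex.
Qed.

Lemma nsqE z : conjc z * z = rC (nsq z).
Proof. by case: z => a b; rewrite /nsq /rC /=; simpc; congr Complex; ring. Qed.

Lemma nsqE2 z : z * conjc z = rC (nsq z).
Proof. by rewrite mulrC nsqE. Qed.

Lemma nsq_conj z : nsq (conjc z) = nsq z.
Proof. by case: z => a b; rewrite /nsq /= sqrrN. Qed.

Lemma nsqM y z : nsq (y * z) = nsq y * nsq z.
Proof. by case: y z => a b [c d]; rewrite /nsq /=; ring. Qed.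

Lemma nsq_rC x : nsq (rC x) = x ^+ 2.
Proof. by rewrite /nsq /= expr0n addr0. Qed.

Lemma le0cE (z : C) : (0 <= z) = (complex.Im z == 0) && (0 <= complex.Re z).
Proof. by rewrite lecE. Qed.

Lemma rC_ge0 (x : R) : (0 <= rC x) = (0 <= x).
Proof. by rewrite le0cE /= eqxx. Qed.

Lemma adjmxE m n (A : 'M[C]_(m, n)) i j : A^h i j = conjc (A j i).
Proof. by rewrite !mxE. Qed.

Section Adj.
Variables m n p : nat.
Implicit Types (A : 'M[C]_(m, n)) (B : 'M[C]_(n, p)).

Lemma adjmxK A : A^h^h = A.
Proof. by apply/matrixP => i j; rewrite !adjmxE conjcK. Qed.
Lemma adjmxD A A' : (A + A')^h = A^h + A'^h.
Proof. by apply/matrixP => i j; rewrite !(adjmxE, mxE) rmorphD. Qed.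
Lemma adjmxN A : (- A)^h = - A^h.
Proof. by apply/matrixP => i j; rewrite !(adjmxE, mxE) rmorphN. Qed.
Lemma adjmxB A A' : (A - A')^h = A^h - A'^h.
Proof. by rewrite adjmxD adjmxN. Qed.
Lemma adjmx0 : (0 : 'M[C]_(m, n))^h = 0.
Proof. by apply/matrixP => i j; rewrite !(adjmxE, mxE) conjc0. Qed.
Lemma adjmxZ c A : (c *: A)^h = conjc c *: A^h.
Proof. by apply/matrixP => i j; rewrite !(adjmxE, mxE) rmorphM. Qed.
Lemma adjmxM A B : (A *m B)^h = B^h *m A^h.
Proof. by rewrite /adjmx map_mxM trmx_mul. Qed.
Lemma adjmx_sum (I : Type) (r : seq I) (P : pred I) (F : I -> 'M[C]_(m, n)) :
  (\sum_(i <- r | P i) F i)^h = \sum_(i <- r | P i) (F i)^h.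
Proof. by apply: big_morph; [exact: adjmxD|exact: adjmx0]. Qed.
End Adj.

Lemma adjmx1 n : (1%:M : 'M[C]_n)^h = 1%:M.
Proof. by rewrite /adjmx map_mx1 trmx1. Qed.

Lemma adjmx_tens m n p q (A : 'M[C]_(m, n)) (B : 'M[C]_(p, q)) :
  (A *t B)^h = A^h *t B^h.
Proof. by rewrite /adjmx map_mxT trmx_tens. Qed.

Lemma adjmx_diag n (d : 'rV[R]_n) :
  (diag_mx (map_mx (@rC R) d))^h = diag_mx (map_mx (@rC R) d).
Proof.
apply/matrixP => i j; rewrite !(adjmxE, mxE) eq_sym.
by case: eqP => [->|]; rewrite ?mulr1n ?conj_rC// !mulr0n conjc0.
Qed.

Lemma mul_diagE m n (f : R -> C) (b : 'rV[R]_m) (W : 'M[C]_(m, n)) i j :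
  (diag_mx (map_mx f b) *m W) i j = f (b 0 i) * W i j.
Proof. by rewrite mul_diag_mx mxE mxE. Qed.

Lemma mul_mx_diagE m n (f : R -> C) (b : 'rV[R]_n) (W : 'M[C]_(m, n)) i j :
  (W *m diag_mx (map_mx f b)) i j = W i j * f (b 0 j).
Proof. by rewrite mul_mx_diag mxE mxE. Qed.

Section Rtrace.
Variable n : nat.
Implicit Types A B : 'M[C]_n.

Lemma rtraceD A B : rtrace (A + B) = rtrace A + rtrace B.
Proof. by rewrite /rtrace mxtraceD ReD. Qed.
Lemma rtrace0 : rtrace (0 : 'M[C]_n) = 0.
Proof. by rewrite /rtrace mxtrace0. Qed.
Lemma rtraceZ c A : rtrace (rC c *: A) = c * rtrace A.
Proof. by rewrite /rtrace mxtraceZ Re_rCM. Qed.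
Lemma rtraceN A : rtrace (- A) = - rtrace A.
Proof. by rewrite -scaleN1r -(rmorph1 (@rC R)) -rmorphN rtraceZ mulN1r. Qed.
Lemma rtraceB A B : rtrace (A - B) = rtrace A - rtrace B.
Proof. by rewrite rtraceD rtraceN. Qed.
Lemma rtrace_sum (I : Type) (r : seq I) (P : pred I) (F : I -> 'M[C]_n) :
  rtrace (\sum_(i <- r | P i) F i) = \sum_(i <- r | P i) rtrace (F i).
Proof. by apply: big_morph; [exact: rtraceD|exact: rtrace0]. Qed.
Lemma rtrace_adj A : rtrace A^h = rtrace A.
Proof.
rewrite /rtrace /mxtrace !Re_sum; apply: eq_bigr => i _.
by rewrite adjmxE Re_conj.
Qed.
End Rtrace.

Lemma rtraceC m n (A : 'M[C]_(m, n)) (B : 'M[C]_(n, m)) :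
  rtrace (A *m B) = rtrace (B *m A).
Proof. by rewrite /rtrace mxtrace_mulC. Qed.

Lemma mxtrace_tens m n (A : 'M[C]_m) (B : 'M[C]_n) :
  \tr (A *t B) = \tr A * \tr B.
Proof.
by rewrite /mxtrace mulr_sum; apply: eq_bigr => i _; rewrite mxE.
Qed.

(** The squared Hilbert-Schmidt norm. *)
Definition hs m n (X : 'M[C]_(m, n)) : R := rtrace (X^h *m X).

Lemma hsE m n (X : 'M[C]_(m, n)) : hs X = \sum_i \sum_j nsq (X i j).
Proof.
rewrite /hs /rtrace /mxtrace Re_sum exchange_big; apply: eq_bigr => j _ /=.
rewrite mxE Re_sum; apply: eq_bigr => i _.
by rewrite adjmxE nsqE.
Qed.

Lemma hs_ge0 m n (X : 'M[C]_(m, n)) : 0 <= hs X.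
Proof. by rewrite hsE; do 2!(apply: sumr_ge0 => ? _); exact: nsq_ge0. Qed.

Lemma hs_eq0 m n (X : 'M[C]_(m, n)) : hs X = 0 -> X = 0.
Proof.
rewrite hsE => X0; apply/matrixP => i j; rewrite mxE; apply/eqP.
rewrite -nsq_eq0; move/eqP: X0.
rewrite psumr_eq0 => [/allP/(_ i)|k _]; last first.
  by apply: sumr_ge0 => ? _; exact: nsq_ge0.
rewrite mem_index_enum => /(_ isT) /=.
rewrite psumr_eq0 => [/allP/(_ j)|k _]; last exact: nsq_ge0.
by rewrite mem_index_enum => /(_ isT) /=.
Qed.

Lemma hs_adj m n (X : 'M[C]_(m, n)) : hs X^h = hs X.
Proof. by rewrite /hs adjmxK rtraceC. Qed.

Lemma unitaryC n (U : 'M[C]_n) : unitary U -> U^h *m U = 1%:M.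
Proof. exact: mulmx1C. Qed.

Lemma unitary_adj n (U : 'M[C]_n) : unitary U -> unitary U^h.
Proof. by rewrite /unitary adjmxK; exact: unitaryC. Qed.

Lemma spec_exists n (A : 'M[C]_n) : hermitian A ->
  exists U, exists d, specd A U d.
Proof.
move=> hA.
have Ah : A \is @hermitianmx C n false (@Num.conj C).
  apply/is_hermitianmxP; rewrite expr0 scale1r.
  by rewrite -[in LHS]hA; apply/matrixP => i j; rewrite !mxE.
have /hermitian_normalmx /orthomx_spectralP A_eq := Ah.
have /mxOverP dR := hermitian_spectral_diag_real Ah.
have Pu := spectral_unitarymx A.
set P := spectralmx A in A_eq Pu *.
have tE : map_mx (@Num.conj C) P^T = P^h by apply/matrixP => i j; rewrite !mxE.
(* The spectral theorem for normal matrices reads [A = P^-1 D P] with [P] unitary, so the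
   eigenvector matrix is the adjoint of [P]; the eigenvalues are real, hence equal to their real
   parts. *)
exists P^h, (\row_j complex.Re (spectral_diag A 0 j)); split=> /=.
  by rewrite /unitary adjmxK; apply: mulmx1C; rewrite -tE; exact/unitarymxP.
rewrite adjmxK; apply: (etrans A_eq); rewrite (invmx_unitary Pu) tE.
congr (_ *m diag_mx _ *m _).
by apply/rowP => j; rewrite !mxE; have := dR 0 j => /RRe_real {1}<-.
Qed.

(** Entrywise, [W i j] is nonzero only where the two eigenvalues agree, and then so do their images
    under [f]. *)
Lemma mul_diag_mx_comm n (W : 'M[C]_n) (d e : 'rV[R]_n) (f : R -> R) :
  diag_mx (map_mx (@rC R) e) *m W = W *m diag_mx (map_mx (@rC R) d) ->
  diag_mx (map_mx (fun x => rC (f x)) e) *m W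
    = W *m diag_mx (map_mx (fun x => rC (f x)) d).
Proof.
move=> /matrixP E; apply/matrixP => i j; have := E i j.
rewrite !mul_diag_mx !mul_mx_diag !mxE.
have [->|W0] := eqVneq (W i j) 0; first by rewrite !mulr0 !mul0r.
rewrite mulrC => /(mulfI W0) /complexI ->.
by rewrite mulrC.
Qed.

(** Two decompositions of [A] differ by the unitary [V^h *m U], which intertwines the two diagonals
    and hence, by [mul_diag_mx_comm], their images under [f]. This frees [fcalc] from the
    decomposition picked by [xget]. *)
Lemma fcalcE n (f : R -> R) (A : 'M[C]_n) U d : specd A U d ->
  fcalc f A = U *m diag_mx (map_mx (fun x => rC (f x)) d) *m U^h.
Proof.
move=> Ad; rewrite /fcalc; case: xgetP => [[V e] /= _ [uV Ae]|/(_ (U, d))//].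
case: Ad => /= uU Ad; rewrite /= in uV Ae.
have /(mul_diag_mx_comm f) :
    diag_mx (map_mx (@rC R) e) *m (V^h *m U)
    = (V^h *m U) *m diag_mx (map_mx (@rC R) d).
  have : V^h *m A *m U = V^h *m A *m U by [].
  rewrite {1}Ae Ad !mulmxA (unitaryC uV) mul1mx -!mulmxA (unitaryC uU) mulmx1.
  by [].
move=> /(congr1 (fun X => V *m X *m U^h)).
rewrite !mulmxA uV mul1mx => <-.
by rewrite -!mulmxA uU mulmx1.
Qed.

End Basics.

(** Locked copies of [fcalc] and [mpow], so that rewriting and unification never unfold them down to
    the chosen decomposition; [fcE] and [mpE] are their interface. *)
HB.lock Definition fc (R : realType) n (f : R -> R) (A : 'M[R[i]]_n) : 'M[R[i]]_n :=
  fcalc f A.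
HB.lock Definition mp (R : realType) n (t : R) (A : 'M[R[i]]_n) : 'M[R[i]]_n :=
  mpow t A.

Section FunctionalCalculus.
Variable R : realType.
Local Notation C := R[i].

Lemma fcE n (f : R -> R) (A : 'M[C]_n) U d : specd A U d ->
  fc f A = U *m diag_mx (map_mx (fun x => rC (f x)) d) *m U^h.
Proof. by rewrite fc.unlock; exact: fcalcE. Qed.

Lemma mpE n t (A : 'M[C]_n) : mp t A = fc (fun x : R => x `^ t) A.
Proof. by rewrite mp.unlock fc.unlock. Qed.

Section Fcalc.
Variable n : nat.
Implicit Types (A : 'M[C]_n) (f g : R -> R).

Lemma fcalc_specd f A U d : specd A U d -> specd (fc f A) U (map_mx f d).
Proof.
move=> Ad; split; first by case: Ad.
by rewrite (fcE f Ad) -map_mx_comp.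
Qed.

Lemma specd_herm A U d : specd A U d -> hermitian A.
Proof.
by move=> [/= uU ->]; rewrite /hermitian !adjmxM adjmxK adjmx_diag mulmxA.
Qed.

Lemma fcalc_herm f A : hermitian A -> hermitian (fc f A).
Proof. by move=> /spec_exists[U [d /(fcalc_specd f)/specd_herm]]. Qed.

Lemma fcalc_id f A : hermitian A -> (forall x, f x = x) -> fc f A = A.
Proof.
move=> /spec_exists[U [d Ad]] fE; rewrite (fcE f Ad); case: Ad => _ /= AE; rewrite [RHS]AE.
by congr (_ *m diag_mx _ *m _); apply/rowP => i; rewrite !mxE fE.
Qed.

Lemma fcalc_comp f g A : hermitian A -> fc f (fc g A) = fc (f \o g) A.
Proof.
move=> /spec_exists[U [d Ad]]; rewrite (fcE _ (fcalc_specd g Ad)) (fcE _ Ad).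
by congr (_ *m diag_mx _ *m _); apply/rowP => i; rewrite !mxE.
Qed.

Lemma fcalcM f g A : hermitian A ->
  fc f A *m fc g A = fc (fun x => f x * g x) A.
Proof.
move=> /spec_exists[U [d Ad]]; rewrite !(fcE _ Ad).
case: Ad => /= uU _.
rewrite !mulmxA -(mulmxA _ U^h U) (unitaryC uU) mulmx1 -(mulmxA U); congr (_ *m _ *m _).
rewrite mulmx_diag; congr diag_mx; apply/rowP => i; rewrite !mxE.
by rewrite rmorphM.
Qed.

Lemma fcalcD f g A : hermitian A ->
  fc f A + fc g A = fc (fun x => f x + g x) A.
Proof.
move=> /spec_exists[U [d Ad]]; rewrite !(fcE _ Ad).
rewrite -mulmxDl -mulmxDr; congr (_ *m _ *m _).
by rewrite -raddfD; congr diag_mx; apply/rowP => i; rewrite !mxE rmorphD.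
Qed.

Lemma fcalcZ c f A : hermitian A -> rC c *: fc f A = fc (fun x => c * f x) A.
Proof.
move=> /spec_exists[U [d Ad]]; rewrite !(fcE _ Ad).
rewrite scalemxAl scalemxAr; congr (_ *m _ *m _).
rewrite -linearZ /=; congr diag_mx; apply/rowP => i; rewrite !mxE.
by rewrite rmorphM.
Qed.

Lemma fcalc_cst c f A : hermitian A -> (forall x, f x = c) -> fc f A = (rC c)%:M.
Proof.
move=> /spec_exists[U [d Ad]] fE; rewrite (fcE f Ad).
have -> : diag_mx (map_mx (fun x => rC (f x)) d) = (rC c)%:M.
  by rewrite -diag_const_mx; congr diag_mx; apply/rowP => i; rewrite !mxE fE.
case: Ad => /= uU _.
by rewrite mul_mx_scalar -scalemxAl uU scale_scalar_mx mulr1.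
Qed.

Lemma specd_ext f g A U d : specd A U d ->
  (forall i, f (d 0 i) = g (d 0 i)) -> fc f A = fc g A.
Proof.
move=> Ad fg; rewrite !(fcE _ Ad); congr (_ *m diag_mx _ *m _).
by apply/rowP => i; rewrite !mxE fg.
Qed.

Lemma rtrace_fcalc f A U d : specd A U d ->
  rtrace (fc f A) = \sum_i f (d 0 i).
Proof.
move=> Ad; rewrite (fcE f Ad); case: Ad => /= uU _.
rewrite rtraceC mulmxA unitaryC// mul1mx /rtrace mxtrace_diag Re_sum.
by apply: eq_bigr => i _; rewrite mxE.
Qed.
End Fcalc.

Lemma rtrace_diag_form p q (Y : 'M[C]_(p, q)) (a : 'rV[R]_p) (b : 'rV[R]_q) :
  rtrace (Y^h *m diag_mx (map_mx (@rC R) a) *m Y *m diag_mx (map_mx (@rC R) b))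
  = \sum_i \sum_j nsq (Y i j) * (a 0 i * b 0 j).
Proof.
rewrite /rtrace /mxtrace Re_sum exchange_big; apply: eq_bigr => j _ /=.
rewrite mul_mx_diag !mxE mulr_suml Re_sum; apply: eq_bigr => i _.
rewrite mul_mx_diag !mxE; set y := Y i j.
have -> : conjc y * rC (a 0 i) * y * rC (b 0 j) = rC (nsq y * (a 0 i * b 0 j)).
  by rewrite !rmorphM /= -nsqE; ring.
by [].
Qed.

(** The entries of [U^h *m X *m V] are the coordinates of [X] in the joint eigenbasis of left
    multiplication by [A] and right multiplication by [B]. *)
Lemma rtrace_form p q (X : 'M[C]_(p, q)) f g A B U V a b :
  specd A U a -> specd B V b ->
  rtrace (X^h *m fc f A *m X *m fc g B)
  = \sum_i \sum_j nsq ((U^h *m X *m V) i j) * (f (a 0 i) * g (b 0 j)).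
Proof.
move=> Aa Bb; transitivity (\sum_i \sum_j nsq ((U^h *m X *m V) i j) *
    (map_mx f a 0 i * map_mx g b 0 j)); last first.
  by apply: eq_bigr => i _; apply: eq_bigr => j _; rewrite !mxE.
rewrite -rtrace_diag_form (fcE f Aa) (fcE g Bb) -!map_mx_comp.
by rewrite !mulmxA rtraceC !adjmxM adjmxK !mulmxA.
Qed.

Lemma rtrace_form1 n f g (A B : 'M[C]_n) U V a b :
  specd A U a -> specd B V b ->
  rtrace (fc f A *m fc g B)
  = \sum_i \sum_j nsq ((U^h *m V) i j) * (f (a 0 i) * g (b 0 j)).
Proof.
move=> Aa Bb; have := rtrace_form 1%:M f g Aa Bb.
by rewrite adjmx1 mul1mx !mulmx1.
Qed.

Lemma nsq_unitary_row n (W : 'M[C]_n) i : unitary W -> \sum_j nsq (W i j) = 1.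
Proof.
move=> /matrixP/(_ i i); rewrite !mxE eqxx.
move=> /(congr1 (@complex.Re R)) /= <-; rewrite Re_sum.
by apply: eq_bigr => j _; rewrite adjmxE nsqE2.
Qed.

Lemma nsq_unitary_col n (W : 'M[C]_n) j : unitary W -> \sum_i nsq (W i j) = 1.
Proof.
move=> /unitary_adj/(@nsq_unitary_row _ _ j) <-.
by apply: eq_bigr => i _; rewrite adjmxE nsq_conj.
Qed.

Lemma unitaryM n (U V : 'M[C]_n) : unitary U -> unitary V -> unitary (U *m V).
Proof. by move=> uU uV; rewrite /unitary adjmxM mulmxA -(mulmxA U) uV mulmx1. Qed.

End FunctionalCalculus.

(** * Positive semidefinite matrices *)

Section Psd.
Variable R : realType.
Local Notation C := R[i].

Lemma quad_diag n (v : 'rV[C]_n) (d : 'rV[R]_n) :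
  (v *m diag_mx (map_mx (@rC R) d) *m v^h) 0 0
  = rC (\sum_i nsq (v 0 i) * d 0 i).
Proof.
rewrite mxE rmorph_sum; apply: eq_bigr => i _.
by rewrite mul_mx_diag mxE adjmxE mxE rmorphM /= -nsqE2; ring.
Qed.

Lemma quad_form n (v : 'rV[C]_n) (A : 'M[C]_n) U d : specd A U d ->
  (v *m A *m v^h) 0 0 = rC (\sum_i nsq ((v *m U) 0 i) * d 0 i).
Proof.
move=> [/= uU ->]; rewrite -quad_diag adjmxM.
by rewrite !mulmxA.
Qed.

Lemma specd_psd n (A : 'M[C]_n) U d : specd A U d ->
  (forall i, 0 <= d 0 i) -> psd A.
Proof.
move=> Ad d0; split=> [|v]; first exact: specd_herm Ad.
rewrite (quad_form _ Ad) rC_ge0; apply: sumr_ge0 => i _.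
by rewrite mulr_ge0 ?nsq_ge0.
Qed.

Lemma psd_specd n (A : 'M[C]_n) U d : psd A -> specd A U d ->
  forall i, 0 <= d 0 i.
Proof.
move=> [hA /(_ (row _ U^h)) qA] Ad i.
have := qA i; rewrite (quad_form _ Ad) rC_ge0; case: Ad => /= uU _.
rewrite (bigD1 i)//= big1 ?addr0 => [|j ji].
  rewrite -row_mul unitaryC// !mxE eqxx.
  by rewrite (_ : nsq _ = 1) ?mul1r// /nsq /= expr1n expr0n addr0.
rewrite -row_mul unitaryC// !mxE eq_sym (negbTE ji).
by rewrite /nsq /= expr0n addr0 mul0r.
Qed.

Lemma psd_spec n (A : 'M[C]_n) : psd A ->
  exists U, exists d, specd A U d /\ forall i, 0 <= d 0 i.
Proof.
move=> pA; have [U [d Ad]] := spec_exists pA.1.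
by exists U, d; split=> //; exact: psd_specd Ad.
Qed.

Lemma psd_fcalc n (f : R -> R) (A : 'M[C]_n) : psd A ->
  (forall x, 0 <= x -> 0 <= f x) -> psd (fc f A).
Proof.
move=> /psd_spec[U [d [Ad d0]]] f0.
by apply: (specd_psd (fcalc_specd f Ad)) => i; rewrite mxE f0.
Qed.

Lemma psd_ext n (f g : R -> R) (A : 'M[C]_n) : psd A ->
  (forall x, 0 <= x -> f x = g x) -> fc f A = fc g A.
Proof.
by move=> /psd_spec[U [d [Ad d0]]] fg; apply: (specd_ext Ad) => i; rewrite fg.
Qed.

Lemma psd_fcalc_id n (f : R -> R) (A : 'M[C]_n) : psd A ->
  (forall x, 0 <= x -> f x = x) -> fc f A = A.
Proof. by move=> pA fE; rewrite (psd_ext pA fE) (fcalc_id pA.1). Qed.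

Lemma psd0 n : psd (0 : 'M[C]_n).
Proof.
by split=> [|v]; [exact: adjmx0|rewrite mulmx0 mul0mx mxE].
Qed.

Lemma psdD n (A B : 'M[C]_n) : psd A -> psd B -> psd (A + B).
Proof.
move=> [hA qA] [hB qB]; split=> [|v]; first by rewrite /hermitian adjmxD hA hB.
by rewrite mulmxDr mulmxDl mxE addr_ge0.
Qed.

Lemma psdZ n c (A : 'M[C]_n) : 0 <= c -> psd A -> psd (rC c *: A).
Proof.
move=> c0 [hA qA]; split=> [|v]; first by rewrite /hermitian adjmxZ conj_rC hA.
by rewrite -scalemxAr -scalemxAl mxE mulr_ge0 ?rC_ge0.
Qed.

Lemma psd_sum n (I : Type) (r : seq I) (P : pred I) (F : I -> 'M[C]_n) :
  (forall i, P i -> psd (F i)) -> psd (\sum_(i <- r | P i) F i).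
Proof. by move=> pF; apply: big_ind pF; [exact: psd0|exact: psdD]. Qed.

Lemma psd_conj m n (X : 'M[C]_(m, n)) (A : 'M[C]_n) : psd A ->
  psd (X *m A *m X^h).
Proof.
move=> [hA qA]; split=> [|v]; first by rewrite /hermitian !adjmxM adjmxK hA mulmxA.
by have := qA (v *m X); rewrite adjmxM !mulmxA.
Qed.

Lemma psd1 n : psd (1%:M : 'M[C]_n).
Proof.
split=> [|v]; first exact: adjmx1.
rewrite mulmx1 mxE; apply: sumr_ge0 => i _.
by rewrite adjmxE nsqE2 rC_ge0 nsq_ge0.
Qed.

Lemma psd_gram m n (X : 'M[C]_(m, n)) : psd (X *m X^h).
Proof. by rewrite -[X in X *m _]mulmx1; apply: psd_conj; exact: psd1. Qed.

Lemma psd_sqrt n (A : 'M[C]_n) : psd A -> exists S : 'M[C]_n, S *m S^h = A.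
Proof.
move=> pA; exists (fc Num.sqrt A).
rewrite (fcalc_herm _ pA.1) (fcalcM _ _ pA.1).
by apply: psd_fcalc_id => // x x0; rewrite -expr2 sqr_sqrtr.
Qed.

Lemma rtrace_psd n (A : 'M[C]_n) : psd A -> 0 <= rtrace A.
Proof. by move=> /psd_sqrt[S <-]; rewrite rtraceC; exact: hs_ge0. Qed.

Lemma rtrace_psdM n (A B : 'M[C]_n) : psd A -> psd B -> 0 <= rtrace (A *m B).
Proof.
move=> /psd_sqrt[S <-] /psd_sqrt[T <-].
rewrite mulmxA rtraceC !mulmxA -(mulmxA _ _ T).
have -> : T^h *m S = (S^h *m T)^h by rewrite adjmxM adjmxK.
exact: hs_ge0.
Qed.

Lemma psd_rtrace0 n (A : 'M[C]_n) : psd A -> rtrace A = 0 -> A = 0.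
Proof.
move=> /psd_sqrt[S <-]; rewrite rtraceC => /hs_eq0 ->.
by rewrite mul0mx.
Qed.

Lemma herm_tr n (A : 'M[C]_n) : hermitian A -> \tr A = rC (rtrace A).
Proof.
move=> hA; rewrite /rtrace /mxtrace Re_sum rmorph_sum; apply: eq_bigr => i _.
move/matrixP: hA => /(_ i i); rewrite adjmxE; case: (A i i) => a b /= [] /eqP.
by rewrite -subr_eq0 -opprD oppr_eq0 -mulr2n mulrn_eq0 /= => /eqP ->.
Qed.

Lemma is_stateE n (A : 'M[C]_n) : is_state A <-> psd A /\ rtrace A = 1.
Proof.
split=> [[pA tA]|[pA tA]]; split=> //; first by rewrite /rtrace tA.
by rewrite herm_tr ?tA ?rmorph1//; case: pA.
Qed.

Lemma mulmx_quad0 n (A : 'M[C]_n) (v : 'rV[C]_n) : psd A ->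
  (v *m A *m v^h) 0 0 = 0 -> v *m A = 0.
Proof.
move=> /psd_sqrt[S <-]; rewrite mulmxA -(mulmxA _ _ v^h) -adjmxM => E.
suff -> : v *m S = 0 by rewrite mul0mx.
rewrite -[LHS]adjmxK; have -> : (v *m S)^h = 0; last by rewrite adjmx0.
apply: hs_eq0; rewrite /hs adjmxK /rtrace mxtrace_mulC.
rewrite mxtrace_mulC /mxtrace big_ord1.
by rewrite E.
Qed.

(** The Loewner order. *)
Definition lep n (A B : 'M[C]_n) : Prop := psd (B - A).

Lemma lep_rtraceM n (A B X : 'M[C]_n) : psd X -> lep A B ->
  rtrace (A *m X) <= rtrace (B *m X).
Proof.
by move=> pX AB; rewrite -subr_ge0 -rtraceB -mulmxBl; exact: rtrace_psdM.
Qed.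

Lemma lep_trans n (B A D : 'M[C]_n) : lep A B -> lep B D -> lep A D.
Proof. by move=> AB BD; have := psdD AB BD; rewrite addrC subrKA. Qed.

Lemma lep_refl n (A : 'M[C]_n) : lep A A.
Proof. by rewrite /lep subrr; exact: psd0. Qed.

Lemma lepD n (A B A' B' : 'M[C]_n) : lep A B -> lep A' B' -> lep (A + A') (B + B').
Proof. by move=> AB BD; have := psdD AB BD; rewrite /lep opprD addrACA. Qed.

Lemma lepZ n c (A B : 'M[C]_n) : 0 <= c -> lep A B -> lep (rC c *: A) (rC c *: B).
Proof. by move=> c0 AB; rewrite /lep -scalerBr; exact: psdZ. Qed.

Lemma lep_conj m n (X : 'M[C]_(m, n)) A B : lep A B ->
  lep (X *m A *m X^h) (X *m B *m X^h).
Proof. by move=> AB; rewrite /lep -mulmxBl -mulmxBr; exact: psd_conj. Qed.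

(** A vector [w] in the kernel of [B] satisfies [w^h A w <= 0], so positivity of [A] forces
    [A w = 0]. Row-space inclusion is this statement for the columns of [cokermx B]. *)
Lemma lep_submx n c (A B : 'M[C]_n) : psd A -> psd B -> lep A (rC c *: B) ->
  (A <= B)%MS.
Proof.
move=> pA pB AB; rewrite submxE; apply/eqP/matrixP => i j.
pose w := col j (cokermx B).
have Bw : B *m w = 0 by rewrite /w colE mulmxA mulmx_coker mul0mx.
have wB : w^h *m B = 0 by rewrite -pB.1 -adjmxM Bw adjmx0.
have wA : (w^h *m A *m w^h^h) 0 0 = 0.
  have [_ /(_ w^h)] := AB.
  rewrite mulmxBr mulmxBl -scalemxAr wB scaler0 mul0mx sub0r mxE => le0.
  by apply/eqP; rewrite eq_le -oppr_ge0 le0 /=; exact: pA.2.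
have /(mulmx_quad0 pA) := wA; move=> /(congr1 (@adjmx _ _ _)).
rewrite adjmxM adjmxK pA.1 adjmx0 /w colE mulmxA -colE => /colP/(_ i).
by rewrite !mxE.
Qed.

(** Kernel vectors of [A] are orthogonal to eigenvectors of [B] with nonzero eigenvalue. In overlap
    sums this removes exactly the terms in which [ln 0] or a negative power of 0 would be
    meaningless. *)
Lemma submx_overlap n (A B : 'M[C]_n) U V a b : (B <= A)%MS ->
  specd A U a -> specd B V b ->
  forall i j, a 0 i = 0 -> b 0 j != 0 -> (U^h *m V) i j = 0.
Proof.
move=> /submxP[D BE] [/= uU AE] [/= uV BE'] i j ai bj.
have E : V^h *m B *m U = diag_mx (map_mx (@rC R) b) *m (V^h *m U).
  by rewrite BE' !mulmxA (unitaryC uV) mul1mx.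
have E2 : V^h *m B *m U = V^h *m D *m U *m diag_mx (map_mx (@rC R) a).
  by rewrite BE AE -!mulmxA (unitaryC uU) mulmx1.
have /matrixP/(_ j i) : diag_mx (map_mx (@rC R) b) *m (V^h *m U)
    = V^h *m D *m U *m diag_mx (map_mx (@rC R) a) by rewrite -E.
rewrite mul_diagE mul_mx_diagE ai rmorph0 mulr0 => /eqP.
rewrite mulf_eq0 fmorph_eq0 (negbTE bj) /= => /eqP W0.
have -> : U^h *m V = (V^h *m U)^h by rewrite adjmxM adjmxK.
by rewrite adjmxE W0 conjc0.
Qed.

End Psd.

(** * Supports, generalized powers and overlap sums *)

HB.lock Definition supp (R : realType) n (A : 'M[R[i]]_n) : 'M[R[i]]_n :=
  fc (fun x => (x != 0)%:R) A.

Section Support.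
Variable R : realType.
Local Notation C := R[i].

Lemma suppE n (A : 'M[C]_n) : supp A = fc (fun x => (x != 0)%:R) A.
Proof. by rewrite supp.unlock. Qed.

Lemma supp_herm n (A : 'M[C]_n) : hermitian A -> hermitian (supp A).
Proof. by rewrite suppE; exact: fcalc_herm. Qed.

Lemma mul_supp n (A : 'M[C]_n) : hermitian A -> A *m supp A = A.
Proof.
move=> hA; rewrite suppE -{1}(@fcalc_id _ _ id _ hA)// (fcalcM _ _ hA).
apply: fcalc_id => // x.
by have [->|] := eqVneq x 0; rewrite ?mulr0 ?mulr1.
Qed.

Lemma submx_supp m n (B : 'M[C]_(m, n)) (A : 'M[C]_n) : hermitian A -> (B <= A)%MS ->
  B *m supp A = B.
Proof. by move=> hA /submxP[D ->]; rewrite -mulmxA mul_supp. Qed.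

Lemma submx_suppl n (B A : 'M[C]_n) : hermitian A -> hermitian B -> (B <= A)%MS ->
  supp A *m B = B.
Proof.
move=> hA hB /(submx_supp hA)/(congr1 (@adjmx _ _ _)).
by rewrite adjmxM (supp_herm hA) hB.
Qed.

Section Mpow.
Variable n : nat.
Implicit Type A : 'M[C]_n.

Lemma psd_mpow t A : psd A -> psd (mp t A).
Proof. by move=> pA; rewrite mpE; apply: psd_fcalc => // x _; exact: powR_ge0. Qed.

Lemma mpow_herm t A : psd A -> hermitian (mp t A).
Proof. by move=> /(psd_mpow t)[]. Qed.

Lemma mpow1 A : psd A -> mp 1 A = A.
Proof. by move=> pA; rewrite mpE; apply: psd_fcalc_id => // x x0; rewrite powRr1. Qed.

(** The power [0^t] is 0 for every nonzero [t], negative ones included, but 1 for [t = 0]. Exponents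
    with nonzero sum add also on the kernel; opposite exponents produce the support projection
    instead, see [mpowV]. *)
Lemma mpowD t s A : psd A -> t + s != 0 -> mp t A *m mp s A = mp (t + s) A.
Proof.
move=> pA ts; rewrite !mpE fcalcM; last exact: pA.1.
by apply: psd_ext => // x _; rewrite powRD// (negbTE ts).
Qed.

Lemma mpowV t s A : psd A -> t != 0 -> t + s = 0 -> mp t A *m mp s A = supp A.
Proof.
move=> pA t0 /eqP; rewrite addrC addr_eq0 => /eqP ->.
rewrite !mpE suppE fcalcM; last exact: pA.1.
apply: psd_ext => // x _; rewrite powRN.
have [->|x0] := eqVneq x 0; first by rewrite powR0// mul0r.
by rewrite divff// powR_eq0 (negbTE x0).
Qed.

Lemma mpow_mpow t s A : psd A -> mp s (mp t A) = mp (t * s) A.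
Proof.
move=> pA; rewrite !mpE fcalc_comp; last exact: pA.1.
by apply: psd_ext => // x _; rewrite /= powRrM.
Qed.

Lemma mpowZ t c A : 0 <= c -> psd A -> mp t (rC c *: A) = rC (c `^ t) *: mp t A.
Proof.
move=> c0 pA.
rewrite -{1}(@fcalc_id _ _ id _ pA.1)// fcalcZ; last exact: pA.1.
rewrite !mpE fcalc_comp ?fcalcZ; try exact: pA.1.
by apply: psd_ext => // x x0; rewrite /= powRM.
Qed.

Lemma mpow_supp t A : psd A -> t != 0 -> mp t A *m supp A = mp t A.
Proof.
move=> pA t0; rewrite !mpE suppE fcalcM; last exact: pA.1.
apply: psd_ext => // x _.
by have [->|x0] := eqVneq x 0; rewrite ?mulr1// mulr0 powR0.
Qed.

Lemma rtrace_mpow_ge0 t A : psd A -> 0 <= rtrace (mp t A).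
Proof. by move=> pA; exact/rtrace_psd/psd_mpow. Qed.

Lemma rtrace_mpow0 t A : psd A -> rtrace (mp t A) = 0 -> A = 0.
Proof.
move=> pA; have [U [d [Ad d0]]] := psd_spec pA.
rewrite !mpE (rtrace_fcalc _ Ad) => /eqP.
rewrite psumr_eq0 => [/allP d00|i _]; last exact: powR_ge0.
case: Ad => _ /= ->; have -> : d = 0.
  apply/rowP => i; have := d00 i; rewrite mem_index_enum => /(_ isT) /=.
  by rewrite powR_eq0 mxE => /andP[/eqP].
suff -> : diag_mx (map_mx (@rC R) 0) = 0 :> 'M[C]_n by rewrite mulmx0 mul0mx.
by apply/matrixP => i j; rewrite !mxE rmorph0 mul0rn.
Qed.
End Mpow.

(** [M *m M^h] and [M^h *m M] have the same nonzero eigenvalues, and the factor [x] in [f] ignores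
    the zero ones, whose multiplicities may differ. In eigenbases [M] becomes [Y], whose squared row
    and column norms are the eigenvalues [a] and [b], with [a_i = b_j] wherever [Y i j] is nonzero;
    both traces are then the same double sum. *)
Lemma rtrace_fcalc_gram p q (M : 'M[C]_(p, q)) (f g : R -> R) :
  (forall x, f x = x * g x) ->
  rtrace (fc f (M *m M^h)) = rtrace (fc f (M^h *m M)).
Proof.
move=> fE.
have [U [a Aa]] := spec_exists (psd_gram M).1.
have [V [b Bb]] := spec_exists (psd_gram M^h).1.
rewrite adjmxK in Bb; rewrite (rtrace_fcalc _ Aa) (rtrace_fcalc _ Bb).
pose Y := U^h *m M *m V.
have [/= uU AE] := Aa; have [/= uV BE] := Bb.
have YYh : Y *m Y^h = diag_mx (map_mx (@rC R) a).
  rewrite /Y !adjmxM adjmxK !mulmxA -(mulmxA _ V) uV mulmx1 -(mulmxA U^h) AE.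
  by rewrite !mulmxA unitaryC// mul1mx -mulmxA unitaryC// mulmx1.
have YhY : Y^h *m Y = diag_mx (map_mx (@rC R) b).
  rewrite /Y !adjmxM adjmxK !mulmxA -(mulmxA _ U) uU mulmx1 -(mulmxA V^h) BE.
  by rewrite !mulmxA unitaryC// mul1mx -mulmxA unitaryC// mulmx1.
have ab i j : nsq (Y i j) * g (a 0 i) = nsq (Y i j) * g (b 0 j).
  have /matrixP/(_ i j) : diag_mx (map_mx (@rC R) a) *m Y
      = Y *m diag_mx (map_mx (@rC R) b) by rewrite -YYh -YhY mulmxA.
  rewrite mul_diagE mul_mx_diagE mulrC.
  have [Y0 _|Y0 /(mulfI Y0)/complexI -> //] := eqVneq (Y i j) 0.
  by rewrite Y0 /nsq /= expr0n addr0 !mul0r.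
have aE i : a 0 i = \sum_j nsq (Y i j).
  transitivity (complex.Re ((Y *m Y^h) i i)); first by rewrite YYh !mxE eqxx.
  by rewrite mxE Re_sum; apply: eq_bigr => j _; rewrite adjmxE nsqE2.
have bE j : b 0 j = \sum_i nsq (Y i j).
  transitivity (complex.Re ((Y^h *m Y) j j)); first by rewrite YhY !mxE eqxx.
  by rewrite mxE Re_sum; apply: eq_bigr => i _; rewrite adjmxE nsqE.
under eq_bigr do rewrite fE {1}aE mulr_suml.
under [RHS]eq_bigr do rewrite fE {1}bE mulr_suml.
rewrite exchange_big; apply: eq_bigr => j _; apply: eq_bigr => i _.
exact: ab.
Qed.

Lemma rtrace_mpow_gram p q (M : 'M[C]_(p, q)) t : t != 0 ->
  rtrace (mp t (M *m M^h)) = rtrace (mp t (M^h *m M)).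
Proof.
move=> t0; have pg := psd_gram M; have := psd_gram M^h; rewrite adjmxK => pg'.
rewrite !mpE.
rewrite (@psd_ext _ _ _ (fun x => x * (if x == 0 then 0 else x `^ t / x)) _ pg).
  rewrite (@psd_ext _ _ _ (fun x => x * (if x == 0 then 0 else x `^ t / x)) _ pg').
    exact: rtrace_fcalc_gram.
  by move=> x _; case: eqVneq => [->|x0]; rewrite ?mulr0 ?powR0// mulrC divfK.
by move=> x _; case: eqVneq => [->|x0]; rewrite ?mulr0 ?powR0// mulrC divfK.
Qed.

Lemma rtrace_mpow_specd n t (A : 'M[C]_n) U d : specd A U d ->
  rtrace (mp t A) = \sum_i d 0 i `^ t.
Proof. by rewrite mpE; exact: rtrace_fcalc. Qed.

Section Overlap.
Variables (n : nat) (U V : 'M[C]_n).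
Hypotheses (uU : unitary U) (uV : unitary V).
Local Notation w i j := (nsq ((U^h *m V) i j)).

(** The overlaps [|<u_i, v_j>|^2] form a doubly stochastic matrix, so a single sum over eigenvalues
    can be rewritten as an overlap sum and compared with it term by term. *)
Lemma overlap_suml (F : 'I_n -> R) : \sum_i \sum_j w i j * F i = \sum_i F i.
Proof.
apply: eq_bigr => i _; rewrite -mulr_suml nsq_unitary_row ?mul1r//.
exact/unitaryM/uV/unitary_adj.
Qed.

Lemma overlap_sumr (F : 'I_n -> R) : \sum_i \sum_j w i j * F j = \sum_j F j.
Proof.
rewrite exchange_big; apply: eq_bigr => j _; rewrite -mulr_suml.
rewrite nsq_unitary_col ?mul1r//.
exact/unitaryM/uV/unitary_adj.
Qed.

Lemma overlap_sum_le (h : 'I_n -> 'I_n -> R) (F G : 'I_n -> R) :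
  (forall i j, (U^h *m V) i j != 0 -> h i j <= F i + G j) ->
  \sum_i \sum_j w i j * h i j <= \sum_i F i + \sum_j G j.
Proof.
move=> hFG; rewrite -overlap_suml -overlap_sumr -big_split /=.
apply: ler_sum => i _; rewrite -big_split; apply: ler_sum => j _ /=.
have [->|w0] := eqVneq ((U^h *m V) i j) 0.
  by rewrite /nsq /= expr0n addr0 !mul0r addr0.
by rewrite -mulrDr ler_wpM2l ?nsq_ge0// hFG.
Qed.

(** Equality between the averages forces equality at every pair of positive weight. Together with
    [fcalc_overlap] it turns the equality case of a scalar inequality into an identity of
    matrices. *)
Lemma overlap_sum_eq (h : 'I_n -> 'I_n -> R) (F G : 'I_n -> R) :
  (forall i j, (U^h *m V) i j != 0 -> h i j <= F i + G j) ->
  \sum_i \sum_j w i j * h i j = \sum_i F i + \sum_j G j ->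
  forall i j, (U^h *m V) i j != 0 -> h i j = F i + G j.
Proof.
move=> hFG E i j w0; apply/eqP; rewrite eq_le hFG//= leNgt; apply/negP => lt.
have : \sum_i \sum_j w i j * h i j < \sum_i F i + \sum_j G j; last first.
  by rewrite E ltxx.
rewrite -overlap_suml -overlap_sumr -big_split /=.
have hle k l : w k l * h k l <= w k l * F k + w k l * G l.
  have [->|w0'] := eqVneq ((U^h *m V) k l) 0.
    by rewrite /nsq /= expr0n addr0 !mul0r addr0.
  by rewrite -mulrDr ler_wpM2l ?nsq_ge0// hFG.
rewrite (bigD1 i)//= [ltRHS](bigD1 i)//= ltr_leD//; last first.
  by apply: ler_sum => k _; rewrite -big_split; apply: ler_sum.
rewrite -big_split (bigD1 j)//= [ltRHS](bigD1 j)//= ltr_leD//; last first.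
  by apply: ler_sum => k _.
by rewrite -mulrDr ltr_pM2l// lt_neqAle eq_sym nsq_eq0 w0 nsq_ge0.
Qed.

Lemma fcalc_overlap (A B : 'M[C]_n) (a b : 'rV[R]_n) (f g : R -> R) :
  specd A U a -> specd B V b ->
  (forall i j, (U^h *m V) i j != 0 -> f (a 0 i) = g (b 0 j)) ->
  fc f A = fc g B.
Proof.
move=> Aa Bb fg; rewrite (fcE f Aa) (fcE g Bb).
have : diag_mx (map_mx (fun x => rC (f x)) a) *m (U^h *m V)
   = (U^h *m V) *m diag_mx (map_mx (fun x => rC (g x)) b).
  apply/matrixP => i j; rewrite mul_diagE mul_mx_diagE.
  have [w0|w0] := eqVneq ((U^h *m V) i j) 0; first by rewrite w0 mulr0 mul0r.
  by rewrite (fg _ _ w0) mulrC.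
move=> /(congr1 (fun X => U *m X *m V^h)).
rewrite !mulmxA uU mul1mx -!mulmxA uV mulmx1 !mulmxA => ->.
by [].
Qed.
End Overlap.

End Support.

(** * Interpolation *)

Section Interpolation.
Variable R : realType.
Local Notation C := R[i].

(** The parallel sum [ab/(a+b)] is the least value of [a |x|^2 + b |y|^2] over splittings
    [x + y = 1]. This variational form makes parallel sums compatible with monotonicity. If
    [a + b = 0], division by zero gives 0, which is again the minimum. *)
Lemma nsq_parallel (x y : C) (a b : R) : 0 <= a -> 0 <= b ->
  nsq (x + y) * (a * b / (a + b)) <= nsq x * a + nsq y * b.
Proof.
move=> a0 b0; have [ab0|ab0] := eqVneq (a + b) 0.
  by rewrite ab0 invr0 !mulr0 addr_ge0// mulr_ge0 ?nsq_ge0.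
have ab : 0 < a + b by rewrite lt_neqAle eq_sym ab0 addr_ge0.
rewrite mulrA ler_pdivrMr// -subr_ge0.
case: x y => [x1 x2] [y1 y2]; rewrite /nsq /=.
have -> : ((x1 ^+ 2 + x2 ^+ 2) * a + (y1 ^+ 2 + y2 ^+ 2) * b) * (a + b) -
   ((x1 + y1) ^+ 2 + (x2 + y2) ^+ 2) * (a * b) =
   (a * x1 - b * y1) ^+ 2 + (a * x2 - b * y2) ^+ 2 by ring.
by rewrite addr_ge0 ?sqr_ge0.
Qed.

Lemma cvg_sumr (I : Type) (r : seq I) (F : I -> nat -> R) (l : I -> R) :
  (forall i, F i @ \oo --> l i) ->
  (fun n => \sum_(i <- r) F i n) @ \oo --> \sum_(i <- r) l i.
Proof.
move=> Fl; elim: r => [|i r ih].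
  rewrite big_nil; under eq_fun do rewrite big_nil; exact: cvg_cst.
rewrite big_cons; under eq_fun do rewrite big_cons.
exact: cvgD.
Qed.

(** Arithmetic and harmonic means. The harmonic mean is twice a parallel sum, so both components
    stay in the class of monotone functions; the product is invariant and the gap at least
    halves. *)
Definition ahm_step (uv : R * R) : R * R :=
  ((uv.1 + uv.2) / 2, 2 * (uv.1 * uv.2 / (uv.1 + uv.2))).

Lemma ahm_step_ge0 uv : 0 <= uv.1 -> 0 <= uv.2 ->
  0 <= (ahm_step uv).1 /\ 0 <= (ahm_step uv).2.
Proof.
move=> u0 v0; split=> /=; first by rewrite divr_ge0 ?addr_ge0.
by rewrite mulr_ge0// divr_ge0 ?mulr_ge0 ?addr_ge0.
Qed.

Lemma ahm_step_prod uv : 0 <= uv.1 -> 0 <= uv.2 ->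
  (ahm_step uv).1 * (ahm_step uv).2 = uv.1 * uv.2.
Proof.
case: uv => u v /= u0 v0; have [s0|s0] := eqVneq (u + v) 0; last by field.
have /andP[/eqP -> /eqP ->] : (u == 0) && (v == 0) by rewrite -paddr_eq0 ?s0.
by rewrite !(mul0r, mulr0, addr0).
Qed.

Lemma ahm_step_dist uv : 0 <= uv.1 -> 0 <= uv.2 ->
  `|(ahm_step uv).1 - (ahm_step uv).2| <= `|uv.1 - uv.2| / 2.
Proof.
case: uv => u v /= u0 v0; have [s0|s0] := eqVneq (u + v) 0.
  have /andP[/eqP -> /eqP ->] : (u == 0) && (v == 0) by rewrite -paddr_eq0 ?s0.
  by rewrite !(mul0r, mulr0, addr0, subrr, normr0).
have s1 : 0 < u + v by rewrite lt_neqAle eq_sym s0 addr_ge0.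
have -> : (u + v) / 2 - 2 * (u * v / (u + v)) = (u - v) / 2 * ((u - v) / (u + v)).
  by field.
rewrite normrM [X in X * _]normrM (ger0_norm (_ : 0 <= 2^-1 :> R)) ?invr_ge0//.
rewrite ler_piMr ?mulr_ge0 ?invr_ge0// normrM normfV (gtr0_norm s1) ler_pdivrMr// mul1r.
by rewrite ler_norml; apply/andP; split; lra.
Qed.

Lemma ahm_iter n uv : 0 <= uv.1 -> 0 <= uv.2 ->
  let w := iter n ahm_step uv in
  [/\ 0 <= w.1, 0 <= w.2, w.1 * w.2 = uv.1 * uv.2
    & `|w.1 - w.2| <= `|uv.1 - uv.2| * 2^-1 ^+ n].
Proof.
move=> u0 v0; elim: n => [|n [w0 w0' wE wd]] /=; first by rewrite expr0 mulr1.
have [g0 g0'] := ahm_step_ge0 w0 w0'.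
split=> //; first by rewrite ahm_step_prod.
apply: le_trans (ahm_step_dist w0 w0') _.
by rewrite exprSr mulrA ler_wpM2r// invr_ge0.
Qed.

(** The square root of the invariant product always lies between the two components, whose distance
    tends to 0. *)
Lemma ahm_cvg u v : 0 <= u -> 0 <= v ->
  (fun n => (iter n ahm_step (u, v)).1) @ \oo --> Num.sqrt (u * v).
Proof.
move=> u0 v0; apply/cvgrPdist_le => e e0.
have g0 : (fun n => `|u - v| * 2^-1 ^+ n : R) @ \oo --> (0 : R).
  rewrite -[X in _ --> X](mulr0 `|u - v|); apply: cvgMr; apply: cvg_expr.
  by rewrite ger0_norm ?invr_ge0// invf_lt1// ltr1n.
near=> n; have [w1 w2 wE wd] := @ahm_iter n (u, v) u0 v0.
apply: (@le_trans _ _ (`|u - v| * 2^-1 ^+ n)); last first.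
  apply: ltW; near: n; exact: (cvgr_lt _ g0).
apply: le_trans wd; move: w1 w2 wE => /=.
set x := (iter _ _ _).1; set y := (iter _ _ _).2 => x0 y0 <-.
have s0 := sqrtr_ge0 (x * y).
have sE : Num.sqrt (x * y) ^+ 2 = x * y by rewrite sqr_sqrtr ?mulr_ge0.
move: s0 sE; set s := Num.sqrt _ => s0 sE.
have [xy|yx] := leP x y.
  have xs : x <= s by rewrite -ler_sqr ?nnegrE// sE expr2 ler_wpM2l.
  have sy : s <= y by rewrite -ler_sqr ?nnegrE// sE expr2 ler_wpM2r.
  by rewrite ger0_norm ?subr_ge0// ler0_norm ?subr_le0//; lra.
have sx : s <= x by rewrite -ler_sqr ?nnegrE// sE expr2 ler_wpM2l// ltW.
have ys : y <= s by rewrite -ler_sqr ?nnegrE// sE expr2 ler_wpM2r// ltW.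
have d0 : 0 <= x - y by rewrite subr_ge0 ltW.
by rewrite (ger0_norm d0) ler0_norm ?subr_le0//; lra.
Unshelve. all: by end_near.
Qed.

(** The limit exponent has to be positive because [0^t] jumps from 0 to 1 at [t = 0]; this is why
    interpolation is stated for [t] in the open interval. *)
Lemma cvg_powRr (x t : R) (u : nat -> R) : 0 <= x -> 0 < t -> u @ \oo --> t ->
  (fun n => x `^ u n) @ \oo --> x `^ t.
Proof.
move=> x0 t0 ut; have [->|xn0] := eqVneq x 0.
  rewrite powR0 ?gt_eqF//; apply/cvgrPdist_le => e e0; near=> n.
  rewrite powR0 ?subrr ?normr0 ?ltW// gt_eqF//.
  near: n; exact: (cvgr_gt _ ut).
rewrite /powR (negbTE xn0).
apply: (@continuous_cvg _ _ _ _ _ _ expR); first exact: continuous_expR.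
by apply: cvgMl.
Unshelve. all: by end_near.
Qed.

Section Mono.
Variables (p q p' q' : nat) (L : 'M[C]_(p', q') -> 'M[C]_(p, q)).
Variables (a : 'I_p -> R) (b : 'I_q -> R) (a' : 'I_p' -> R) (b' : 'I_q' -> R).
Hypotheses (LD : forall X Y, L (X + Y) = L X + L Y).
Hypotheses (a0 : forall i, 0 <= a i) (b0 : forall i, 0 <= b i).
Hypotheses (a'0 : forall i, 0 <= a' i) (b'0 : forall i, 0 <= b' i).

(* [phi(A, B)] composed with [L] is dominated by [phi(A', B')] as a quadratic
   form, in coordinates where the commuting operators are diagonal. *)
Definition monof (phi : R -> R -> R) : Prop := forall X,
  \sum_i \sum_j nsq (L X i j) * phi (a i) (b j)
  <= \sum_i \sum_j nsq (X i j) * phi (a' i) (b' j).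

Lemma monof_ext f g : (forall x y, 0 <= x -> 0 <= y -> f x y = g x y) ->
  monof f -> monof g.
Proof.
move=> fg mf X; have := mf X.
under eq_bigr do (under eq_bigr do rewrite fg//).
by under [leRHS]eq_bigr do (under eq_bigr do rewrite fg//).
Qed.

Lemma monofD f g : monof f -> monof g -> monof (fun x y => f x y + g x y).
Proof.
move=> mf mg X; have := lerD (mf X) (mg X); rewrite -!big_split /=.
under eq_bigr do (rewrite -big_split /=; under eq_bigr do rewrite -mulrDr).
by under [leRHS]eq_bigr do (rewrite -big_split /=; under eq_bigr do rewrite -mulrDr).
Qed.

Lemma monofZ c f : 0 <= c -> monof f -> monof (fun x y => c * f x y).
Proof.
move=> c0 mf X; have := ler_wpM2l c0 (mf X); rewrite !mulr_sumr.
under eq_bigr do (rewrite mulr_sumr; under eq_bigr do rewrite mulrCA).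
by under [leRHS]eq_bigr do (rewrite mulr_sumr; under eq_bigr do rewrite mulrCA).
Qed.

Lemma monof_parallel f g : (forall x y, 0 <= x -> 0 <= y -> 0 <= f x y) ->
  (forall x y, 0 <= x -> 0 <= y -> 0 <= g x y) -> monof f -> monof g ->
  monof (fun x y => f x y * g x y / (f x y + g x y)).
Proof.
move=> f0 g0 mf mg X.
(* The optimal splitting of [X] on the target side: with weights [g/(f+g)] and [f/(f+g)] the bound
   of [nsq_parallel] is attained there, while on the source side the inequality is enough. Where [f]
   and [g] both vanish the cost is 0 for any weight, and 1 is taken. *)
pose c i j := let s := f (a' i) (b' j) + g (a' i) (b' j) in
  if s == 0 then 1 else g (a' i) (b' j) / s.
pose Y := \matrix_(i, j) (rC (c i j) * X i j).
pose Z := \matrix_(i, j) (rC (1 - c i j) * X i j).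
have XE : X = Y + Z.
  by apply/matrixP => i j; rewrite !mxE -mulrDl -rmorphD /= addrC subrK rmorph1 mul1r.
apply: (@le_trans _ _ (\sum_i \sum_j (nsq (L Y i j) * f (a i) (b j)
                                 + nsq (L Z i j) * g (a i) (b j)))).
  apply: ler_sum => i _; apply: ler_sum => j _.
  rewrite {1}XE LD mxE; apply: nsq_parallel; first exact: f0.
  exact: g0.
apply: (@le_trans _ _ (\sum_i \sum_j (nsq (Y i j) * f (a' i) (b' j)
                                 + nsq (Z i j) * g (a' i) (b' j)))).
  have := lerD (mf Y) (mg Z); rewrite -!big_split /=.
  under eq_bigr do rewrite -big_split.
  by under [leRHS]eq_bigr do rewrite -big_split.
apply: ler_sum => i _; apply: ler_sum => j _; rewrite /Y /Z !mxE !nsqM !nsq_rC /c.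
have F0 := f0 _ _ (a'0 i) (b'0 j); have G0 := g0 _ _ (a'0 i) (b'0 j).
move: F0 G0; set u := f _ _; set v := g _ _ => u0 v0.
have [s0|s0] := eqVneq (u + v) 0.
  have /andP[/eqP -> /eqP ->] : (u == 0) && (v == 0) by rewrite -paddr_eq0 ?s0.
  by rewrite !(mul0r, mulr0, addr0).
by rewrite le_eqVlt; apply/orP; left; apply/eqP; field.
Qed.

Lemma monof_lim (f : nat -> R -> R -> R) g : (forall n, monof (f n)) ->
  (forall x y, 0 <= x -> 0 <= y -> (fun n => f n x y) @ \oo --> g x y) -> monof g.
Proof.
move=> mf fg X.
apply: (@ler_cvg_to _ \oo _ R (fun n => \sum_i \sum_j nsq (L X i j) * f n (a i) (b j))
   (fun n => \sum_i \sum_j nsq (X i j) * f n (a' i) (b' j))).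
- by apply: cvg_sumr => i; apply: cvg_sumr => j; apply: cvgMr; exact: fg.
- by apply: cvg_sumr => i; apply: cvg_sumr => j; apply: cvgMr; exact: fg.
by near=> n; exact: mf.
Unshelve. all: by end_near.
Qed.

Lemma monof_ahm n f g : (forall x y, 0 <= x -> 0 <= y -> 0 <= f x y) ->
  (forall x y, 0 <= x -> 0 <= y -> 0 <= g x y) -> monof f -> monof g ->
  monof (fun x y => (iter n ahm_step (f x y, g x y)).1) /\
  monof (fun x y => (iter n ahm_step (f x y, g x y)).2).
Proof.
move=> f0 g0 mf mg; elim: n => [|n [ih1 ih2]] //=.
have i0 x y : 0 <= x -> 0 <= y ->
    0 <= (iter n ahm_step (f x y, g x y)).1 /\ 0 <= (iter n ahm_step (f x y, g x y)).2.
  by move=> x0 y0; have [] := @ahm_iter n (f x y, g x y) (f0 _ _ x0 y0) (g0 _ _ x0 y0).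
split.
  have h : (0 : R) <= 2^-1 by rewrite invr_ge0.
  have := monofZ h (monofD ih1 ih2).
  by apply: monof_ext => x y _ _; rewrite mulrC.
apply: monofZ => //; apply: monof_parallel => // x y x0 y0.
  by have [] := i0 _ _ x0 y0.
by have [] := i0 _ _ x0 y0.
Qed.

Lemma monof_sqrt f g : (forall x y, 0 <= x -> 0 <= y -> 0 <= f x y) ->
  (forall x y, 0 <= x -> 0 <= y -> 0 <= g x y) -> monof f -> monof g ->
  monof (fun x y => Num.sqrt (f x y * g x y)).
Proof.
move=> f0 g0 mf mg.
apply: (@monof_lim (fun n x y => (iter n ahm_step (f x y, g x y)).1)).
  by move=> n; have [] := monof_ahm n f0 g0 mf mg.
by move=> x y x0 y0; apply: ahm_cvg; [exact: f0|exact: g0].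
Qed.

Hypotheses (m0 : monof (fun _ y => y)) (m1 : monof (fun x _ => x)).

Definition good (s : R) := monof (fun x y => x `^ s * y `^ (1 - s)).

Lemma sqrt_powR (x s r : R) : 0 <= x -> 0 <= s -> 0 <= r ->
  Num.sqrt (x `^ s * x `^ r) = x `^ ((s + r) / 2).
Proof.
move=> x0 s0 r0; have -> : x `^ s * x `^ r = x `^ ((s + r) / 2) ^+ 2.
  rewrite -powR_mulrn ?powR_ge0// -powRrM divfK//.
  have [sr|sr] := eqVneq (s + r) 0; last by rewrite powRD// (negbTE sr).
  have /andP[/eqP -> /eqP ->] : (s == 0) && (r == 0) by rewrite -paddr_eq0 ?sr.
  by rewrite addr0 powRr0 mulr1.
by rewrite sqrtr_sqr ger0_norm ?powR_ge0.
Qed.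

Lemma good_mid s r : 0 <= s <= 1 -> 0 <= r <= 1 -> good s -> good r ->
  good ((s + r) / 2).
Proof.
move=> /andP[s0 s1] /andP[r0 r1] gs gr.
have p0 t x y : 0 <= x -> 0 <= y -> 0 <= x `^ t * y `^ (1 - t) :> R.
  by move=> _ _; rewrite mulr_ge0 ?powR_ge0.
have := monof_sqrt (p0 s) (p0 r) gs gr; apply: monof_ext => x y x0 y0.
rewrite mulrACA sqrtrM ?mulr_ge0 ?powR_ge0// !sqrt_powR ?subr_ge0//.
by congr (_ * _ `^ _); field.
Qed.

Lemma good0 : good 0.
Proof. by apply: monof_ext m0 => x y x0 y0; rewrite powRr0 mul1r subr0 powRr1. Qed.

Lemma good1 : good 1.
Proof. by apply: monof_ext m1 => x y x0 y0; rewrite subrr powRr0 mulr1 powRr1. Qed.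

(** Bracketing of [t] by dyadic exponents. By [good_mid] the midpoint of two good exponents is good,
    so both ends remain good and [t] is a limit of good exponents. *)
Definition bisect (t : R) (lu : R * R) : R * R :=
  let m := (lu.1 + lu.2) / 2 in if t <= m then (lu.1, m) else (m, lu.2).

Lemma bisect_iter t n : 0 <= t <= 1 ->
  let w := iter n (bisect t) (0, 1) in
  [/\ good w.1, good w.2, 0 <= w.1 /\ w.2 <= 1, w.1 <= t <= w.2
    & w.2 - w.1 = 2^-1 ^+ n].
Proof.
move=> /andP[t0 t1]; elim: n => [|n [g1 g2 [l0 u1] /andP[lt tu] d]] /=.
  split; [exact: good0|exact: good1|by []|by rewrite t0|by rewrite expr0 subr0].
set w := iter _ _ _ in g1 g2 l0 u1 lt tu d *; rewrite /bisect.
have gm : good ((w.1 + w.2) / 2) by apply: good_mid => //; apply/andP; split; lra.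
case: ifPn => [tm|]; last rewrite -ltNge => tm.
  by split=> //=; [lra|rewrite lt|rewrite exprS -d; field].
by split=> //=; [lra|rewrite tu ltW|rewrite exprS -d; field].
Qed.

Lemma good_itv t : 0 < t < 1 -> good t.
Proof.
move=> /andP[t0 t1].
have t01 : 0 <= t <= 1 by rewrite !ltW.
pose u n := (iter n (bisect t) (0, 1)).2.
have ut : u @ \oo --> t.
  apply/cvgrPdist_le => e e0.
  have g0 : (fun n => 2^-1 ^+ n : R) @ \oo --> (0 : R).
    by apply: cvg_expr; rewrite ger0_norm ?invr_ge0// invf_lt1// ltr1n.
  near=> n; have [_ _ _ /andP[lt tu] d] := bisect_iter n t01.
  have : 2^-1 ^+ n < e by near: n; exact: (cvgr_lt _ g0).
  rewrite -d -/(u n) in lt tu * => de.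
  by rewrite ler0_norm ?subr_le0//; rewrite /u in de *; lra.
apply: (@monof_lim (fun n x y => x `^ u n * y `^ (1 - u n))).
  by move=> n; have [] := bisect_iter n t01.
move=> x y x0 y0; apply: cvgM; apply: cvg_powRr => //; first by rewrite subr_gt0.
by apply: cvgB => //; exact: cvg_cst.
Unshelve. all: by end_near.
Qed.

End Mono.

(** In the eigenbases of [A], [B] and [A'], [B'] the map [J] becomes [L], and the two hypotheses say
    that the coordinate functions [y] and [x] are monotone for [L]. *)
Theorem lieb_interp p q p' q' (A : 'M[C]_p) (B : 'M[C]_q) (A' : 'M[C]_p') (B' : 'M[C]_q')
  (J : 'M[C]_(p', q') -> 'M[C]_(p, q)) (t : R) :
  psd A -> psd B -> psd A' -> psd B' ->
  (forall X Y, J (X + Y) = J X + J Y) ->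
  (forall X, rtrace ((J X)^h *m J X *m B) <= rtrace (X^h *m X *m B')) ->
  (forall X, rtrace ((J X)^h *m A *m J X) <= rtrace (X^h *m A' *m X)) ->
  0 < t < 1 ->
  forall X, rtrace ((J X)^h *m mp t A *m J X *m mp (1 - t) B)
    <= rtrace (X^h *m mp t A' *m X *m mp (1 - t) B').
Proof.
move=> pA pB pA' pB' JD H0 H1 t01 X.
have [U [a [Aa a0]]] := psd_spec pA; have [V [b [Bb b0]]] := psd_spec pB.
have [U' [a' [Aa' a'0]]] := psd_spec pA'; have [V' [b' [Bb' b'0]]] := psd_spec pB'.
pose L Z := U^h *m J (U' *m Z *m V'^h) *m V.
have uU' : unitary U' by case: Aa'.
have uV' : unitary V' by case: Bb'.
have LD Y Z : L (Y + Z) = L Y + L Z.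
  by rewrite /L mulmxDr mulmxDl JD mulmxDr mulmxDl.
have form0 Z (f g : R -> R) :
  rtrace ((J (U' *m Z *m V'^h))^h *m fc f A *m J (U' *m Z *m V'^h) *m fc g B)
   = \sum_i \sum_j nsq (L Z i j) * (f (a 0 i) * g (b 0 j)).
  by rewrite (rtrace_form _ _ _ Aa Bb).
have form0' Z (f g : R -> R) :
  rtrace ((U' *m Z *m V'^h)^h *m fc f A' *m (U' *m Z *m V'^h) *m fc g B')
   = \sum_i \sum_j nsq (Z i j) * (f (a' 0 i) * g (b' 0 j)).
  rewrite (rtrace_form _ _ _ Aa' Bb').
  by rewrite !mulmxA unitaryC// mul1mx -mulmxA unitaryC// mulmx1.
have XE : X = U' *m (U'^h *m X *m V') *m V'^h.
  by rewrite !mulmxA uU' mul1mx -mulmxA uV' mulmx1.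
(* To read the hypotheses as such forms, the missing factor is written as the functional calculus of
   the constant 1, which is the identity also on the kernel. *)
have f1 n (D : 'M[C]_n) : psd D -> fc (fun=> 1) D = 1%:M.
  by move=> pD; rewrite (@fcalc_cst _ _ 1)// ?rmorph1//; exact: pD.1.
have fid n (D : 'M[C]_n) : psd D -> fc id D = D.
  by move=> pD; apply: fcalc_id => //; exact: pD.1.
rewrite !mpE XE form0 form0'.
apply: (@good_itv _ _ _ _ L (fun i => a 0 i) (fun j => b 0 j)
  (fun i => a' 0 i) (fun j => b' 0 j)) => //.
- move=> Z; have := H0 (U' *m Z *m V'^h).
  have := form0 Z (fun=> 1) id; have := form0' Z (fun=> 1) id.
  rewrite !f1// !fid// !mulmx1 => -> ->.
  under eq_bigr do (under eq_bigr do rewrite mul1r).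
  by under [leRHS]eq_bigr do (under eq_bigr do rewrite mul1r).
- move=> Z; have := H1 (U' *m Z *m V'^h).
  have := form0 Z id (fun=> 1); have := form0' Z id (fun=> 1).
  rewrite !f1// !fid// !mulmx1 => -> ->.
  under eq_bigr do (under eq_bigr do rewrite mulr1).
  by under [leRHS]eq_bigr do (under eq_bigr do rewrite mulr1).
Qed.

End Interpolation.

(** * Young's trace inequality *)

Section Young.
Variable R : realType.
Local Notation C := R[i].

Lemma young_scalar (al a b : R) : 1 < al -> 0 <= a -> 0 <= b ->
  a * b <= al^-1 * a `^ al + (1 - al^-1) * b `^ (1 - al^-1)^-1.
Proof.
move=> al1 a0 b0; have al0 : 0 < al by lra.
have p0 : 0 < 1 - al^-1 by rewrite subr_gt0 invf_lt1.
have := @conjugate_powR R a b al (1 - al^-1)^-1 a0 b0 al0.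
have e : al^-1 + (1 - al^-1) = 1 by lra.
rewrite invr_gt0 invrK => /(_ p0 e).
by rewrite [al^-1 * _]mulrC [(1 - al^-1) * _]mulrC.
Qed.

(** Put [a^al = e^x] and [b^q = e^y] with [q] the conjugate exponent. Young's inequality is then
    convexity of the exponential around the weighted mean [m] of [x] and [y], and the strict bound
    [1 + u < e^u] for nonzero [u] forces [x = y]. *)
Lemma young_scalar_eq (al a b : R) : 1 < al -> 0 <= a -> 0 <= b ->
  a * b = al^-1 * a `^ al + (1 - al^-1) * b `^ (1 - al^-1)^-1 ->
  a `^ al = b `^ (1 - al^-1)^-1.
Proof.
move=> al1 a0 b0; have al0 : 0 < al by lra.
have th0 : 0 < al^-1 by rewrite invr_gt0.
have p0 : 0 < 1 - al^-1 by rewrite subr_gt0 invf_lt1.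
have q0 : (1 - al^-1)^-1 != 0 by rewrite invr_eq0 gt_eqF.
have [->|an0] := eqVneq a 0.
  rewrite mul0r powR0 ?gt_eqF// mulr0 add0r => /esym/eqP.
  by rewrite mulf_eq0 (gt_eqF p0) /= => /eqP ->.
have [->|bn0] := eqVneq b 0.
  rewrite mulr0 [in X in _ + X]powR0// mulr0 addr0 => /esym/eqP.
  by rewrite mulf_eq0 (gt_eqF th0) /= => /eqP ->; rewrite powR0.
have ap : 0 < a by rewrite lt_neqAle eq_sym an0.
have bp : 0 < b by rewrite lt_neqAle eq_sym bn0.
rewrite /powR (negbTE an0) (negbTE bn0) => E.
congr expR; apply/eqP; rewrite -subr_eq0; apply/negPn/negP => z0.
move: E; set x := al * ln a in z0 *; set y := _^-1 * ln b in z0 *.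
pose m := al^-1 * x + (1 - al^-1) * y.
have mE : a * b = expR m.
  by rewrite /m /x /y mulKf ?gt_eqF// mulVKf ?gt_eqF// expRD !lnK.
have -> : expR x = expR m * expR ((1 - al^-1) * (x - y)).
  by rewrite -expRD; congr expR; rewrite /m; ring.
have -> : expR y = expR m * expR (- al^-1 * (x - y)).
  by rewrite -expRD; congr expR; rewrite /m; ring.
rewrite mE => E.
have e1 : 1 + (1 - al^-1) * (x - y) < expR ((1 - al^-1) * (x - y)).
  by apply: expR_gt1Dx; rewrite mulf_neq0// gt_eqF.
have e2 := expR_ge1Dx (- al^-1 * (x - y)).
have : expR m < al^-1 * (expR m * expR ((1 - al^-1) * (x - y)))
     + (1 - al^-1) * (expR m * expR (- al^-1 * (x - y))); last first.
  by rewrite -E ltxx.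
rewrite mulrCA [X in _ + X]mulrCA -mulrDr ltr_pMr ?expR_gt0//.
apply: (@lt_le_trans _ _ (al^-1 * expR ((1 - al^-1) * (x - y))
    + (1 - al^-1) * (1 + - al^-1 * (x - y)))); last first.
  by rewrite lerD2l ler_wpM2l// ltW.
apply: (@le_lt_trans _ _ (al^-1 * (1 + (1 - al^-1) * (x - y))
    + (1 - al^-1) * (1 + - al^-1 * (x - y)))); last first.
  by rewrite ltrD2r ltr_pM2l.
by rewrite le_eqVlt; apply/orP; left; apply/eqP; ring.
Qed.

Lemma young n al (X Y : 'M[C]_n) : 1 < al -> psd X -> psd Y ->
  rtrace (X *m Y) <= al^-1 * rtrace (mp al X)
     + (1 - al^-1) * rtrace (mp (1 - al^-1)^-1 Y).
Proof.
move=> al1 pX pY.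
have [U [a [Aa a0]]] := psd_spec pX; have [V [b [Bb b0]]] := psd_spec pY.
have := rtrace_form1 id id Aa Bb.
rewrite (fcalc_id pX.1)// (fcalc_id pY.1)// => ->.
rewrite (rtrace_mpow_specd _ Aa) (rtrace_mpow_specd _ Bb) !mulr_sumr.
have [/= uU _] := Aa; have [/= uV _] := Bb.
by apply: overlap_sum_le => // i j _; exact: young_scalar.
Qed.

Lemma young_eq n al (X Y : 'M[C]_n) : 1 < al -> psd X -> psd Y ->
  rtrace (X *m Y) = al^-1 * rtrace (mp al X)
     + (1 - al^-1) * rtrace (mp (1 - al^-1)^-1 Y) ->
  mp al X = mp (1 - al^-1)^-1 Y.
Proof.
move=> al1 pX pY.
have [U [a [Aa a0]]] := psd_spec pX; have [V [b [Bb b0]]] := psd_spec pY.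
have := rtrace_form1 id id Aa Bb.
rewrite (fcalc_id pX.1)// (fcalc_id pY.1)// => ->.
rewrite (rtrace_mpow_specd _ Aa) (rtrace_mpow_specd _ Bb) !mulr_sumr => E.
have [/= uU _] := Aa; have [/= uV _] := Bb.
rewrite !mpE; apply: (fcalc_overlap uU uV Aa Bb) => i j w0; apply: young_scalar_eq => //.
move: i j w0; apply: (overlap_sum_eq uU uV _ E) => i j _.
exact: young_scalar.
Qed.

Section Alpha.
Variable al : R.
Hypothesis al1 : 1 < al.
Let al0 : 0 < al. Proof. exact: lt_trans ltr01 al1. Qed.
Let p := 1 - al^-1.
Let p0 : 0 < p. Proof. by rewrite subr_gt0 invf_lt1. Qed.
Let p1 : p < 1. Proof. by rewrite /p; have := al0; rewrite -invr_gt0; lra. Qed.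
Let palE : (al - 1) * p^-1 = al.
Proof. by rewrite /p; field; rewrite !gt_eqF//= subr_gt0. Qed.

Lemma rtrace_mpow_split n (S : 'M[C]_n) : psd S ->
  rtrace (S *m mp (al - 1) S) = rtrace (mp al S).
Proof.
move=> pS; rewrite -{1}(mpow1 pS) mpowD//; first by rewrite addrC subrK.
by rewrite addrC subrK gt_eqF.
Qed.

Lemma young_mpow n (A S : 'M[C]_n) : psd A -> psd S ->
  rtrace (A *m mp (al - 1) S) <= al^-1 * rtrace (mp al A) + p * rtrace (mp al S).
Proof.
move=> pA pS; have := young al1 pA (psd_mpow (al - 1) pS).
by rewrite mpow_mpow// palE.
Qed.

(** The power [x^al] need not be operator monotone, but its trace is: test both sides against
    [A^(al-1)], apply Young to [B] and [A^(al-1)], and absorb the resulting multiple of [tr A^al] on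
    the left. *)
Lemma rtrace_mpow_le n (A B : 'M[C]_n) : psd A -> psd B -> lep A B ->
  rtrace (mp al A) <= rtrace (mp al B).
Proof.
move=> pA pB AB; have := young_mpow pB pA.
have := lep_rtraceM (psd_mpow (al - 1) pA) AB; rewrite rtrace_mpow_split//.
have th : 0 < al^-1 by rewrite invr_gt0.
rewrite /p => h1 h2; rewrite -(ler_pM2l th); lra.
Qed.

(** The argument of [rtrace_mpow_le] again, now with test matrix [S^(al-1)], where [S] is the
    mixture. *)
Lemma rtrace_mpow_convex n (I : finType) (w : I -> R) (A : I -> 'M[C]_n) :
  (forall i, 0 <= w i) -> \sum_i w i = 1 -> (forall i, psd (A i)) ->
  rtrace (mp al (\sum_i rC (w i) *: A i)) <= \sum_i w i * rtrace (mp al (A i)).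
Proof.
move=> w0 w1 pA; set S := \sum_i _.
have pS : psd S by apply: psd_sum => i _; exact: psdZ.
have : rtrace (mp al S) <= \sum_i w i * (al^-1 * rtrace (mp al (A i))
     + p * rtrace (mp al S)).
  rewrite -{1}rtrace_mpow_split// {1}/S mulmx_suml rtrace_sum; apply: ler_sum => i _.
  by rewrite -scalemxAl rtraceZ ler_wpM2l// young_mpow.
under eq_bigr do rewrite mulrDr mulrCA.
rewrite big_split /= -mulr_suml w1 mul1r -mulr_sumr => h.
have th : 0 < al^-1 by rewrite invr_gt0.
by rewrite -(ler_pM2l th); move: h; rewrite /p; lra.
Qed.

Definition swexp := (1 - al) / (2 * al).

Lemma swexpE : swexp = - (p / 2).
Proof. by rewrite /swexp /p; field; rewrite gt_eqF. Qed.

Let s0 : swexp != 0.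
Proof. by rewrite swexpE oppr_eq0 gt_eqF ?divr_gt0. Qed.

Definition sandw n (rho sigma : 'M[C]_n) : 'M[C]_n :=
  mp swexp sigma *m rho *m mp swexp sigma.

(** The trace inside the logarithm of the sandwiched divergence; [al] acts as a power here, which
    makes convexity and homogeneity available. *)
Definition qal n (rho sigma : 'M[C]_n) : R := rtrace (mp al (sandw rho sigma)).

Section Sandwich.
Variable n : nat.
Implicit Types rho sigma : 'M[C]_n.

Lemma psd_sandw rho sigma : psd rho -> psd sigma -> psd (sandw rho sigma).
Proof.
move=> pr ps; have := psd_conj (mp swexp sigma) pr.
by rewrite (mpow_herm _ ps).
Qed.

Lemma sandwK rho sigma : psd rho -> psd sigma -> (rho <= sigma)%MS ->
  mp (p / 2) sigma *m sandw rho sigma *m mp (p / 2) sigma = rho.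
Proof.
move=> pr ps rs; rewrite /sandw !mulmxA.
have p20 : p / 2 != 0 by rewrite gt_eqF ?divr_gt0.
rewrite mpowV//; last by rewrite swexpE subrr.
rewrite -!mulmxA mpowV//; last by rewrite swexpE addNr.
rewrite submx_supp//; last exact: ps.1.
by apply: submx_suppl => //; [exact: ps.1|exact: pr.1].
Qed.

Lemma sandw_supp rho sigma : psd sigma -> sandw rho sigma *m supp sigma = sandw rho sigma.
Proof. by move=> ps; rewrite /sandw -mulmxA mpow_supp. Qed.

Lemma rtrace_sandw rho sigma : psd rho -> psd sigma -> (rho <= sigma)%MS ->
  rtrace (sandw rho sigma *m mp p sigma) = rtrace rho.
Proof.
move=> pr ps rs; rewrite -{2}(sandwK pr ps rs) [RHS]rtraceC mulmxA mpowD//.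
  by rewrite rtraceC -splitr.
by rewrite -splitr gt_eqF.
Qed.

Lemma mpow_pV sigma : psd sigma -> mp p^-1 (mp p sigma) = sigma.
Proof. by move=> ps; rewrite mpow_mpow// divff ?gt_eqF// mpow1. Qed.

(** Pairing the sandwiched matrix with [sigma^p] recovers [tr rho = 1]; Young bounds this pairing by
    [qal/al + p tr sigma], and [1 - p = 1/al]. *)
Lemma qal_ge1 rho sigma : psd rho -> psd sigma -> (rho <= sigma)%MS ->
  rtrace rho = 1 -> rtrace sigma = 1 -> 1 <= qal rho sigma.
Proof.
move=> pr ps rs tr ts.
have := young al1 (psd_sandw pr ps) (psd_mpow p ps).
rewrite rtrace_sandw// -/p mpow_pV// tr ts mulr1 -/(qal _ _).
have th : 0 < al^-1 by rewrite invr_gt0.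
by move=> h; rewrite -(ler_pM2l th); move: h; rewrite /p; lra.
Qed.

(** Equality in Young makes the [al]-th power of the sandwiched matrix equal to [sigma]. Undoing the
    sandwich gives [rho] as the power of [sigma] with exponent [p/2 + 1/al + p/2 = 1]. *)
Lemma qal_eq1 rho sigma : psd rho -> psd sigma -> (rho <= sigma)%MS ->
  rtrace rho = 1 -> rtrace sigma = 1 -> qal rho sigma = 1 -> rho = sigma.
Proof.
move=> pr ps rs tr ts q1; have pX := psd_sandw pr ps.
have := young_eq al1 pX (psd_mpow p ps).
rewrite rtrace_sandw// -/p mpow_pV// tr ts -/(qal _ _) q1 => XE0.
have /XE0 : 1 = al^-1 * 1 + p * 1 by rewrite /p; lra.
move=> /(congr1 (mp al^-1)); rewrite mpow_mpow// divff ?gt_eqF// mpow1// => XE.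
rewrite -(sandwK pr ps rs) XE mpowD//.
  rewrite mpowD//; first by rewrite (_ : _ + _ = 1) ?mpow1// /p; field; rewrite gt_eqF.
  by rewrite (_ : _ + _ = 1) ?oner_eq0// /p; field; rewrite gt_eqF.
by rewrite gt_eqF// addr_gt0 ?divr_gt0 ?invr_gt0.
Qed.

Lemma sandw_self sigma : psd sigma -> sandw sigma sigma = mp al^-1 sigma.
Proof.
move=> ps; rewrite /sandw -{2}(mpow1 ps) mpowD//.
  rewrite mpowD//.
    by congr mp; rewrite swexpE /p; field; rewrite gt_eqF.
  rewrite (_ : _ + _ = al^-1) ?invr_eq0 ?gt_eqF//.
  by rewrite swexpE /p; field; rewrite gt_eqF.
by rewrite swexpE gt_eqF//; have := p1; have := p0; lra.
Qed.

Lemma qal_self sigma : psd sigma -> qal sigma sigma = rtrace sigma.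
Proof. by move=> ps; rewrite /qal sandw_self// mpow_mpow// mulVf ?gt_eqF// mpow1. Qed.

Lemma sandwZ c rho sigma : sandw (c *: rho) sigma = c *: sandw rho sigma.
Proof. by rewrite /sandw -scalemxAr -scalemxAl. Qed.

Lemma sandw_sum (I : Type) (r : seq I) (F : I -> 'M[C]_n) sigma :
  sandw (\sum_(i <- r) F i) sigma = \sum_(i <- r) sandw (F i) sigma.
Proof. by rewrite /sandw mulmx_sumr mulmx_suml. Qed.

Lemma qalZ c rho sigma : 0 <= c -> psd rho -> psd sigma ->
  qal (rC c *: rho) sigma = c `^ al * qal rho sigma.
Proof.
by move=> c0 pr ps; rewrite /qal sandwZ (mpowZ _ c0 (psd_sandw pr ps)) rtraceZ.
Qed.

Lemma qal_le rho rho' sigma : psd rho -> psd rho' -> psd sigma -> lep rho rho' ->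
  qal rho sigma <= qal rho' sigma.
Proof.
move=> pr pr' ps rr; apply: rtrace_mpow_le; try exact: psd_sandw.
by have := lep_conj (mp swexp sigma) rr; rewrite (mpow_herm _ ps).
Qed.

Lemma qal_convex (I : finType) (w : I -> R) (A : I -> 'M[C]_n) sigma :
  (forall i, 0 <= w i) -> \sum_i w i = 1 -> (forall i, psd (A i)) -> psd sigma ->
  qal (\sum_i rC (w i) *: A i) sigma <= \sum_i w i * qal (A i) sigma.
Proof.
move=> w0 w1 pA ps; rewrite /qal sandw_sum.
under eq_bigr do rewrite sandwZ.
by apply: rtrace_mpow_convex => // i; exact: psd_sandw.
Qed.

End Sandwich.
End Alpha.
End Young.

(** * Relative entropy *)

Section Dpi.
Variable R : realType.
Local Notation C := R[i].

Definition kraus e m n (V : 'I_e -> 'M[C]_(n, m)) (X : 'M[C]_m) : 'M[C]_n :=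
  \sum_r V r *m X *m (V r)^h.

Section Kraus.
Variables (e m n : nat) (V : 'I_e -> 'M[C]_(n, m)).

Lemma krausD X Y : kraus V (X + Y) = kraus V X + kraus V Y.
Proof. by rewrite -big_split; apply: eq_bigr => r _; rewrite mulmxDr mulmxDl. Qed.

Lemma krausZ c X : kraus V (c *: X) = c *: kraus V X.
Proof.
by rewrite scaler_sumr; apply: eq_bigr => r _; rewrite -scalemxAr -scalemxAl.
Qed.

Lemma krausB X Y : kraus V (X - Y) = kraus V X - kraus V Y.
Proof. by rewrite krausD -scaleN1r krausZ scaleN1r. Qed.

Lemma psd_kraus X : psd X -> psd (kraus V X).
Proof. by move=> pX; apply: psd_sum => r _; exact: psd_conj. Qed.

Lemma lep_kraus X Y : lep X Y -> lep (kraus V X) (kraus V Y).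
Proof. by rewrite /lep -krausB; exact: psd_kraus. Qed.

Lemma rtrace_krausM X (Y : 'M[C]_n) :
  rtrace (Y *m kraus V X) = rtrace ((\sum_r (V r)^h *m Y *m V r) *m X).
Proof.
rewrite mulmx_sumr mulmx_suml !rtrace_sum; apply: eq_bigr => r _.
by rewrite !mulmxA rtraceC !mulmxA.
Qed.

Hypothesis V1 : \sum_r (V r)^h *m V r = 1%:M.

Lemma tr_kraus X : \tr (kraus V X) = \tr X.
Proof.
rewrite raddf_sum -[in RHS](mul1mx X) -V1 mulmx_suml raddf_sum; apply: eq_bigr => r _ /=.
by rewrite mxtrace_mulC mulmxA.
Qed.

Lemma rtrace_kraus X : rtrace (kraus V X) = rtrace X.
Proof. by rewrite /rtrace tr_kraus. Qed.

(* The block row of the [V r]^* is a co-isometry. *)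
Lemma hs_kraus_contraction q (Z : 'I_e -> 'M[C]_(n, q)) :
  hs (\sum_r (V r)^h *m Z r) <= \sum_r hs (Z r).
Proof.
set P := \sum_r _; have : 0 <= \sum_r hs (Z r - V r *m P).
  by apply: sumr_ge0 => r _; exact: hs_ge0.
have hsB r : hs (Z r - V r *m P) = hs (Z r) - 2 * rtrace (P^h *m ((V r)^h *m Z r))
     + rtrace (P^h *m ((V r)^h *m V r) *m P).
  rewrite /hs adjmxB adjmxM mulmxBl !mulmxBr !rtraceB !mulmxA.
  have -> : rtrace ((Z r)^h *m V r *m P) = rtrace (P^h *m (V r)^h *m Z r).
    by rewrite -rtrace_adj !adjmxM adjmxK mulmxA.
  lra.
under eq_bigr do rewrite hsB.
rewrite !big_split /= sumrN -mulr_sumr -!rtrace_sum -mulmx_sumr -mulmx_suml -mulmx_sumr.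
by rewrite V1 mulmx1 -/P -/(hs P); lra.
Qed.

End Kraus.

Definition relr n (rho sigma : 'M[C]_n) : R :=
  rtrace (fc (fun x => x * ln x) rho) - rtrace (rho *m fc (@ln R) sigma).

(** The points along which derivatives at [t = 0] are taken; the shift by 2 keeps them strictly
    inside the unit interval. *)
Definition tk (k : nat) : R := k.+2%:R^-1.

Lemma tk_itv k : 0 < tk k < 1.
Proof. by rewrite /tk invr_gt0 ltr0n /= invf_lt1 ?ltr1n ?ltr0n. Qed.

Lemma tk_cvg : tk @ \oo --> (0 : R).
Proof.
have h := @cvg_harmonic R.
apply: (@squeeze_cvgr _ _ _ _ (fun=> 0) harmonic) => //; last exact: cvg_cst.
near=> k; have /andP[t0 _] := tk_itv k; rewrite (ltW t0) /= /tk /harmonic.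
by rewrite lef_pV2 ?posrE ?ltr0n// ler_nat.
Unshelve. all: by end_near.
Qed.

Lemma expR_slope_cvg (c : R) : (fun k => (expR (tk k * c) - 1) / tk k) @ \oo --> c.
Proof.
apply: (@squeeze_cvgr _ _ _ _ (fun=> c) (fun k => c * expR (tk k * c))).
- near=> k; have /andP[t0 _] := tk_itv k; move: (tk k) t0 => t t0.
  rewrite ler_pdivlMr// ler_pdivrMr//; apply/andP; split.
    by have := expR_ge1Dx (t * c); lra.
  have := expR_ge1Dx (- (t * c)).
  rewrite -(ler_pM2r (expR_gt0 (t * c))) -expRD addNr expR0; lra.
- exact: cvg_cst.
- rewrite -[X in _ --> X]mulr1; apply: cvgMr.
  rewrite -(@expR0 R); apply: (@continuous_cvg _ _ _ _ _ _ expR).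
    exact: continuous_expR.
  rewrite -(mul0r c); apply: cvgMl; exact: tk_cvg.
Unshelve. all: by end_near.
Qed.

(** The derivative at [t = 0] of [a^t b^(1-t)]. For [b = 0] every quotient vanishes, since
    [0^(1-t) = 0], in agreement with the value of the right-hand side. *)
Lemma powR_slope_cvg (a b : R) : 0 <= a -> 0 <= b -> (a = 0 -> b = 0) ->
  (fun k => (a `^ tk k * b `^ (1 - tk k) - b) / tk k) @ \oo
    --> ln a * b - b * ln b.
Proof.
move=> a0 b0 ab; have [bE|bn0] := eqVneq b 0.
  rewrite bE !mul0r mulr0 subr0; under eq_fun => k.
    have /andP[_ t1] := tk_itv k.
    rewrite powR0; last by rewrite subr_eq0 gt_eqF.
    rewrite mulr0 subr0 mul0r; over.
  exact: cvg_cst.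
have an0 : a != 0 by apply: contraNneq bn0 => /ab ->.
rewrite (mulrC (ln a)) -mulrBr; under eq_fun => k.
  rewrite (_ : _ / _ = b * ((expR (tk k * (ln a - ln b)) - 1) / tk k)); last first.
    rewrite /powR (negbTE an0) (negbTE bn0) -expRD mulrA mulrBr mulr1; congr ((_ - _) / _).
    have {2}-> : b = expR (ln b) by rewrite lnK// posrE lt_neqAle eq_sym bn0.
    by rewrite -expRD; congr expR; ring.
  over.
by apply: cvgMr; exact: expR_slope_cvg.
Qed.

Lemma relr_specd n (rho sigma : 'M[C]_n) U V a b :
  specd sigma U a -> specd rho V b ->
  relr rho sigma = \sum_i \sum_j nsq ((U^h *m V) i j) *
     (b 0 j * ln (b 0 j) - ln (a 0 i) * b 0 j).
Proof.
move=> sa rb; have [/= uU _] := sa; have [/= uV _] := rb.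
rewrite /relr (rtrace_fcalc _ rb) -(overlap_sumr uU uV) rtraceC.
rewrite -{1}(@fcalc_id _ _ id _ (specd_herm rb))// (rtrace_form1 _ _ sa rb).
rewrite -sumrB; apply: eq_bigr => i _; rewrite -sumrB; apply: eq_bigr => j _.
by rewrite -mulrBr.
Qed.

Lemma relr_cvg n (rho sigma : 'M[C]_n) : psd rho -> psd sigma -> (rho <= sigma)%MS ->
  (fun k => (rtrace (mp (tk k) sigma *m mp (1 - tk k) rho) - rtrace rho) / tk k)
    @ \oo --> - relr rho sigma.
Proof.
move=> pr ps rs.
have [U [a [sa a0]]] := psd_spec ps; have [V [b [rb b0]]] := psd_spec pr.
have [/= uU _] := sa; have [/= uV _] := rb.
have E k : (rtrace (mp (tk k) sigma *m mp (1 - tk k) rho) - rtrace rho) / tk k =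
   \sum_i \sum_j nsq ((U^h *m V) i j) *
     ((a 0 i `^ tk k * b 0 j `^ (1 - tk k) - b 0 j) / tk k).
  rewrite !mpE (rtrace_form1 _ _ sa rb).
  rewrite -{1}(@fcalc_id _ _ id _ (specd_herm rb))// (rtrace_fcalc _ rb).
  rewrite -(overlap_sumr uU uV) -sumrB mulr_suml; apply: eq_bigr => i _.
  rewrite -sumrB mulr_suml; apply: eq_bigr => j _.
  by rewrite -mulrBr mulrA.
under eq_fun do rewrite E.
rewrite (relr_specd sa rb) -sumrN; apply: cvg_sumr => i.
rewrite -sumrN; apply: cvg_sumr => j; rewrite -mulrN opprB.
have [W0|W0] := eqVneq ((U^h *m V) i j) 0.
  have -> : nsq ((U^h *m V) i j) = 0 by apply/eqP; rewrite nsq_eq0 W0.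
  rewrite mul0r; under eq_fun do rewrite mul0r.
  exact: cvg_cst.
apply: cvgMr; apply: powR_slope_cvg => // ai; apply/eqP; apply: contraNT W0 => bj.
by apply/eqP; exact: (submx_overlap rs sa rb).
Qed.

(** At [t = 0] the two sides of the interpolation inequality, taken at [X = 1], are the equal traces
    of [rho] and [rho'], so the inequality passes to the slopes. With [J] the dual of a channel this
    is data processing; with [J] the identity it is antitonicity in the second argument. *)
Lemma relr_interp m n (rho sigma : 'M[C]_m) (rho' sigma' : 'M[C]_n)
  (J : 'M[C]_n -> 'M[C]_m) :
  psd rho -> psd sigma -> psd rho' -> psd sigma' ->
  (rho <= sigma)%MS -> (rho' <= sigma')%MS ->
  (forall X Y, J (X + Y) = J X + J Y) -> J 1%:M = 1%:M ->
  (forall X, rtrace ((J X)^h *m J X *m rho) <= rtrace (X^h *m X *m rho')) ->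
  (forall X, rtrace ((J X)^h *m sigma *m J X) <= rtrace (X^h *m sigma' *m X)) ->
  rtrace rho = rtrace rho' ->
  relr rho' sigma' <= relr rho sigma.
Proof.
move=> pr ps pr' ps' rs rs' JD J1 H0 H1 tE.
rewrite -lerN2; apply: ler_cvg_to (relr_cvg pr ps rs) (relr_cvg pr' ps' rs') _.
near=> k; have tk01 := tk_itv k; have /andP[t0 _] := tk01.
rewrite ler_pM2r ?invr_gt0// tE lerD2r.
have := lieb_interp ps pr ps' pr' JD H0 H1 tk01 1%:M.
by rewrite J1 !adjmx1 !mul1mx !mulmx1.
Unshelve. all: by end_near.
Qed.

(** [J] is the Heisenberg-picture dual of the channel, which is unital. The two quadratic hypotheses
    are the Kadison-Schwarz inequalities for [J(X)^h J(X)] and [J(X) J(X)^h], tested on [rho] and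
    [sigma]; [hs_kraus_contraction] provides both. *)
Lemma relr_dpi e m n (V : 'I_e -> 'M[C]_(n, m)) (rho sigma : 'M[C]_m) :
  \sum_r (V r)^h *m V r = 1%:M -> psd rho -> psd sigma -> (rho <= sigma)%MS ->
  (kraus V rho <= kraus V sigma)%MS ->
  relr (kraus V rho) (kraus V sigma) <= relr rho sigma.
Proof.
move=> V1 pr ps rs krs.
apply: (@relr_interp _ _ _ _ _ _ (fun K => \sum_r (V r)^h *m K *m V r)) => //.
- exact: psd_kraus.
- exact: psd_kraus.
- by move=> X Y; rewrite -big_split; apply: eq_bigr => r _; rewrite mulmxDr mulmxDl.
- by under eq_bigr do rewrite mulmx1.
- move=> X; have [S rE] := psd_sqrt pr.
  have -> : rtrace ((\sum_r (V r)^h *m X *m V r)^h *m (\sum_r (V r)^h *m X *m V r) *m rho)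
     = hs (\sum_r (V r)^h *m (X *m V r *m S)).
    rewrite -rE mulmxA rtraceC !mulmxA -(mulmxA _ _ S) -adjmxM /hs mulmx_suml.
    by congr (rtrace (_^h *m _)); apply: eq_bigr => r _; rewrite !mulmxA.
  apply: le_trans (hs_kraus_contraction V1 _) _.
  rewrite rtrace_krausM mulmx_suml rtrace_sum; apply: ler_sum => r _.
  by rewrite /hs -rE !adjmxM !mulmxA [leRHS]rtraceC !mulmxA.
- move=> X; have [S sE] := psd_sqrt ps.
  have -> : rtrace ((\sum_r (V r)^h *m X *m V r)^h *m sigma *m (\sum_r (V r)^h *m X *m V r))
     = hs (\sum_r (V r)^h *m (X^h *m V r *m S)).
    have -> : \sum_r (V r)^h *m (X^h *m V r *m S) = (\sum_r (V r)^h *m X *m V r)^h *m S.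
      rewrite adjmx_sum mulmx_suml; apply: eq_bigr => r _.
      by rewrite !adjmxM adjmxK !mulmxA.
    by rewrite -hs_adj /hs adjmxK adjmxM adjmxK -sE !mulmxA.
  apply: le_trans (hs_kraus_contraction V1 _) _.
  rewrite [leRHS]rtraceC mulmxA.
  rewrite rtrace_krausM mulmx_suml rtrace_sum; apply: ler_sum => r _.
  by rewrite /hs -sE !adjmxM adjmxK !mulmxA [leRHS]rtraceC !mulmxA.
- by rewrite rtrace_kraus.
Qed.

Lemma relr_antitone n (rho sigma sigma' : 'M[C]_n) :
  psd rho -> psd sigma -> psd sigma' -> (rho <= sigma)%MS -> (rho <= sigma')%MS ->
  lep sigma sigma' -> relr rho sigma' <= relr rho sigma.
Proof.
move=> pr ps ps' rs rs' ss'; apply: (@relr_interp _ _ _ _ _ _ id pr ps pr ps' rs rs') => // X.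
have E s0 : rtrace (X^h *m s0 *m X) = rtrace (s0 *m (X *m X^h)).
  by rewrite -mulmxA rtraceC -mulmxA.
rewrite !E.
exact: (lep_rtraceM (psd_gram X) ss').
Qed.

Lemma relr_scale n c (rho : 'M[C]_n) : 0 < c -> psd rho ->
  relr rho (rC c *: rho) = - ln c * rtrace rho.
Proof.
move=> c0 pr; have hr := pr.1; rewrite /relr.
have -> : rC c *: rho = fc (fun x => c * x) rho.
  by rewrite -{1}(@fcalc_id _ _ id _ hr)// fcalcZ.
rewrite fcalc_comp// -{2 4}(@fcalc_id _ _ id _ hr)// fcalcM//.
rewrite (@psd_ext _ _ (fun x => id x * (@ln R \o *%R c) x)
   (fun x => ln c * x + x * ln x) _ pr).
  rewrite -(fcalcD (fun x => ln c * x)) // rtraceD -fcalcZ// rtraceZ; lra.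
move=> x; rewrite le_eqVlt => /predU1P[<-|x0] /=; first by rewrite !mul0r mulr0 addr0.
by rewrite lnM ?posrE//; ring.
Qed.

(** Lowering [sigma] to [c rho] can only increase the relative entropy, and there it is explicit. *)
Lemma relr_bound n c (rho sigma : 'M[C]_n) : 0 < c -> psd rho -> psd sigma ->
  lep (rC c *: rho) sigma -> relr rho sigma <= - ln c * rtrace rho.
Proof.
move=> c0 pr ps rs; rewrite -(relr_scale c0 pr).
have cV : rC c^-1 *: (rC c *: rho) = rho.
  by rewrite rCZ mulVf ?gt_eqF// rC1 scale1r.
have c1 : 0 <= c^-1 by rewrite invr_ge0 ltW.
have sub1 : (rho <= rC c *: rho)%MS by rewrite -{1}cV; exact: scalemx_sub.
have h := lepZ c1 rs; rewrite cV in h.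
exact: (relr_antitone pr (psdZ (ltW c0) pr) ps sub1 (lep_submx pr ps h) rs).
Qed.

(** For [b > 0] the gap is [b (e^u - 1 - u)] with [u = ln a - ln b], which vanishes only at [u = 0].
    The equality case is kept for the faithfulness part of [relr_klein]. *)
Lemma klein_scalar (a b : R) : 0 <= a -> 0 <= b -> (a = 0 -> b = 0) ->
  ln a * b <= a + (b * ln b - b) ?= iff (a == b).
Proof.
move=> a0 b0 ab; have [bE|bn0] := eqVneq b 0.
  by rewrite bE !mul0r mulr0 subr0 addr0; split=> //; exact: eq_sym.
have an0 : a != 0 by apply: contraNneq bn0 => /ab ->.
have ap : 0 < a by rewrite lt_neqAle eq_sym an0.
have bp : 0 < b by rewrite lt_neqAle eq_sym bn0.
have E : a + (b * ln b - b) - ln a * b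
   = b * (expR (ln a - ln b) - (1 + (ln a - ln b))).
  by rewrite expRD expRN !lnK//; field.
split; first by rewrite -subr_ge0 E mulr_ge0// subr_ge0 expR_ge1Dx.
apply/eqP/eqP => [/esym/eqP|->]; last by ring.
rewrite -subr_eq0 E mulf_eq0 (negbTE bn0) subr_eq0 /= => /eqP h.
apply/eqP; apply/negPn/negP => neq.
have /expR_gt1Dx : ln a - ln b != 0.
  by rewrite subr_eq0; apply: contra neq => /eqP/ln_inj ->.
by rewrite h ltxx.
Qed.

Lemma relr_klein n (rho sigma : 'M[C]_n) : psd rho -> psd sigma -> (rho <= sigma)%MS ->
  rtrace rho = rtrace sigma -> 0 <= relr rho sigma /\ (relr rho sigma = 0 -> rho = sigma).
Proof.
move=> pr ps rs tE.
have [U [a [sa a0]]] := psd_spec ps; have [V [b [rb b0]]] := psd_spec pr.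
have [/= uU _] := sa; have [/= uV _] := rb.
have ts : rtrace sigma = \sum_i a 0 i.
  by rewrite -(@fcalc_id _ _ id _ ps.1)// (rtrace_fcalc _ sa).
have tr : rtrace rho = \sum_i b 0 i.
  by rewrite -(@fcalc_id _ _ id _ pr.1)// (rtrace_fcalc _ rb).
have rE : rtrace (rho *m fc (@ln R) sigma) =
    \sum_i \sum_j nsq ((U^h *m V) i j) * (ln (a 0 i) * b 0 j).
  by rewrite rtraceC -{1}(@fcalc_id _ _ id _ pr.1)// (rtrace_form1 _ _ sa rb).
have fE : rtrace (fc (fun x => x * ln x) rho) =
   \sum_i a 0 i + \sum_j (b 0 j * ln (b 0 j) - b 0 j).
  by rewrite (rtrace_fcalc _ rb) sumrB -ts -tE tr; ring.
have kl i j : (U^h *m V) i j != 0 ->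
    ln (a 0 i) * b 0 j <= a 0 i + (b 0 j * ln (b 0 j) - b 0 j) ?= iff (a 0 i == b 0 j).
  move=> W0; apply: klein_scalar => // ai; apply/eqP; apply: contraNT W0 => bj.
  by apply/eqP; exact: (submx_overlap rs sa rb).
have kl1 i j W0 := (kl i j W0).1.
split.
  by rewrite /relr rE fE subr_ge0; exact: (overlap_sum_le uU uV kl1).
rewrite /relr rE fE => /eqP; rewrite subr_eq0 => /eqP/esym E.
rewrite -(@fcalc_id _ _ id _ pr.1)// -[RHS](@fcalc_id _ _ id _ ps.1)//; apply/esym.
apply: (fcalc_overlap uU uV sa rb) => i j W0.
have := overlap_sum_eq uU uV kl1 E W0 => /eqP.
by rewrite (kl i j W0).2 => /eqP.
Qed.

End Dpi.

(** * Data processing for sandwiched divergences *)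

Section DpiAlpha.
Variable R : realType.
Local Notation C := R[i].

Section Selectors.
Variables e n : nat.

(** The selector of the [r]-th block. As Kraus operators these matrices give the partial trace over
    the first factor. *)
Definition selmx (r : 'I_e) : 'M[C]_(n, e * n) :=
  \matrix_(j, x) (mxtens_index (r, j) == x)%:R.

Lemma conj_natb (b : bool) : conjc (b%:R : C) = b%:R.
Proof. exact: conjc_nat. Qed.

Lemma selmxK r s : selmx r *m (selmx s)^h = if r == s then 1%:M else 0.
Proof.
apply/matrixP => i j; rewrite mxE (bigD1 (mxtens_index (r, i)))//= big1 => [|x xi]; last first.
  by rewrite mxE eq_sym (negbTE xi) mul0r.
rewrite adjmxE !mxE eqxx mul1r addr0 conj_natb (can_eq (@mxtens_indexK _ _)) xpair_eqE.
by have [_|_] := eqVneq r s; rewrite mxE//= eq_sym.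
Qed.

Lemma selmx1 : \sum_r (selmx r)^h *m selmx r = 1%:M.
Proof.
apply/matrixP => x y; rewrite summxE; case: (mxtens_indexP x) => r i.
rewrite (bigD1 r)//= big1 => [|s sr].
  rewrite addr0 mxE (bigD1 i)//= big1 => [|k ki].
    by rewrite adjmxE !mxE eqxx conj_natb mul1r addr0.
  by rewrite adjmxE !mxE (can_eq (@mxtens_indexK _ _)) xpair_eqE (negbTE ki) andbF conjc0 mul0r.
rewrite mxE big1// => k _.
by rewrite adjmxE !mxE (can_eq (@mxtens_indexK _ _)) xpair_eqE (negbTE sr) conjc0 mul0r.
Qed.
End Selectors.

Section Alpha.
Variable al : R.
Hypothesis al1 : 1 < al.
Let al0 : 0 < al. Proof. exact: lt_trans ltr01 al1. Qed.
Let p := 1 - al^-1.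
Let p0 : 0 < p. Proof. by rewrite subr_gt0 invf_lt1. Qed.
Let p1 : p < 1. Proof. by rewrite /p; have := al0; rewrite -invr_gt0; lra. Qed.

Variables (e m n : nat) (V : 'I_e -> 'M[C]_(n, m)).
Hypothesis V1 : \sum_r (V r)^h *m V r = 1%:M.

(** With [W] the Stinespring isometry that stacks the [V r], this is [W^h (1 *t K)]. *)
Definition kraus_lift (K : 'M[C]_n) : 'M[C]_(m, e * n) :=
  \sum_r (V r)^h *m K *m selmx n r.

Lemma kraus_lift_gram K :
  kraus_lift K *m (kraus_lift K)^h = \sum_r (V r)^h *m (K *m K^h) *m V r.
Proof.
rewrite /kraus_lift adjmx_sum mulmx_suml; apply: eq_bigr => r _.
rewrite mulmx_sumr (bigD1 r)//= big1 => [|s sr].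
  rewrite addr0 !adjmxM adjmxK !mulmxA -(mulmxA _ (selmx n r)) selmxK eqxx.
  by rewrite mulmx1.
rewrite !adjmxM adjmxK !mulmxA -(mulmxA _ (selmx n r)) selmxK eq_sym (negbTE sr).
by rewrite mulmx0 !mul0mx.
Qed.

Let pinv1 : 1 < p^-1. Proof. by rewrite invf_gt1. Qed.

(* The partial-trace monotonicity of [tr (K^* sigma^p K)^(1/p)] (Epstein's
   concavity in disguise): linearise the power by Young's inequality with
   [Y = G^(1/p)] and interpolate. *)
Lemma rtrace_mpow_lift K (sigma : 'M[C]_m) : psd sigma ->
  rtrace (mp p^-1 ((kraus_lift K)^h *m mp p sigma *m kraus_lift K))
  <= rtrace (mp p^-1 (K^h *m mp p (kraus V sigma) *m K)).
Proof.
move=> ps; set G := _ *m kraus_lift K; set G' := K^h *m _ *m K.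
have pG : psd G.
  by have := psd_conj (kraus_lift K)^h (psd_mpow p ps); rewrite adjmxK.
have pks := psd_kraus V ps.
have pG' : psd G' by have := psd_conj K^h (psd_mpow p pks); rewrite adjmxK.
pose Y := mp p^-1 G; pose Y' := kraus (selmx n) Y.
have pY : psd Y := psd_mpow _ pG.
have pY' : psd Y' := psd_kraus _ pY.
have tY : rtrace Y' = rtrace Y by apply: rtrace_kraus; exact: selmx1.
(* [Y] is chosen so that [G = Y^p]; the linearised expression is then exactly [tr Y]. *)
have GY : rtrace (G *m mp (1 - p) Y) = rtrace Y.
  rewrite /Y mpow_mpow// (_ : p^-1 * (1 - p) = p^-1 - 1).
    by apply: rtrace_mpow_split.
  by field; rewrite gt_eqF.
have h : rtrace (G *m mp (1 - p) Y) <= rtrace (G' *m mp (1 - p) Y').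
  apply: (lieb_interp (J := kraus_lift) ps pY pks pY').
  - move=> X Z; rewrite /kraus_lift -big_split; apply: eq_bigr => r _.
    by rewrite mulmxDr mulmxDl.
  - move=> X; have [S YE] := psd_sqrt pY.
    have -> : rtrace ((kraus_lift X)^h *m kraus_lift X *m Y)
        = hs (\sum_r (V r)^h *m (X *m selmx n r *m S)).
      rewrite -YE mulmxA rtraceC !mulmxA -(mulmxA _ _ S) -adjmxM /hs /kraus_lift mulmx_suml.
      by congr (rtrace (_^h *m _)); apply: eq_bigr => r _; rewrite !mulmxA.
    apply: le_trans (hs_kraus_contraction V1 _) _.
    rewrite rtrace_krausM mulmx_suml rtrace_sum; apply: ler_sum => r _.
    by rewrite /hs -YE !adjmxM !mulmxA [leRHS]rtraceC !mulmxA.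
  - move=> X; rewrite rtraceC mulmxA kraus_lift_gram -rtrace_krausM.
    by rewrite [leRHS]rtraceC mulmxA.
  - by rewrite p0.
(* Young bounds the interpolated trace by [p tr G'^(1/p) + (1-p) tr Y']. The partial trace preserves
   [tr Y], so this term is absorbed and a factor [p] cancels. *)
have := young pinv1 pG' (psd_mpow (1 - p) pY').
rewrite invrK (mpow_mpow _ _ pY') mulfV ?gt_eqF ?subr_gt0// (mpow1 pY') tY.
move=> h2; have := le_trans h h2; rewrite GY -/Y => h3.
by rewrite -(ler_pM2l p0); lra.
Qed.

Lemma qal_dpi (rho sigma : 'M[C]_m) : psd rho -> psd sigma -> (rho <= sigma)%MS ->
  (kraus V rho <= kraus V sigma)%MS ->
  qal al (kraus V rho) (kraus V sigma) <= qal al rho sigma.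
Proof.
move=> pr ps rs krs.
have pkr := psd_kraus V pr; have pks := psd_kraus V ps.
rewrite /qal; set X := sandw al rho sigma.
set X' := sandw al (kraus V rho) (kraus V sigma).
have pX : psd X := psd_sandw al pr ps.
have pX' : psd X' := psd_sandw al pkr pks.
pose h := (al - 1) / 2.
have h0 : h != 0 by rewrite /h gt_eqF// divr_gt0// subr_gt0.
(* [K *m K^h] is the maximiser [H] of the variational formula for the output pair: it pairs with the
   output state to [tr X'^al], and the compressed power of the output [sigma] is [X'^(al-1)], whose
   power [1/p] is [X'^al]. *)
pose K := mp (swexp al) (kraus V sigma) *m mp h X'.
have hh : mp h X' *m mp h X' = mp (al - 1) X'.
  by rewrite mpowD// -?splitr// gt_eqF// subr_gt0.
have X'E : rtrace (K *m K^h *m kraus V rho) = rtrace (mp al X').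
  rewrite /K adjmxM (mpow_herm _ pks) (mpow_herm _ pX').
  rewrite -(rtrace_mpow_split al1 pX') -hh [RHS]rtraceC.
  by rewrite !mulmxA -!(mulmxA (mp (swexp al) _)) rtraceC.
have GE : K^h *m mp p (kraus V sigma) *m K = mp (al - 1) X'.
  rewrite /K adjmxM (mpow_herm _ pks) (mpow_herm _ pX') !mulmxA.
  rewrite -(mulmxA (mp h X')) mpowD//; last first.
    by rewrite swexpE// -/p gt_eqF//; have := p0; lra.
  rewrite -(mulmxA (mp h X')) mpowV//; first last.
  - by rewrite swexpE// -/p; lra.
  - by rewrite swexpE// -/p gt_eqF//; have := p0; lra.
  suff -> : mp h X' *m supp (kraus V sigma) = mp h X' by [].
  have -> : mp h X' = mp (h - 1) X' *m X'.
    by rewrite -{3}(mpow1 pX') mpowD// subrK.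
  by rewrite -mulmxA sandw_supp.
have lift := rtrace_mpow_lift K ps.
rewrite GE mpow_mpow// (_ : (al - 1) * p^-1 = al) in lift; last first.
  by rewrite /p; field; rewrite !gt_eqF//= subr_gt0.
(* Moves the same test to the input: the pairing with the output state becomes [tr X M M^h]. Young
   applies to it, and [M M^h] may be traded for [M^h M], which [lift] controls. *)
pose M := mp (p / 2) sigma *m kraus_lift K.
have hM : rtrace (K *m K^h *m kraus V rho) = rtrace (X *m (M *m M^h)).
  rewrite rtrace_krausM -kraus_lift_gram -{1}(sandwK al1 pr ps rs) -/X.
  rewrite /M adjmxM (mpow_herm _ ps) -/p; move: (X) => Z.
  by rewrite [RHS]rtraceC !mulmxA rtraceC !mulmxA.
have := young al1 pX (psd_gram M).
rewrite -hM X'E -/p rtrace_mpow_gram; last by rewrite invr_eq0 gt_eqF.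
have -> : M^h *m M = (kraus_lift K)^h *m mp p sigma *m kraus_lift K.
  rewrite /M adjmxM (mpow_herm _ ps) !mulmxA -(mulmxA _ (mp _ _) (mp _ _)) mpowD//.
    by rewrite -splitr.
  by rewrite -splitr gt_eqF.
move=> y; have p0' := p0; have := ler_wpM2l (ltW p0) lift.
have th : 0 < al^-1 by rewrite invr_gt0.
by move=> h1; rewrite -(ler_pM2l th); move: y h1; rewrite /p; lra.
Qed.

End Alpha.
End DpiAlpha.

(** * Tensor products and partial traces *)

Section Tensor.
Variable R : realType.
Local Notation C := R[i].

Section Bilinear.
Variables m n p q : nat.
Implicit Types (A : 'M[C]_(m, n)) (B : 'M[C]_(p, q)).

Lemma tensmxDl A A' B : (A + A') *t B = A *t B + A' *t B.
Proof. by apply/matrixP => i j; rewrite !mxE mulrDl. Qed.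
Lemma tensmxDr A B B' : A *t (B + B') = A *t B + A *t B'.
Proof. by apply/matrixP => i j; rewrite !mxE mulrDr. Qed.
Lemma tensmxZl c A B : (c *: A) *t B = c *: (A *t B).
Proof. by apply/matrixP => i j; rewrite !mxE mulrA. Qed.
Lemma tensmxZr c A B : A *t (c *: B) = c *: (A *t B).
Proof. by apply/matrixP => i j; rewrite !mxE mulrCA. Qed.
Lemma tensmxBl A A' B : (A - A') *t B = A *t B - A' *t B.
Proof. by rewrite -scaleN1r tensmxDl tensmxZl scaleN1r. Qed.
Lemma tensmx_suml (I : Type) (r : seq I) (F : I -> 'M[C]_(m, n)) B :
  (\sum_(i <- r) F i) *t B = \sum_(i <- r) F i *t B.
Proof.
by apply: (big_morph (fun A => A *t B)) => [A A'|]; rewrite ?tensmxDl ?tens0mx.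
Qed.
Lemma tensmx_sumr (I : Type) (r : seq I) A (F : I -> 'M[C]_(p, q)) :
  A *t (\sum_(i <- r) F i) = \sum_(i <- r) A *t F i.
Proof.
by apply: (big_morph (fun B => A *t B)) => [B B'|]; rewrite ?tensmxDr ?tensmx0.
Qed.
End Bilinear.

Lemma tens1mx1 m n : (1%:M : 'M[C]_m) *t (1%:M : 'M[C]_n) = 1%:M.
Proof.
apply/matrixP => x y; case: (mxtens_indexP x) => i j; case: (mxtens_indexP y) => k l.
rewrite tensmxE !mxE (can_eq (@mxtens_indexK _ _)) xpair_eqE.
by case: eqP; rewrite ?mul1r ?mul0r.
Qed.

Lemma unitary_tens m n (U : 'M[C]_m) (V : 'M[C]_n) : unitary U -> unitary V ->
  unitary (U *t V).
Proof. by move=> uU uV; rewrite /unitary adjmx_tens tensmx_mul uU uV tens1mx1. Qed.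

(** Eigenvalues on a composite system: [op] is multiplication for [A *t B] and addition for a
    noninteracting Hamiltonian. *)
Definition tensrv m n (op : R -> R -> R) (a : 'rV[R]_m) (b : 'rV[R]_n) : 'rV[R]_(m * n) :=
  \row_x op (a 0 (mxtens_unindex x).1) (b 0 (mxtens_unindex x).2).

Lemma tensrvE m n op (a : 'rV[R]_m) (b : 'rV[R]_n) i j :
  tensrv op a b 0 (mxtens_index (i, j)) = op (a 0 i) (b 0 j).
Proof. by rewrite mxE mxtens_indexK. Qed.

Lemma diag_tens m n (a : 'rV[R]_m) (b : 'rV[R]_n) :
  diag_mx (map_mx (@rC R) a) *t diag_mx (map_mx (@rC R) b)
  = diag_mx (map_mx (@rC R) (tensrv *%R a b)).
Proof.
apply/matrixP => x y; case: (mxtens_indexP x) => i j; case: (mxtens_indexP y) => k l.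
rewrite tensmxE !mxE (can_eq (@mxtens_indexK _ _)) xpair_eqE !mxtens_indexK /=.
case: eqP => _; rewrite ?mulr0n ?mul0r//; case: eqP => _; rewrite ?mulr0n ?mulr0//.
by rewrite !mulr1n rmorphM.
Qed.

Lemma specd_tens m n (A : 'M[C]_m) (B : 'M[C]_n) U V a b :
  specd A U a -> specd B V b -> specd (A *t B) (U *t V) (tensrv *%R a b).
Proof.
move=> [/= uU AE] [/= uV BE]; split=> /=; first exact: unitary_tens.
by rewrite -diag_tens adjmx_tens !tensmx_mul -AE -BE.
Qed.

Lemma psd_tens m n (A : 'M[C]_m) (B : 'M[C]_n) : psd A -> psd B -> psd (A *t B).
Proof.
move=> /psd_spec[U [a [Aa a0]]] /psd_spec[V [b [Bb b0]]].
apply: (specd_psd (specd_tens Aa Bb)) => x; rewrite mxE.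
exact: mulr_ge0.
Qed.

Lemma fc_tens m n (A : 'M[C]_m) (B : 'M[C]_n) U V a b (f g h : R -> R) :
  specd A U a -> specd B V b ->
  (forall i j, h (a 0 i * b 0 j) = f (a 0 i) * g (b 0 j)) ->
  fc h (A *t B) = fc f A *t fc g B.
Proof.
move=> Aa Bb E; rewrite (fcE h (specd_tens Aa Bb)).
have [/= uU _] := fcalc_specd f Aa; have [_ /= ->] := fcalc_specd f Aa.
have [_ /= ->] := fcalc_specd g Bb.
rewrite adjmx_tens -!tensmx_mul diag_tens; congr (_ *m diag_mx _ *m _).
apply/rowP => x; case: (mxtens_indexP x) => i j.
by rewrite !mxE mxtens_indexK E.
Qed.

Lemma mp_tens m n t (A : 'M[C]_m) (B : 'M[C]_n) : psd A -> psd B ->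
  mp t (A *t B) = mp t A *t mp t B.
Proof.
move=> /psd_spec[U [a [Aa a0]]] /psd_spec[V [b [Bb b0]]].
by rewrite !mpE; apply: (fc_tens Aa Bb) => i j; rewrite powRM.
Qed.

Lemma rtrace_tens m n (A : 'M[C]_m) (B : 'M[C]_n) : hermitian A -> hermitian B ->
  rtrace (A *t B) = rtrace A * rtrace B.
Proof. by move=> hA hB; rewrite /rtrace mxtrace_tens !herm_tr// -rmorphM. Qed.

Lemma sum_mxtens (W : nmodType) m n (F : 'I_(m * n) -> W) :
  \sum_x F x = \sum_(i < m) \sum_(j < n) F (mxtens_index (i, j)).
Proof.
rewrite pair_big (reindex (@mxtens_index m n)) /=; last first.
  by exists (@mxtens_unindex m n) => x _; rewrite (mxtens_indexK, mxtens_unindexK).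
by apply: eq_bigr => -[i j].
Qed.

Lemma mx_tens_sum m1 m2 (X : 'M[C]_(m1 * m2)) :
  X = \sum_(i < m1) \sum_(j < m1) \sum_(k < m2) \sum_(l < m2)
    X (mxtens_index (i, k)) (mxtens_index (j, l)) *: (delta_mx i j *t delta_mx k l).
Proof.
rewrite [LHS]matrix_sum_delta sum_mxtens; apply: eq_bigr => i _.
under eq_bigr do rewrite sum_mxtens.
rewrite exchange_big; apply: eq_bigr => j _; apply: eq_bigr => k _; apply: eq_bigr => l _.
congr (_ *: _); apply/matrixP => x y.
case: (mxtens_indexP x) => i' k'; case: (mxtens_indexP y) => j' l'.
rewrite tensmxE !mxE !(can_eq (@mxtens_indexK _ _)) !xpair_eqE.
by do 4!case: eqP => _; rewrite ?(mul0r, mulr0, mulr1).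
Qed.

Section LinMap.
Variables (m n : nat) (F : 'M[C]_m -> 'M[C]_n).
Hypothesis linF : lin_map F.

Lemma lin_mapD X Y : F (X + Y) = F X + F Y.
Proof. by have := linF 1 X Y; rewrite !scale1r. Qed.
Lemma lin_map0 : F 0 = 0.
Proof. by apply: (addrI (F 0)); rewrite -lin_mapD !addr0. Qed.
Lemma lin_mapZ c X : F (c *: X) = c *: F X.
Proof. by have := linF c X 0; rewrite lin_map0 !addr0. Qed.
Lemma lin_map_sum (I : Type) (r : seq I) (G : I -> 'M[C]_m) :
  F (\sum_(i <- r) G i) = \sum_(i <- r) F (G i).
Proof. by apply: big_morph; [exact: lin_mapD|exact: lin_map0]. Qed.
End LinMap.

Lemma lin_map_comp m n p (F : 'M[C]_n -> 'M[C]_p) (G : 'M[C]_m -> 'M[C]_n) :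
  lin_map F -> lin_map G -> lin_map (fun X => F (G X)).
Proof. by move=> lF lG c X Y; rewrite lG lF. Qed.

Lemma lin_mx_sum m n (F : 'M[C]_m -> 'M[C]_n) : lin_map F -> forall X,
  F X = \sum_i \sum_j X i j *: F (delta_mx i j).
Proof.
move=> lF X; rewrite [in LHS](matrix_sum_delta X) (lin_map_sum lF).
apply: eq_bigr => i _; rewrite (lin_map_sum lF); apply: eq_bigr => j _.
by rewrite (lin_mapZ lF).
Qed.

Lemma lin_tens_ext m1 m2 n (F G : 'M[C]_(m1 * m2) -> 'M[C]_n) :
  lin_map F -> lin_map G -> (forall A B, F (A *t B) = G (A *t B)) ->
  forall X, F X = G X.
Proof.
move=> lF lG FG X; rewrite [X]mx_tens_sum.
rewrite (lin_map_sum lF) (lin_map_sum lG); apply: eq_bigr => i _.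
rewrite (lin_map_sum lF) (lin_map_sum lG); apply: eq_bigr => j _.
rewrite (lin_map_sum lF) (lin_map_sum lG); apply: eq_bigr => k _.
rewrite (lin_map_sum lF) (lin_map_sum lG); apply: eq_bigr => l _.
by rewrite (lin_mapZ lF) (lin_mapZ lG) FG.
Qed.

Section Tensmap.
Variables (m1 n1 m2 n2 : nat) (N : 'M[C]_m1 -> 'M[C]_n1) (M : 'M[C]_m2 -> 'M[C]_n2).

(** Product operators span, so linearity and the values on products determine [tensmap]. Later
    identities use this in place of the fourfold sum. *)
Lemma tensmap_unique (F : 'M[C]_(m1 * m2) -> 'M[C]_(n1 * n2)) : lin_map F ->
  (forall A B, F (A *t B) = N A *t M B) -> forall X, tensmap N M X = F X.
Proof.
move=> lF FE X; rewrite [in RHS](mx_tens_sum X) /tensmap.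
rewrite (lin_map_sum lF); apply: eq_bigr => i _.
rewrite (lin_map_sum lF); apply: eq_bigr => j _.
rewrite (lin_map_sum lF); apply: eq_bigr => k _.
rewrite (lin_map_sum lF); apply: eq_bigr => l _.
by rewrite (lin_mapZ lF) FE.
Qed.

Lemma tensmap_lin : lin_map (tensmap N M).
Proof.
move=> c X Y; rewrite /tensmap scaler_sumr -big_split; apply: eq_bigr => i _ /=.
rewrite scaler_sumr -big_split; apply: eq_bigr => j _ /=.
rewrite scaler_sumr -big_split; apply: eq_bigr => k _ /=.
rewrite scaler_sumr -big_split; apply: eq_bigr => l _ /=.
by rewrite !mxE scalerDl scalerA.
Qed.

Lemma tensmap_tens A B : lin_map N -> lin_map M -> tensmap N M (A *t B) = N A *t M B.
Proof.
move=> lN lM; rewrite (lin_mx_sum lN A) (lin_mx_sum lM B) /tensmap.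
rewrite tensmx_suml; apply: eq_bigr => i _; rewrite tensmx_suml; apply: eq_bigr => j _.
rewrite tensmx_sumr; apply: eq_bigr => k _; rewrite tensmx_sumr; apply: eq_bigr => l _.
by rewrite tensmxE tensmxZl tensmxZr scalerA.
Qed.
End Tensmap.

Lemma idtens_lin k m n (N : 'M[C]_m -> 'M[C]_n) : lin_map (@idtens _ k m n N).
Proof. exact: tensmap_lin. Qed.

Lemma idtens_tens k m n (N : 'M[C]_m -> 'M[C]_n) (A : 'M[C]_k) B : lin_map N ->
  idtens N (A *t B) = A *t N B.
Proof. by move=> lN; rewrite /idtens tensmap_tens. Qed.

Lemma idtens_comp k m n p (F : 'M[C]_n -> 'M[C]_p) (G : 'M[C]_m -> 'M[C]_n) :
  lin_map F -> lin_map G -> forall X : 'M[C]_(k * m),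
  idtens (fun Y => F (G Y)) X = idtens F (idtens G X).
Proof.
move=> lF lG; apply: tensmap_unique.
  by apply: lin_map_comp; exact: idtens_lin.
by move=> A B; rewrite !idtens_tens.
Qed.

Lemma kraus_lin e m n (V : 'I_e -> 'M[C]_(n, m)) : lin_map (kraus V).
Proof. by move=> c X Y; rewrite krausD krausZ. Qed.

Definition id_kraus k e m n (V : 'I_e -> 'M[C]_(n, m)) (r : 'I_e) : 'M[C]_(k * n, k * m) :=
  1%:M *t V r.

Lemma idtens_kraus k e m n (V : 'I_e -> 'M[C]_(n, m)) (X : 'M[C]_(k * m)) :
  idtens (kraus V) X = kraus (id_kraus k V) X.
Proof.
apply: tensmap_unique; first exact: kraus_lin.
move=> A B; rewrite /kraus tensmx_sumr; apply: eq_bigr => r _.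
by rewrite /id_kraus adjmx_tens adjmx1 !tensmx_mul mul1mx mulmx1.
Qed.

Lemma id_kraus1 k e m n (V : 'I_e -> 'M[C]_(n, m)) : \sum_r (V r)^h *m V r = 1%:M ->
  \sum_r (id_kraus k V r)^h *m id_kraus k V r = 1%:M.
Proof.
move=> V1; under eq_bigr do rewrite /id_kraus adjmx_tens tensmx_mul adjmx1 mul1mx.
by rewrite -tensmx_sumr V1 tens1mx1.
Qed.

Definition tens_kraus e1 m1 n1 e2 m2 n2 (V : 'I_e1 -> 'M[C]_(n1, m1))
  (W : 'I_e2 -> 'M[C]_(n2, m2)) (x : 'I_(e1 * e2)) : 'M[C]_(n1 * n2, m1 * m2) :=
  V (mxtens_unindex x).1 *t W (mxtens_unindex x).2.

Lemma sum_tens e1 e2 m n p q (F : 'I_e1 -> 'M[C]_(m, n)) (G : 'I_e2 -> 'M[C]_(p, q)) :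
  \sum_(x < e1 * e2) F (mxtens_unindex x).1 *t G (mxtens_unindex x).2
  = (\sum_r F r) *t (\sum_s G s).
Proof.
apply/matrixP => i j; rewrite summxE mxE !summxE mulr_sum.
by apply: eq_bigr => x _; rewrite mxE.
Qed.

Lemma tensmap_kraus e1 m1 n1 e2 m2 n2 (V : 'I_e1 -> 'M[C]_(n1, m1))
  (W : 'I_e2 -> 'M[C]_(n2, m2)) X :
  tensmap (kraus V) (kraus W) X = kraus (tens_kraus V W) X.
Proof.
apply: tensmap_unique; first exact: kraus_lin.
move=> A B; rewrite {2 3}/kraus -sum_tens; apply: eq_bigr => x _.
by rewrite /tens_kraus adjmx_tens !tensmx_mul.
Qed.

Lemma tens_kraus1 e1 m1 n1 e2 m2 n2 (V : 'I_e1 -> 'M[C]_(n1, m1))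
  (W : 'I_e2 -> 'M[C]_(n2, m2)) : \sum_r (V r)^h *m V r = 1%:M ->
  \sum_r (W r)^h *m W r = 1%:M ->
  \sum_r (tens_kraus V W r)^h *m tens_kraus V W r = 1%:M.
Proof.
move=> V1 W1; under eq_bigr do rewrite /tens_kraus adjmx_tens tensmx_mul.
by rewrite (sum_tens (fun r => (V r)^h *m V r) (fun s => (W s)^h *m W s)) V1 W1 tens1mx1.
Qed.

Section PartialTrace.
Variables k n : nat.

Definition psel (b : 'I_n) : 'M[C]_(k, k * n) :=
  \matrix_(i, x) (mxtens_index (i, b) == x)%:R.

(** The partial trace over the second factor, written in Kraus form so that positivity, trace
    preservation and data processing apply to it directly. *)
Definition ptr (X : 'M[C]_(k * n)) : 'M[C]_k := kraus psel X.

Lemma psel1 : \sum_b (psel b)^h *m psel b = 1%:M.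
Proof.
apply/matrixP => x y; rewrite summxE; case: (mxtens_indexP x) => i b.
rewrite (bigD1 b)//= big1 => [|c cb].
  rewrite addr0 mxE (bigD1 i)//= big1 => [|j ji].
    by rewrite adjmxE !mxE eqxx conj_natb mul1r addr0.
  by rewrite adjmxE !mxE (can_eq (@mxtens_indexK _ _)) xpair_eqE (negbTE ji) conjc0 mul0r.
rewrite mxE big1// => j _.
by rewrite adjmxE !mxE (can_eq (@mxtens_indexK _ _)) xpair_eqE (negbTE cb) andbF conjc0 mul0r.
Qed.

Lemma mul_psel m b (X : 'M[C]_(k * n, m)) i j : (psel b *m X) i j = X (mxtens_index (i, b)) j.
Proof.
rewrite mxE (bigD1 (mxtens_index (i, b)))//= big1 => [|x xi].
  by rewrite mxE eqxx mul1r addr0.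
by rewrite mxE eq_sym (negbTE xi) mul0r.
Qed.

Lemma psel_tens b (A : 'M[C]_k) : psel b *m (A *t 1%:M) = A *m psel b.
Proof.
apply/matrixP => i x; rewrite mul_psel; case: (mxtens_indexP x) => j c.
rewrite tensmxE !mxE (bigD1 j)//= big1 => [|l lj].
  by rewrite mxE (can_eq (@mxtens_indexK _ _)) xpair_eqE eqxx addr0.
by rewrite mxE (can_eq (@mxtens_indexK _ _)) xpair_eqE (negbTE lj) mulr0.
Qed.

Lemma ptrE X i j : ptr X i j = \sum_b X (mxtens_index (i, b)) (mxtens_index (j, b)).
Proof.
rewrite /ptr summxE; apply: eq_bigr => b _; rewrite -mulmxA mul_psel.
by rewrite -[X *m _]adjmxK adjmxM adjmxK adjmxE mul_psel adjmxE conjcK.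
Qed.

Lemma ptr_tens (A : 'M[C]_k) (B : 'M[C]_n) : ptr (A *t B) = \tr B *: A.
Proof.
apply/matrixP => i j; rewrite ptrE mxE mulr_suml; apply: eq_bigr => b _.
by rewrite tensmxE mulrC.
Qed.

Lemma ptr_conj (A B : 'M[C]_k) X : ptr ((A *t 1%:M) *m X *m (B *t 1%:M)) = A *m ptr X *m B.
Proof.
rewrite /ptr /kraus mulmx_sumr mulmx_suml; apply: eq_bigr => b _.
rewrite !mulmxA psel_tens -!mulmxA; do 3![congr (_ *m _)].
by apply: (can_inj (@adjmxK _ _ _)); rewrite !adjmxM adjmxK adjmx_tens adjmx1 psel_tens.
Qed.

Lemma rtrace_ptrM X (A : 'M[C]_k) : rtrace (A *m ptr X) = rtrace ((A *t 1%:M) *m X).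
Proof.
rewrite rtrace_krausM; congr (rtrace (_ *m X)).
under eq_bigr do rewrite -mulmxA -psel_tens mulmxA.
by rewrite -mulmx_suml psel1 mul1mx.
Qed.

Lemma psd_ptr X : psd X -> psd (ptr X).
Proof. exact: psd_kraus. Qed.

Lemma rtrace_ptr X : rtrace (ptr X) = rtrace X.
Proof. by apply: rtrace_kraus; exact: psel1. Qed.
End PartialTrace.

(** A matrix Cauchy-Schwarz inequality: summing the positive terms [(A b - A c) X (A b - A c)^h]
    over all pairs gives twice the difference of the two sides. *)
Lemma lep_sum_conj e m n (A : 'I_e -> 'M[C]_(n, m)) (X : 'M[C]_m) : psd X ->
  lep ((\sum_b A b) *m X *m (\sum_b A b)^h) (rC e%:R *: \sum_b A b *m X *m (A b)^h).
Proof.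
move=> pX; set S := \sum_b A b; set T := \sum_b _.
have E : \sum_b \sum_c (A b - A c) *m X *m (A b - A c)^h
   = rC 2 *: (rC e%:R *: T - S *m X *m S^h).
  have inner b : \sum_c (A b - A c) *m X *m (A b - A c)^h
     = (A b *m X *m (A b)^h *+ e - S *m X *m (A b)^h) - (A b *m X *m S^h - T).
    under eq_bigr do rewrite adjmxB mulmxBl !mulmxBr !mulmxBl.
    by rewrite 3!sumrB sumr_const card_ord -mulmx_sumr -!mulmx_suml -adjmx_sum.
  under eq_bigr do rewrite inner.
  rewrite !sumrB sumrMnl sumr_const card_ord -mulmx_sumr -!mulmx_suml -adjmx_sum -/S -/T.
  by rewrite !rmorph_nat !scaler_nat mulr2n opprB.
have : psd (rC 2 *: (rC e%:R *: T - S *m X *m S^h)).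
  by rewrite -E; apply: psd_sum => b _; apply: psd_sum => c _; exact: psd_conj.
move=> /(@psdZ _ _ 2^-1 _); rewrite rCZ mulVf ?rC1 ?scale1r ?pnatr_eq0//.
by apply; rewrite invr_ge0.
Qed.

Lemma ptr_twirl k n (X : 'M[C]_(k * n)) :
  \sum_b \sum_c (1%:M *t delta_mx b c) *m X *m (1%:M *t delta_mx b c)^h
  = ptr X *t (1%:M : 'M[C]_n).
Proof.
move: X; apply: lin_tens_ext.
- move=> a X Y; rewrite scaler_sumr -big_split; apply: eq_bigr => b _ /=.
  rewrite scaler_sumr -big_split; apply: eq_bigr => c _ /=.
  by rewrite mulmxDr mulmxDl -scalemxAr -scalemxAl.
- by move=> a X Y; rewrite /ptr krausD krausZ tensmxDl tensmxZl.
move=> A B; rewrite ptr_tens tensmxZl -tensmxZr scale_scalar_mx mulr1.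
under eq_bigr => b _.
  under eq_bigr => c _.
    rewrite adjmx_tens adjmx1 !tensmx_mul mul1mx mulmx1; over.
  rewrite -tensmx_sumr; over.
rewrite -tensmx_sumr; congr (_ *t _); apply/matrixP => i j.
rewrite summxE !mxE -mulr_natr.
have ent b c : (delta_mx b c *m B *m (delta_mx b c)^h) i j = ((b == i) && (b == j))%:R * B c c.
  rewrite mxE (bigD1 c)//= big1 => [|l lc].
    rewrite adjmxE mxE (bigD1 c)//= big1 => [|l lc].
      rewrite !mxE !eqxx !andbT addr0 conj_natb (eq_sym i) (eq_sym j).
      by case: eqP; case: eqP; rewrite ?(mul0r, mul1r, mulr0, mulr1, addr0).
    by rewrite !mxE (negbTE lc) andbF mul0r.
  by rewrite adjmxE !mxE (negbTE lc) andbF conjc0 mulr0.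
under eq_bigr => b _.
  rewrite summxE; under eq_bigr do rewrite ent.
  rewrite -mulr_sumr; over.
rewrite -mulr_suml mulrC; congr (_ * _).
rewrite (bigD1 i)//= eqxx big1 ?addr0// => b bi.
by rewrite (negbTE bi).
Qed.

(** Decompose the identity into the [n] diagonal units of the second factor; [lep_sum_conj] costs
    the factor [n]. Adding the off-diagonal units only increases the sum, and the full sum is
    [ptr X *t 1] by [ptr_twirl]. *)
Lemma lep_ptr k n (X : 'M[C]_(k * n)) : psd X ->
  lep X (rC n%:R *: (ptr X *t (1%:M : 'M[C]_n))).
Proof.
move=> pX; have := lep_sum_conj (fun b : 'I_n => 1%:M *t delta_mx b b) pX.
have -> : \sum_(b < n) (1%:M : 'M[C]_k) *t delta_mx b b = 1%:M.
  rewrite -tensmx_sumr -tens1mx1; congr (_ *t _).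
  rewrite [RHS]matrix_sum_delta; apply: eq_bigr => b _.
  rewrite (bigD1 b)//= big1 => [|c cb]; first by rewrite mxE eqxx scale1r addr0.
  by rewrite mxE eq_sym (negbTE cb) scale0r.
rewrite mul1mx adjmx1 mulmx1 => /lep_trans; apply.
apply: lepZ => //.
rewrite -ptr_twirl /lep -sumrB; apply: psd_sum => b _.
rewrite (bigD1 b)//= addrAC subrr add0r.
by apply: psd_sum => c _; exact: psd_conj.
Qed.

End Tensor.

(** * Kraus representations and reindexing *)

Section Channels.
Variable R : realType.
Local Notation C := R[i].

(** The unnormalised maximally entangled operator; the image of it under [idtens N] is the Choi
    matrix of [N]. *)
Definition maxent m : 'M[C]_(m * m) := \sum_i \sum_j delta_mx i j *t delta_mx i j.

Lemma maxentE m (i j k l : 'I_m) :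
  maxent m (mxtens_index (i, k)) (mxtens_index (j, l)) = ((i == k) && (j == l))%:R.
Proof.
rewrite /maxent summxE (eq_bigr (fun i' => ((i == i') && (k == i') && (j == l))%:R)).
  rewrite (bigD1 i)//= eqxx /= big1 ?addr0 => [|i' ii]; first by rewrite eq_sym.
  by rewrite eq_sym (negbTE ii).
move=> i' _; rewrite summxE (eq_bigr (fun j' => ((i == i') && (k == i') && (j == j') && (l == j'))%:R)).
  rewrite (bigD1 j)//= eqxx /= big1 ?addr0 => [|j' jj]; first by rewrite ?andbT (eq_sym l).
  by rewrite (eq_sym j) (negbTE jj) andbF.
move=> j' _; rewrite tensmxE !mxE.
by case: (i == i'); case: (k == i'); case: (j == j'); case: (l == j');
  rewrite /= ?(mul0r, mulr0, mulr1).
Qed.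

Lemma psd_maxent m : psd (maxent m).
Proof.
pose u : 'cV[C]_(m * m) := \col_x ((mxtens_unindex x).1 == (mxtens_unindex x).2)%:R.
suff -> : maxent m = u *m u^h by exact: psd_gram.
apply/matrixP => x y; case: (mxtens_indexP x) => i k; case: (mxtens_indexP y) => j l.
rewrite maxentE mxE big_ord1 adjmxE !mxE !mxtens_indexK /= conj_natb.
by do 2!case: eqP => _; rewrite ?(mul0r, mulr0, mulr1).
Qed.

Lemma idtens_maxent m n (N : 'M[C]_m -> 'M[C]_n) : lin_map N ->
  idtens N (maxent m) = \sum_i \sum_j delta_mx i j *t N (delta_mx i j).
Proof.
move=> lN; rewrite /maxent (lin_map_sum (idtens_lin _)); apply: eq_bigr => i _.
rewrite (lin_map_sum (idtens_lin _)); apply: eq_bigr => j _.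
by rewrite idtens_tens.
Qed.

Lemma idtens_maxentE m n (N : 'M[C]_m -> 'M[C]_n) i j a b : lin_map N ->
  idtens N (maxent m) (mxtens_index (i, a)) (mxtens_index (j, b)) = N (delta_mx i j) a b.
Proof.
move=> lN; rewrite idtens_maxent// summxE (bigD1 i)//= [X in _ + X]big1 => [|i' ii].
  rewrite addr0 summxE (bigD1 j)//= [X in _ + X]big1 => [|j' jj].
    by rewrite addr0 tensmxE mxE !eqxx mul1r.
  by rewrite tensmxE mxE (eq_sym j) (negbTE jj) andbF mul0r.
rewrite summxE big1// => j' _.
by rewrite tensmxE mxE eq_sym (negbTE ii) mul0r.
Qed.

(** Factor the Choi matrix as [L *m L^h]. Each column of [L], reshaped to an [n] by [m] matrix, is
    one Kraus operator. *)
Lemma choi_kraus m n (N : 'M[C]_m -> 'M[C]_n) : lin_map N ->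
  psd (idtens N (maxent m)) ->
  exists e, exists V : 'I_e -> 'M[C]_(n, m), forall X, N X = kraus V X.
Proof.
move=> lN /psd_sqrt[L LE].
pose V r : 'M[C]_(n, m) := \matrix_(a, i) L (mxtens_index (i, a)) r.
exists (m * n)%N, V => X; rewrite (lin_mx_sum lN) [RHS](lin_mx_sum (kraus_lin V)).
apply: eq_bigr => i _; apply: eq_bigr => j _; congr (_ *: _).
apply/matrixP => a b; rewrite -(idtens_maxentE _ _ _ _ lN) -LE mxE /kraus summxE.
apply: eq_bigr => r _.
rewrite adjmxE mxE (bigD1 j)//= big1 => [|j' jj].
  rewrite adjmxE addr0 mxE (bigD1 i)//= big1 => [|i' ii].
    by rewrite !mxE !eqxx addr0 mulr1.
  by rewrite !mxE (negbTE ii) mulr0.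
rewrite mxE big1 ?mul0r// => i' _.
by rewrite !mxE (negbTE jj) andbF mulr0.
Qed.

Lemma channel_kraus m n (N : 'M[C]_m -> 'M[C]_n) : is_channel N ->
  exists e, exists V : 'I_e -> 'M[C]_(n, m),
    (forall X, N X = kraus V X) /\ \sum_r (V r)^h *m V r = 1%:M.
Proof.
move=> [lN cpN tpN]; have [e [V NV]] := choi_kraus lN (cpN _ _ (psd_maxent m)).
exists e, V; split=> //; apply/matrixP => i j.
have : \tr ((\sum_r (V r)^h *m V r) *m delta_mx j i) = \tr (delta_mx j i : 'M[C]_m).
  rewrite -tpN NV mulmx_suml !raddf_sum; apply: eq_bigr => r _ /=.
  by rewrite [RHS]mxtrace_mulC mulmxA.
have trd (W : 'M[C]_m) : \tr (W *m delta_mx j i) = W i j.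
  rewrite /mxtrace (bigD1 i)//= [X in _ + X]big1 => [|l li].
    rewrite addr0 mxE (bigD1 j)//= big1 => [|l lj]; first by rewrite mxE !eqxx mulr1 addr0.
    by rewrite mxE (negbTE lj) mulr0.
  by rewrite mxE big1// => l' _; rewrite mxE (negbTE li) andbF mulr0.
by rewrite trd -{1}(mul1mx (delta_mx j i)) trd.
Qed.

Lemma kraus_channel e m n (V : 'I_e -> 'M[C]_(n, m)) : \sum_r (V r)^h *m V r = 1%:M ->
  is_channel (kraus V).
Proof.
move=> V1; split; first exact: kraus_lin; last by move=> X; exact: tr_kraus.
by move=> k X pX; rewrite idtens_kraus; exact: psd_kraus.
Qed.

Lemma ptr_idtens k m n (N : 'M[C]_m -> 'M[C]_n) : lin_map N ->
  (forall X, \tr (N X) = \tr X) -> forall X : 'M[C]_(k * m), ptr (idtens N X) = ptr X.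
Proof.
move=> lN tN; apply: lin_tens_ext.
- by apply: lin_map_comp; [exact: kraus_lin|exact: idtens_lin].
- exact: kraus_lin.
by move=> A B; rewrite idtens_tens// !ptr_tens tN.
Qed.

Lemma idtens_replacer k m n (w : 'M[C]_n) (X : 'M[C]_(k * m)) :
  idtens (replacer w) X = ptr X *t w.
Proof.
apply: (@tensmap_unique _ _ _ _ _ (fun Y => Y) (replacer w) (fun Y => ptr Y *t w)).
  by move=> c Y Z; rewrite /ptr krausD krausZ tensmxDl tensmxZl.
by move=> A B; rewrite ptr_tens tensmxZl -tensmxZr.
Qed.

Section Reindex.
Variables (p q : nat) (f : 'I_p -> 'I_q) (g : 'I_q -> 'I_p).
Hypotheses (fK : cancel f g) (gK : cancel g f).

(** Relabelling of the basis. By [reix_kraus] it is conjugation by a permutation matrix when [h] is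
    bijective, so data processing applies in both directions. *)
Definition reix (h : 'I_p -> 'I_q) (X : 'M[C]_q) : 'M[C]_p := \matrix_(i, j) X (h i) (h j).

Definition reix_mx : 'M[C]_(p, q) := \matrix_(i, x) (f i == x)%:R.

Lemma mul_reix_mx r (X : 'M[C]_(q, r)) i j : (reix_mx *m X) i j = X (f i) j.
Proof.
rewrite mxE (bigD1 (f i))//= big1 => [|x xi]; first by rewrite mxE eqxx mul1r addr0.
by rewrite mxE eq_sym (negbTE xi) mul0r.
Qed.

Lemma reix_kraus X : reix f X = kraus (fun _ : 'I_1 => reix_mx) X.
Proof.
apply/matrixP => i j; rewrite /kraus big_ord1 -mulmxA mul_reix_mx mxE.
by rewrite -[X *m _]adjmxK adjmxM adjmxK adjmxE mul_reix_mx adjmxE conjcK.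
Qed.

Lemma reix1 : \sum_(r < 1) reix_mx^h *m reix_mx = 1%:M.
Proof.
rewrite big_ord1; apply/matrixP => x y; rewrite !mxE (bigD1 (g x))//= big1 => [|i ix].
  by rewrite adjmxE !mxE gK eqxx conjc1 mul1r addr0.
rewrite adjmxE !mxE; have [fx|_] := eqVneq (f i) x.
  by rewrite -fx fK eqxx in ix.
by rewrite conjc0 mul0r.
Qed.
End Reindex.

Lemma reixK p q (f : 'I_p -> 'I_q) g X : cancel f g -> reix f (reix g X) = X.
Proof. by move=> fK; apply/matrixP => i j; rewrite !mxE !fK. Qed.

Lemma reix_lin p q (f : 'I_p -> 'I_q) : lin_map (reix f).
Proof. by move=> c X Y; apply/matrixP => i j; rewrite !mxE. Qed.

Section Assoc.
Variables k e m : nat.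

(** Indices of [k * (e * m)] and [k * e * m] have different types, so associativity of the tensor
    product has to be an explicit bijection. *)
Definition assoc_ix (x : 'I_(k * (e * m))) : 'I_(k * e * m) :=
  let: (i, y) := mxtens_unindex x in let: (j, l) := mxtens_unindex y in
  mxtens_index (mxtens_index (i, j), l).

Definition assoc_inv (x : 'I_(k * e * m)) : 'I_(k * (e * m)) :=
  let: (y, l) := mxtens_unindex x in let: (i, j) := mxtens_unindex y in
  mxtens_index (i, mxtens_index (j, l)).

Lemma assoc_ixE i j l :
  assoc_ix (mxtens_index (i, mxtens_index (j, l))) = mxtens_index (mxtens_index (i, j), l).
Proof. by rewrite /assoc_ix !mxtens_indexK. Qed.

Lemma assoc_invE i j l :
  assoc_inv (mxtens_index (mxtens_index (i, j), l)) = mxtens_index (i, mxtens_index (j, l)).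
Proof. by rewrite /assoc_inv !mxtens_indexK. Qed.

Lemma assoc_ixK : cancel assoc_ix assoc_inv.
Proof.
move=> x; case: (mxtens_indexP x) => i y; case: (mxtens_indexP y) => j l.
by rewrite assoc_ixE assoc_invE.
Qed.

Lemma assoc_invK : cancel assoc_inv assoc_ix.
Proof.
move=> x; case: (mxtens_indexP x) => y l; case: (mxtens_indexP y) => i j.
by rewrite assoc_invE assoc_ixE.
Qed.

Lemma reix_assoc (A : 'M[C]_k) (B : 'M[C]_e) (D : 'M[C]_m) :
  reix assoc_ix (A *t B *t D) = A *t (B *t D).
Proof.
apply/matrixP => x y.
case: (mxtens_indexP x) => i x'; case: (mxtens_indexP x') => j l.
case: (mxtens_indexP y) => i' y'; case: (mxtens_indexP y') => j' l'.
by rewrite mxE !assoc_ixE !tensmxE mulrA.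
Qed.

Lemma reix_assoc_inv (A : 'M[C]_k) (B : 'M[C]_e) (D : 'M[C]_m) :
  reix assoc_inv (A *t (B *t D)) = A *t B *t D.
Proof. by rewrite -reix_assoc (reixK _ assoc_invK). Qed.
End Assoc.

Lemma lin_tens3_ext k e m n (F G : 'M[C]_(k * (e * m)) -> 'M[C]_n) :
  lin_map F -> lin_map G -> (forall A B D, F (A *t (B *t D)) = G (A *t (B *t D))) ->
  forall X, F X = G X.
Proof.
move=> lF lG FG; apply: lin_tens_ext => // A; apply: lin_tens_ext => //.
- by move=> c X Y; rewrite tensmxDr tensmxZr lF.
- by move=> c X Y; rewrite tensmxDr tensmxZr lG.
Qed.

Lemma idtens_idtens k e m n (N : 'M[C]_m -> 'M[C]_n) : lin_map N ->
  forall X : 'M[C]_(k * (e * m)),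
  idtens (@idtens _ e _ _ N) X =
    reix (@assoc_ix k e n) (@idtens _ (k * e) _ _ N (reix (@assoc_inv k e m) X)).
Proof.
move=> lN; apply: lin_tens3_ext.
- exact: idtens_lin.
- apply: lin_map_comp; first exact: reix_lin.
  by apply: lin_map_comp; [exact: idtens_lin|exact: reix_lin].
move=> A B D; rewrite (idtens_tens _ _ (idtens_lin _)) (idtens_tens _ _ lN).
by rewrite reix_assoc_inv (idtens_tens _ _ lN) reix_assoc.
Qed.

Section Swap.
Variables k1 m1 k2 m2 : nat.

(** Exchanges the two middle factors: it groups references with references and systems with
    systems. *)
Definition swap_ix (x : 'I_(k1 * k2 * (m1 * m2))) : 'I_(k1 * m1 * (k2 * m2)) :=
  let: (u, v) := mxtens_unindex x in
  let: (i1, i2) := mxtens_unindex u in let: (j1, j2) := mxtens_unindex v in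
  mxtens_index (mxtens_index (i1, j1), mxtens_index (i2, j2)).

Lemma swap_ixE i1 i2 j1 j2 :
  swap_ix (mxtens_index (mxtens_index (i1, i2), mxtens_index (j1, j2)))
  = mxtens_index (mxtens_index (i1, j1), mxtens_index (i2, j2)).
Proof. by rewrite /swap_ix !mxtens_indexK. Qed.

Lemma reix_swap (A1 : 'M[C]_k1) (B1 : 'M[C]_m1) (A2 : 'M[C]_k2) (B2 : 'M[C]_m2) :
  reix swap_ix ((A1 *t B1) *t (A2 *t B2)) = (A1 *t A2) *t (B1 *t B2).
Proof.
apply/matrixP => x y.
case: (mxtens_indexP x) => u v; case: (mxtens_indexP u) => i1 i2; case: (mxtens_indexP v) => j1 j2.
case: (mxtens_indexP y) => u' v'; case: (mxtens_indexP u') => i1' i2'; case: (mxtens_indexP v') => j1' j2'.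
rewrite mxE !swap_ixE !tensmxE.
by rewrite mulrACA.
Qed.
End Swap.

Lemma swap_ixK k1 m1 k2 m2 : cancel (@swap_ix k1 m1 k2 m2) (@swap_ix k1 k2 m1 m2).
Proof.
move=> x; case: (mxtens_indexP x) => u v; case: (mxtens_indexP u) => i1 i2.
by case: (mxtens_indexP v) => j1 j2; rewrite !swap_ixE.
Qed.

Lemma idtens_tensmap_swap k1 m1 n1 k2 m2 n2 (N : 'M[C]_m1 -> 'M[C]_n1)
  (M : 'M[C]_m2 -> 'M[C]_n2) : lin_map N -> lin_map M ->
  forall (X1 : 'M[C]_(k1 * m1)) (X2 : 'M[C]_(k2 * m2)),
  idtens (tensmap N M) (reix (@swap_ix k1 m1 k2 m2) (X1 *t X2))
  = reix (@swap_ix k1 n1 k2 n2) (idtens N X1 *t idtens M X2).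
Proof.
move=> lN lM X1 X2; move: X1; apply: lin_tens_ext.
- move=> c X Y; rewrite tensmxDl tensmxZl; rewrite (reix_lin _ c) (idtens_lin _ c) //.
- by move=> c X Y; rewrite (idtens_lin _ c) tensmxDl tensmxZl (reix_lin _ c).
move=> A1 B1; move: X2; apply: lin_tens_ext.
- by move=> c X Y; rewrite tensmxDr tensmxZr (reix_lin _ c) (idtens_lin _ c).
- by move=> c X Y; rewrite (idtens_lin _ c) tensmxDr tensmxZr (reix_lin _ c).
move=> A2 B2; rewrite reix_swap (idtens_tens _ _ (tensmap_lin N M)) tensmap_tens//.
by rewrite !idtens_tens// reix_swap.
Qed.

End Channels.

(** * Tensor products of states *)

Section States.
Variable R : realType.
Local Notation C := R[i].

Lemma fc_tens2 m n (A : 'M[C]_m) (B : 'M[C]_n) (f1 g1 f2 g2 h : R -> R) :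
  psd A -> psd B ->
  (forall x y, 0 <= x -> 0 <= y -> h (x * y) = f1 x * g1 y + f2 x * g2 y) ->
  fc h (A *t B) = fc f1 A *t fc g1 B + fc f2 A *t fc g2 B.
Proof.
move=> /psd_spec[U [a [Aa a0]]] /psd_spec[V [b [Bb b0]]] E.
rewrite (fcE h (specd_tens Aa Bb)).
have [_ /= ->] := fcalc_specd f1 Aa; have [_ /= ->] := fcalc_specd f2 Aa.
have [_ /= ->] := fcalc_specd g1 Bb; have [_ /= ->] := fcalc_specd g2 Bb.
rewrite adjmx_tens -!tensmx_mul !diag_tens -mulmxDl -mulmxDr -raddfD.
congr (_ *m diag_mx _ *m _).
apply/rowP => x; case: (mxtens_indexP x) => i j.
by rewrite !mxE mxtens_indexK E// rmorphD.
Qed.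

(** With [ln 0 = 0] the rule [ln (xy) = ln x + ln y] fails when one factor is 0; the support
    projections remove the stray term. *)
Lemma fc_ln_tens m n (A : 'M[C]_m) (B : 'M[C]_n) : psd A -> psd B ->
  fc (@ln R) (A *t B) = fc (@ln R) A *t supp B + supp A *t fc (@ln R) B.
Proof.
move=> pA pB; rewrite !suppE; apply: fc_tens2 => // x y.
rewrite le_eqVlt => /predU1P[<-|x0]; first by rewrite eqxx !mul0r ln0// mul0r addr0.
rewrite le_eqVlt => /predU1P[<-|y0]; first by rewrite eqxx !mulr0 ln0// mulr0 addr0.
by rewrite lnM ?posrE// !gt_eqF// mulr1 mul1r.
Qed.

Lemma fc_xlnx_tens m n (A : 'M[C]_m) (B : 'M[C]_n) : psd A -> psd B ->
  fc (fun x => x * ln x) (A *t B)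
  = fc (fun x => x * ln x) A *t B + A *t fc (fun x => x * ln x) B.
Proof.
move=> pA pB; rewrite -[X in _ *t X + _](@fcalc_id _ _ id _ pB.1)//.
rewrite -[X in _ + X *t _](@fcalc_id _ _ id _ pA.1)//.
apply: fc_tens2 => // x y.
rewrite le_eqVlt => /predU1P[<-|x0]; first by rewrite !mul0r addr0.
rewrite le_eqVlt => /predU1P[<-|y0]; first by rewrite !(mulr0, mul0r) addr0.
by rewrite lnM ?posrE//=; ring.
Qed.

(** Real parts multiply only for real traces. Writing [A = S S^h] turns [tr A B] into the trace of
    the Hermitian matrix [S^h B S]. *)
Lemma rtraceM_real m n (A B : 'M[C]_m) (A' B' : 'M[C]_n) : psd A -> hermitian B ->
  psd A' -> hermitian B' ->
  rtrace ((A *t A') *m (B *t B')) = rtrace (A *m B) * rtrace (A' *m B').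
Proof.
move=> /psd_sqrt[S <-] hB /psd_sqrt[T <-] hB'.
have conj_tr k (Y Z : 'M[C]_k) : \tr (Y *m Y^h *m Z) = \tr (Y^h *m Z *m Y).
  by rewrite -mulmxA mxtrace_mulC.
rewrite tensmx_mul /rtrace mxtrace_tens !conj_tr.
have hc k (Y Z : 'M[C]_k) : hermitian Z -> hermitian (Y^h *m Z *m Y).
  by move=> hZ; rewrite /hermitian !adjmxM adjmxK hZ mulmxA.
by rewrite (herm_tr (hc _ S _ hB)) (herm_tr (hc _ T _ hB')) -rmorphM.
Qed.

Lemma relr_tens m n (r1 s1 : 'M[C]_m) (r2 s2 : 'M[C]_n) :
  psd r1 -> psd s1 -> psd r2 -> psd s2 -> (r1 <= s1)%MS -> (r2 <= s2)%MS ->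
  rtrace r1 = 1 -> rtrace r2 = 1 ->
  relr (r1 *t r2) (s1 *t s2) = relr r1 s1 + relr r2 s2.
Proof.
move=> p1 q1 p2 q2 rs1 rs2 t1 t2; rewrite /relr (fc_xlnx_tens p1 p2) (fc_ln_tens q1 q2).
have h1 := fcalc_herm (fun x => x * ln x) p1.1.
have h2 := fcalc_herm (fun x => x * ln x) p2.1.
rewrite mulmxDr !rtraceD (rtrace_tens h1 p2.1) (rtrace_tens p1.1 h2).
rewrite (rtraceM_real p1 (fcalc_herm _ q1.1) p2 (supp_herm q2.1)).
rewrite (rtraceM_real p1 (supp_herm q1.1) p2 (fcalc_herm _ q2.1)).
rewrite (submx_supp q1.1 rs1) (submx_supp q2.1 rs2) t1 t2; ring.
Qed.

Lemma qal_tens m n al (r1 s1 : 'M[C]_m) (r2 s2 : 'M[C]_n) :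
  psd r1 -> psd s1 -> psd r2 -> psd s2 ->
  qal al (r1 *t r2) (s1 *t s2) = qal al r1 s1 * qal al r2 s2.
Proof.
move=> p1 q1 p2 q2; rewrite /qal.
have -> : sandw al (r1 *t r2) (s1 *t s2) = sandw al r1 s1 *t sandw al r2 s2.
  by rewrite /sandw (mp_tens _ q1 q2) !tensmx_mul.
have pS1 := psd_sandw al p1 q1; have pS2 := psd_sandw al p2 q2.
rewrite (mp_tens _ pS1 pS2) rtrace_tens//; exact: mpow_herm.
Qed.

(** Faithful states. The lower bound [l] on the spectrum enters the constants of [idtens_dom] and
    [choi_lep]. *)
Definition fstate n (g : 'M[C]_n) : Prop :=
  [/\ psd g, rtrace g = 1 & exists2 l, 0 < l & lep (rC l *: 1%:M) g].

Lemma lep_scaleV n l (A B : 'M[C]_n) : 0 < l -> lep (rC l *: A) B -> lep A (rC l^-1 *: B).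
Proof.
move=> l0 AB; have l1 : 0 <= l^-1 by rewrite invr_ge0 ltW.
have lV : l^-1 * l = 1 by rewrite mulVf ?gt_eqF.
have h := lepZ l1 AB; rewrite rCZ lV rC1 scale1r in h.
exact: h.
Qed.

Lemma lep_scalar n c (A : 'M[C]_n) U d : specd A U d -> (forall i, d 0 i <= c) ->
  lep A (rC c *: 1%:M).
Proof.
move=> Ad dc; have hA := specd_herm Ad.
have E : rC c *: 1%:M - A = fc (fun x => c - x) A.
  rewrite -(fcalcD (fun=> c) (fun x => - x) hA) (@fcalc_cst _ _ c _ _ hA)//.
  rewrite scalemx1; congr (_ + _); rewrite -{1}(@fcalc_id _ _ id _ hA)//.
  rewrite -scaleN1r -(rmorphN1 (@rC R)) fcalcZ//.
  by apply: (specd_ext Ad) => i; rewrite mulN1r.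
rewrite /lep E; apply: (specd_psd (fcalc_specd _ Ad)) => i.
by rewrite mxE subr_ge0.
Qed.

Lemma lep_trace n (A : 'M[C]_n) : psd A -> lep A (rC (rtrace A) *: 1%:M).
Proof.
move=> pA; have [U [d [Ad d0]]] := psd_spec pA; apply: (lep_scalar Ad) => i.
rewrite -(@fcalc_id _ _ id _ pA.1)// (rtrace_fcalc _ Ad) (bigD1 i)//= lerDl.
by apply: sumr_ge0.
Qed.

Lemma fstate_sub1 n (g : 'M[C]_n) : fstate g -> (1%:M <= g)%MS.
Proof.
by move=> [pg _ [l l0 lg]]; exact: (lep_submx (psd1 _ _) pg (lep_scaleV l0 lg)).
Qed.

Lemma fstate_supp n (g : 'M[C]_n) : fstate g -> supp g = 1%:M.
Proof.
move=> fg; have [[hg _] _ _] := fg.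
by have := submx_supp hg (fstate_sub1 fg); rewrite mul1mx.
Qed.

Lemma lep_tensr m n (A : 'M[C]_m) (B B' : 'M[C]_n) : psd A -> lep B B' ->
  lep (A *t B) (A *t B').
Proof.
move=> pA BB; have := psd_tens pA BB.
by rewrite /lep -scaleN1r tensmxDr tensmxZr scaleN1r.
Qed.

Lemma lep_tensl m n (A A' : 'M[C]_m) (B : 'M[C]_n) : psd B -> lep A A' ->
  lep (A *t B) (A' *t B).
Proof. by move=> pB AA; have := psd_tens AA pB; rewrite /lep tensmxBl. Qed.

Lemma submx_tens1 k n (A B : 'M[C]_k) : (A <= B)%MS ->
  (A *t (1%:M : 'M[C]_n) <= B *t (1%:M : 'M[C]_n))%MS.
Proof.
move=> /submxP[D ->]; apply/submxP; exists (D *t 1%:M).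
by rewrite tensmx_mul mulmx1.
Qed.

Lemma submx_ptr k n (X : 'M[C]_(k * n)) : psd X -> (X <= ptr X *t (1%:M : 'M[C]_n))%MS.
Proof.
move=> pX; apply: (lep_submx pX _ (lep_ptr pX)).
by apply: psd_tens; [exact: psd_ptr|exact: psd1].
Qed.

Lemma mul_supp_tens k n (X : 'M[C]_(k * n)) (t : 'M[C]_k) : psd X -> psd t ->
  (ptr X <= t)%MS -> X *m (supp t *t (1%:M : 'M[C]_n)) = X.
Proof.
move=> pX pt Xt.
have /submxP[D ->] := submx_trans (submx_ptr pX) (submx_tens1 n Xt).
by rewrite -mulmxA tensmx_mul mulmx1 (mul_supp pt.1).
Qed.

(** The logarithm of [t *t g] splits, and against [w] the support of [t] acts as the identity. Only
    the middle term involves [t], and only through the marginal of [w]; the chain rule [relr_chain]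
    compares two choices of [t]. *)
Lemma relr_marginal k n (w : 'M[C]_(k * n)) (t : 'M[C]_k) (g : 'M[C]_n) :
  psd w -> psd t -> fstate g -> (ptr w <= t)%MS ->
  relr w (t *t g) = rtrace (fc (fun x => x * ln x) w)
    - rtrace (ptr w *m fc (@ln R) t) - rtrace (w *m (1%:M *t fc (@ln R) g)).
Proof.
move=> pw pt fg wt; have [pg _ _] := fg.
rewrite /relr (fc_ln_tens pt pg) mulmxDr rtraceD (fstate_supp fg).
have -> : w *m (supp t *t fc (@ln R) g) = w *m (1%:M *t fc (@ln R) g).
  by rewrite -[in RHS](mul_supp_tens pw pt wt) -mulmxA tensmx_mul mulmx1 mul1mx.
by rewrite [in X in _ - (X + _)]rtraceC -rtrace_ptrM rtraceC; ring.
Qed.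

Lemma relr_chain k n (w : 'M[C]_(k * n)) (t : 'M[C]_k) (g : 'M[C]_n) :
  psd w -> psd t -> fstate g -> (ptr w <= t)%MS ->
  relr w (t *t g) = relr w (ptr w *t g) + relr (ptr w) t.
Proof.
move=> pw pt fg wt; have pp := psd_ptr pw.
rewrite (relr_marginal pw pt fg wt) (relr_marginal pw pp fg (submx_refl _)) [relr (ptr w) t]/relr.
rewrite -{2}(@fcalc_id _ _ id _ pp.1)// (fcalcM _ _ pp.1) /=; ring.
Qed.

(** Support inclusion with a constant, a form that Kraus maps and tensor products visibly
    preserve. *)
Definition dom n (r s : 'M[C]_n) : Prop := exists2 c, 0 < c & lep r (rC c *: s).

Lemma dom_sub n (r s : 'M[C]_n) : psd r -> psd s -> dom r s -> (r <= s)%MS.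
Proof. by move=> pr ps [c _]; exact: lep_submx. Qed.

Lemma dom_kraus e m n (V : 'I_e -> 'M[C]_(n, m)) r s : dom r s -> dom (kraus V r) (kraus V s).
Proof. by move=> [c c0 rs]; exists c => //; rewrite -krausZ; exact: lep_kraus. Qed.

Lemma dom_refl n (r : 'M[C]_n) : dom r r.
Proof. by exists 1 => //; rewrite rmorph1 scale1r; exact: lep_refl. Qed.

Lemma dom_tens m n (r1 s1 : 'M[C]_m) (r2 s2 : 'M[C]_n) : psd r1 -> psd r2 -> psd s1 -> psd s2 ->
  dom r1 s1 -> dom r2 s2 -> dom (r1 *t r2) (s1 *t s2).
Proof.
move=> p1 p2 q1 q2 [c c0 rs1] [d d0 rs2]; exists (d * c); first exact: mulr_gt0.
have h1 := lep_tensl p2 rs1; have h2 := lep_tensr (psdZ (ltW c0) q1) rs2.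
by have := lep_trans h1 h2; rewrite tensmxZr tensmxZl rCZ.
Qed.

(** The output is at most [n] times its marginal tensored with 1, and [1 <= g/l]; the marginal is
    that of the input. [K] is independent of the reference, which makes channel divergences finite.
    It uses [n + 1] so as to be positive for every [n]. *)
Lemma idtens_dom n (g : 'M[C]_n) : fstate g -> exists2 K, 0 < K &
  forall k m (N : 'M[C]_m -> 'M[C]_n) (psi : 'M[C]_(k * m)), is_channel N -> psd psi ->
  lep (idtens N psi) (rC K *: idtens (replacer g) psi).
Proof.
move=> [pg _ [l l0 lg]]; exists (n.+1%:R / l); first by rewrite divr_gt0.
move=> k m N psi [lN cpN tpN] pp; have pX := cpN _ _ pp.
apply: lep_trans (lep_ptr pX) _; rewrite ptr_idtens// idtens_replacer.
have pt := psd_ptr pp.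
have pt1 : psd (ptr psi *t (1%:M : 'M[C]_n)) := psd_tens pt (psd1 _ _).
have h1 : lep (rC n%:R *: (ptr psi *t (1%:M : 'M[C]_n))) (rC n.+1%:R *: (ptr psi *t 1%:M)).
  have nE : n.+1%:R - n%:R = 1 :> R by rewrite -natrB ?leqnSn// subSnn.
  rewrite /lep -scalerBl -rCB nE.
  exact: psdZ ler01 pt1.
apply: lep_trans h1 _; rewrite -rCZ.
by apply: lepZ; rewrite -?tensmxZr; [exact: ler0n|exact: (lep_tensr pt (lep_scaleV l0 lg))].
Qed.

End States.

(** * Channel divergences *)

Section Divergence.
Variable R : realType.
Local Notation C := R[i].

Lemma channel_ext m n (N M : 'M[C]_m -> 'M[C]_n) : lin_map N -> lin_map M ->
  idtens N (maxent R m) = idtens M (maxent R m) -> N = M.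
Proof.
move=> lN lM E; apply/funext => X; rewrite (lin_mx_sum lN) [RHS](lin_mx_sum lM).
apply: eq_bigr => i _; apply: eq_bigr => j _; congr (_ *: _); apply/matrixP => a b.
by rewrite -(idtens_maxentE _ _ _ _ lN) -(idtens_maxentE _ _ _ _ lM) E.
Qed.

Lemma replacer_lin m n (w : 'M[C]_n) : lin_map (@replacer R m n w).
Proof. by move=> c X Y; rewrite /replacer mxtraceD mxtraceZ scalerDl scalerA. Qed.

Lemma replacer_channel m n (w : 'M[C]_n) : is_state w -> is_channel (@replacer R m n w).
Proof.
move=> [pw tw]; split; first exact: replacer_lin.
  move=> k X pX; rewrite idtens_replacer.
  exact: psd_tens (psd_ptr pX) pw.
by move=> X; rewrite /replacer mxtraceZ tw mulr1.
Qed.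

Lemma idtens_state k m n (N : 'M[C]_m -> 'M[C]_n) (psi : 'M[C]_(k * m)) :
  is_channel N -> is_state psi -> psd (idtens N psi) /\ rtrace (idtens N psi) = 1.
Proof.
move=> [lN cpN tpN] /is_stateE[pp tp]; split; first exact: cpN.
by rewrite -rtrace_ptr ptr_idtens// rtrace_ptr.
Qed.

Lemma fstate_state n (g : 'M[C]_n) : fstate g -> is_state g.
Proof. by move=> [pg tg _]; apply/is_stateE. Qed.

Lemma state_exists m : (0 < m)%N -> exists psi : 'M[C]_(1 * m), is_state psi.
Proof.
move=> m0; exists (rC (1 * m)%:R^-1 *: 1%:M); apply/is_stateE; split.
  by apply: psdZ; [rewrite invr_ge0 ler0n|exact: psd1].
rewrite rtraceZ /rtrace mxtrace1 -(rmorph_nat (@rC R)) /= mulVf//.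
by rewrite pnatr_eq0 mul1n -lt0n.
Qed.

Lemma rtrace_maxent_gt0 m : (0 < m)%N -> 0 < rtrace (maxent R m).
Proof.
move=> m0; rewrite lt_neqAle eq_sym rtrace_psd ?andbT; last exact: psd_maxent.
apply/eqP => /(psd_rtrace0 (psd_maxent R m))/matrixP.
pose i := Ordinal m0; move=> /(_ (mxtens_index (i, i)) (mxtens_index (i, i))).
by rewrite maxentE !eqxx mxE => /eqP; rewrite oner_eq0.
Qed.

Definition maxent_state m : 'M[C]_(m * m) := rC (rtrace (maxent R m))^-1 *: maxent R m.

Lemma maxent_is_state m : (0 < m)%N -> is_state (maxent_state m).
Proof.
move=> m0; have t0 := rtrace_maxent_gt0 m0; apply/is_stateE; split.
  by apply: psdZ; [rewrite invr_ge0 ltW|exact: psd_maxent].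
by rewrite rtraceZ mulVf ?gt_eqF.
Qed.

Lemma tensmap_channel m1 n1 m2 n2 (N : 'M[C]_m1 -> 'M[C]_n1) (M : 'M[C]_m2 -> 'M[C]_n2) :
  is_channel N -> is_channel M -> is_channel (tensmap N M).
Proof.
move=> /channel_kraus[e1 [V [NV V1]]] /channel_kraus[e2 [W [MW W1]]].
have -> : tensmap N M = kraus (tens_kraus V W).
  by apply/funext => X; rewrite -tensmap_kraus (funext NV) (funext MW).
exact/kraus_channel/tens_kraus1.
Qed.

Lemma tensmap_replacer m1 n1 m2 n2 (g1 : 'M[C]_n1) (g2 : 'M[C]_n2) :
  tensmap (@replacer R m1 n1 g1) (@replacer R m2 n2 g2) = replacer (g1 *t g2).
Proof.
apply/funext; apply: tensmap_unique; first exact: replacer_lin.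
by move=> A B; rewrite /replacer mxtrace_tens tensmxZl tensmxZr scalerA.
Qed.

Lemma fstate_tens n1 n2 (g1 : 'M[C]_n1) (g2 : 'M[C]_n2) : fstate g1 -> fstate g2 ->
  fstate (g1 *t g2).
Proof.
move=> [p1 t1 [l1 l10 lg1]] [p2 t2 [l2 l20 lg2]]; split.
- exact: psd_tens.
- by rewrite (rtrace_tens p1.1 p2.1) t1 t2 mulr1.
exists (l2 * l1); first exact: mulr_gt0.
have h1 := lep_tensl (psdZ (ltW l20) (psd1 R n2)) lg1; have h2 := lep_tensr p1 lg2.
by have := lep_trans h1 h2; rewrite {1}tensmxZr {1}tensmxZl rCZ tens1mx1.
Qed.

(* [Dr] is the real value of [Dv] on pairs with [r <= c s]; these are the
   only pairs that channel divergences from a full-rank replacer see. *)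
Record divergence (Dv : forall n, 'M[C]_n -> 'M[C]_n -> \bar R)
    (Dr : forall n, 'M[C]_n -> 'M[C]_n -> R) : Prop := Divergence {
  div_fin : forall n (r s : 'M[C]_n), psd r -> psd s -> dom r s ->
    Dv n r s = (Dr n r s)%:E;
  div_dpi : forall e m n (V : 'I_e -> 'M[C]_(n, m)) (r s : 'M[C]_m),
    \sum_i (V i)^h *m V i = 1%:M -> psd r -> psd s -> rtrace r = 1 -> rtrace s = 1 ->
    dom r s -> Dr n (kraus V r) (kraus V s) <= Dr m r s;
  div_bound : forall K : R, 0 < K -> exists B : R,
    forall n (r s : 'M[C]_n), psd r -> psd s -> rtrace r = 1 -> rtrace s = 1 ->
    lep r (rC K *: s) -> Dr n r s <= B;
  div_ge0 : forall n (r s : 'M[C]_n), psd r -> psd s -> rtrace r = 1 ->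
    rtrace s = 1 -> dom r s -> 0 <= Dr n r s;
  div_eq0 : forall n (r s : 'M[C]_n), psd r -> psd s -> rtrace r = 1 ->
    rtrace s = 1 -> dom r s -> Dr n r s = 0 -> r = s;
  div_self : forall n (r : 'M[C]_n), psd r -> rtrace r = 1 -> Dr n r r = 0;
  div_tens : forall m n (r1 s1 : 'M[C]_m) (r2 s2 : 'M[C]_n),
    psd r1 -> psd s1 -> psd r2 -> psd s2 -> rtrace r1 = 1 -> rtrace s1 = 1 ->
    rtrace r2 = 1 -> rtrace s2 = 1 -> dom r1 s1 -> dom r2 s2 ->
    Dr _ (r1 *t r2) (s1 *t s2) = Dr m r1 s1 + Dr n r2 s2;
  div_chain : forall k m n (M : 'M[C]_m -> 'M[C]_n) (g : 'M[C]_n) (xi : 'M[C]_(k * m))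
      (s : 'M[C]_k) B, is_channel M -> fstate g -> is_state xi ->
    psd s -> rtrace s = 1 -> dom (ptr xi) s ->
    (forall psi : 'M[C]_(k * m), is_state psi ->
      Dr _ (idtens M psi) (idtens (replacer g) psi) <= B) ->
    Dr _ (idtens M xi) (s *t g) <= Dr k (ptr xi) s + B;
  div_cont : forall eps : R, 0 < eps -> exists2 e : R, 0 < e &
    forall n (rN rM s : 'M[C]_n), psd rN -> psd rM -> psd s ->
    rtrace rN = 1 -> rtrace rM = 1 -> rtrace s = 1 -> dom rN s -> dom rM s ->
    lep rN (rM + rC e *: s) -> Dr n rN s <= Dr n rM s + eps
}.

(** * Channel divergences built from an abstract state divergence *)

Section Generic.
Variable Dv : forall n, 'M[C]_n -> 'M[C]_n -> \bar R.
Variable Dr : forall n, 'M[C]_n -> 'M[C]_n -> R.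
Arguments Dv {n}. Arguments Dr {n}.
Hypothesis HD : divergence (@Dv) (@Dr).
Let DvE := div_fin HD.
Let Dr_dpi := div_dpi HD.
Let Dr_bound := div_bound HD.
Let Dr_ge0 := div_ge0 HD.
Let Dr_eq0 := div_eq0 HD.
Let Dr_self := div_self HD.
Let Dr_tens := div_tens HD.

(** A real least upper bound over all references and inputs. Its two halves are used separately,
    which keeps extended reals out of the estimates. *)
Definition is_chdiv m n (N : 'M[C]_m -> 'M[C]_n) (g : 'M[C]_n) (r : R) : Prop :=
  (forall k (psi : 'M[C]_(k * m)), is_state psi ->
    Dr (idtens N psi) (idtens (replacer g) psi) <= r) /\
  (forall B, (forall k (psi : 'M[C]_(k * m)), is_state psi ->
    Dr (idtens N psi) (idtens (replacer g) psi) <= B) -> r <= B).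

Lemma channel_pair k m n (N : 'M[C]_m -> 'M[C]_n) g (psi : 'M[C]_(k * m)) :
  is_channel N -> fstate g -> is_state psi ->
  let r := idtens N psi in let s := idtens (replacer g) psi in
  [/\ psd r, psd s, rtrace r = 1, rtrace s = 1 & dom r s].
Proof.
move=> cN fg sp; have [pr tr] := idtens_state cN sp.
have [ps ts] := idtens_state (@replacer_channel m n g (fstate_state fg)) sp.
have [K K0 dK] := idtens_dom fg; split; [exact: pr|exact: ps|exact: tr|exact: ts|].
by exists K; [exact: K0|apply: (dK _ _ _ _ cN); case: sp].
Qed.

Lemma Dv_pair k m n (N : 'M[C]_m -> 'M[C]_n) g (psi : 'M[C]_(k * m)) :
  is_channel N -> fstate g -> is_state psi ->
  Dv (idtens N psi) (idtens (replacer g) psi)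
    = (Dr (idtens N psi) (idtens (replacer g) psi))%:E.
Proof. by move=> cN fg sp; have [pr ps _ _ d] := channel_pair cN fg sp; exact: DvE. Qed.

(** The supremum is finite because [idtens_dom] supplies one dominance constant for all references,
    and [Dr_bound] turns it into one bound. *)
Lemma chdiv_real m n (N : 'M[C]_m -> 'M[C]_n) (g : 'M[C]_n) : (0 < m)%N ->
  is_channel N -> fstate g ->
  exists2 r, chdiv (@Dv) N (replacer g) = r%:E & is_chdiv N g r.
Proof.
move=> m0 cN fg.
pose A : set R := [set x : R | exists k (psi : 'M[C]_(k * m)), is_state psi /\
     x = Dr (idtens N psi) (idtens (replacer g) psi)]%classic.
have A0 : (A !=set0)%classic.
  have [psi sp] := state_exists m0.
  by exists (Dr (idtens N psi) (idtens (replacer g) psi)), 1%N, psi.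
have [K K0 dK] := idtens_dom fg; have [B hB] := Dr_bound K0.
have ubA : has_ubound A.
  exists B => x [k [psi [sp ->]]]; have [pr ps tr ts _] := channel_pair cN fg sp.
  by apply: (hB _ _ _ pr ps tr ts); apply: (dK _ _ _ _ cN); case: sp.
exists (sup A).
  rewrite /chdiv -ereal_sup_EFin//; congr ereal_sup; apply/seteqP; split => x /=.
    move=> [k [psi [sp ->]]]; exists (Dr (idtens N psi) (idtens (replacer g) psi)).
      by exists k, psi.
    by rewrite Dv_pair.
  move=> [y [k [psi [sp ->]]] <-]; exists k, psi; split=> //.
  by rewrite Dv_pair.
split=> [k psi sp|B' hB'].
  by apply: ub_le_sup => //; exists k, psi.
by apply: ge_sup => // x [k [psi [sp ->]]]; exact: hB'.
Qed.

Lemma chdiv_unique m n (N : 'M[C]_m -> 'M[C]_n) (g : 'M[C]_n) r : (0 < m)%N ->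
  is_channel N -> fstate g -> is_chdiv N g r -> chdiv (@Dv) N (replacer g) = r%:E.
Proof.
move=> m0 cN fg [r1 r2]; have [r' -> [r1' r2']] := chdiv_real m0 cN fg.
by congr EFin; apply/eqP; rewrite eq_le r2//= ?r2'// => ?; exact: r1.
Qed.

Lemma idtens_supmap k e m' m n' n (P : 'M[C]_n' -> 'M[C]_(e * m'))
  (Q : 'M[C]_(e * m) -> 'M[C]_n) (N : 'M[C]_m' -> 'M[C]_m) (psi : 'M[C]_(k * n')) :
  lin_map P -> lin_map Q -> lin_map N ->
  idtens (supmap P Q N) psi
  = idtens Q (reix (@assoc_ix k e m) (idtens N (reix (@assoc_inv k e m') (idtens P psi)))).
Proof.
move=> lP lQ lN; rewrite /supmap.
rewrite (@idtens_comp _ k n' (e * m) n Q (fun X => idtens N (P X)) lQ); last first.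
  by apply: lin_map_comp => //; exact: idtens_lin.
congr idtens; rewrite -(idtens_idtens lN).
by rewrite (@idtens_comp _ k n' (e * m') (e * m) (idtens N) P (idtens_lin _) lP).
Qed.

Lemma reix_state p q (f : 'I_p -> 'I_q) g (X : 'M[C]_q) : cancel f g -> cancel g f ->
  is_state X -> is_state (reix f X).
Proof.
move=> fK gK /is_stateE[pX tX]; apply/is_stateE; rewrite reix_kraus; split.
  exact: psd_kraus.
by rewrite rtrace_kraus//; exact: (reix1 R fK gK).
Qed.

(** The memory of the superchannel joins the reference: the preprocessed input [psi1] is an
    admissible input of [N] with reference of dimension [k * e]. The postprocessing is then removed
    by data processing. *)
Lemma chdiv_A1 e m' m n' n (P : 'M[C]_n' -> 'M[C]_(e * m'))
  (Q : 'M[C]_(e * m) -> 'M[C]_n) (N : 'M[C]_m' -> 'M[C]_m) gA gB :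
  (0 < m')%N -> fstate gA -> fstate gB ->
  is_channel P -> is_channel Q -> is_channel N ->
  supmap P Q (replacer gA) = replacer gB ->
  (chdiv (@Dv) (supmap P Q N) (replacer gB) <= chdiv (@Dv) N (replacer gA))%E.
Proof.
move=> m0 fA fB cP cQ cN E; have [r -> [r1 _]] := chdiv_real m0 cN fA.
apply: ge_ereal_sup => _ [k [psi [sp ->]]]; rewrite -E.
have [lP _ _] := cP; have [lQ _ _] := cQ; have [lN _ _] := cN.
rewrite (idtens_supmap _ lP lQ lN) (idtens_supmap _ lP lQ (@replacer_lin _ _ gA)).
set psi1 := reix _ (idtens P psi).
have sp1 : is_state psi1.
  apply: (reix_state (@assoc_invK k e m') (@assoc_ixK k e m')).
  by apply/is_stateE; exact: idtens_state.
have [e2 [W [QW W1]]] := channel_kraus cQ.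
have [pr ps tr ts d] := channel_pair cN fA sp1.
rewrite (funext QW) !idtens_kraus !reix_kraus.
set V := fun _ : 'I_1 => _; have V1 := reix1 R (@assoc_ixK k e m) (@assoc_invK k e m).
have d1 := dom_kraus V d.
have pr1 := psd_kraus V pr; have ps1 := psd_kraus V ps.
have W1' := id_kraus1 k W1.
rewrite DvE; [|exact: psd_kraus|exact: psd_kraus|exact: dom_kraus].
rewrite lee_fin; apply: le_trans (r1 _ _ sp1).
apply: (@le_trans _ _ (Dr (kraus V (idtens N psi1)) (kraus V (idtens (replacer gA) psi1)))).
  by apply: Dr_dpi => //; rewrite rtrace_kraus.
exact: Dr_dpi.
Qed.

(** Both outputs are product states with the same reference marginal; additivity on products and
    [Dr r r = 0] make the value independent of the input. *)
Lemma chdiv_A2 m n (w g : 'M[C]_n) : (0 < m)%N -> is_state w -> fstate g ->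
  chdiv (@Dv) (@replacer R m n w) (replacer g) = Dv w g.
Proof.
move=> m0 sw fg; have cw := replacer_channel m sw.
have [pw tw] := (is_stateE w).1 sw; have [pg tg _] := fg.
have dwg : dom w g.
  have [l l0 lg] : exists2 l, 0 < l & lep (rC l *: 1%:M) g by case: fg.
  exists l^-1; first by rewrite invr_gt0.
  have h := lep_trace pw; rewrite tw rC1 scale1r in h.
  exact: lep_trans h (lep_scaleV l0 lg).
rewrite (DvE pw pg dwg); apply: chdiv_unique => //.
have DE k (psi : 'M[C]_(k * m)) : is_state psi ->
    Dr (idtens (replacer w) psi) (idtens (replacer g) psi) = Dr w g.
  move=> /is_stateE[pp tp]; rewrite !idtens_replacer Dr_tens//.
  - rewrite Dr_self ?add0r//; [exact: psd_ptr|by rewrite rtrace_ptr].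
  - exact: psd_ptr.
  - exact: psd_ptr.
  - by rewrite rtrace_ptr.
  - by rewrite rtrace_ptr.
  - exact: dom_refl.
split=> [k psi sp|B hB]; first by rewrite DE.
by have [psi sp] := state_exists m0; rewrite -(DE _ _ sp); exact: hB.
Qed.

Lemma chdiv_A3 m n (N : 'M[C]_m -> 'M[C]_n) g : (0 < m)%N -> is_channel N -> fstate g ->
  (0 <= chdiv (@Dv) N (replacer g))%E /\
  (chdiv (@Dv) N (replacer g) = 0%E <-> N = replacer g).
Proof.
move=> m0 cN fg; split.
  have [r -> [r1 _]] := chdiv_real m0 cN fg; rewrite lee_fin.
  have [psi sp] := state_exists m0; apply: le_trans (r1 _ _ sp).
  by have [pr ps tr ts d] := channel_pair cN fg sp; exact: Dr_ge0.
split=> [|->]; last first.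
  have [pg tg _] := fg; rewrite chdiv_A2//; last exact: fstate_state.
  by rewrite DvE//; [rewrite Dr_self|exact: dom_refl].
have [r -> [r1 _]] := chdiv_real m0 cN fg => -[r0].
(* Vanishing is tested on the maximally entangled input only: faithfulness identifies the two Choi
   matrices, and these determine the maps. *)
have sp := maxent_is_state m0; have := r1 _ _ sp; rewrite r0 => D0.
have [pr ps tr ts d] := channel_pair cN fg sp.
have [lN _ _] := cN; apply: channel_ext => //; first exact: replacer_lin.
have := Dr_eq0 pr ps tr ts d; rewrite /maxent_state !(lin_mapZ (idtens_lin _)) => h.
have t0 := rtrace_maxent_gt0 m0.
apply: (@scalerI _ _ (rC (rtrace (maxent R m))^-1)).
  by rewrite fmorph_eq0 invr_eq0 gt_eqF.
apply: h; rewrite -!(lin_mapZ (idtens_lin _)); apply/eqP.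
by rewrite eq_le D0 (Dr_ge0 pr ps tr ts d).
Qed.

Lemma chdiv_superadd m1 n1 m2 n2 (N : 'M[C]_m1 -> 'M[C]_n1) (M : 'M[C]_m2 -> 'M[C]_n2)
  g1 g2 r1 r2 r : is_channel N -> is_channel M -> fstate g1 -> fstate g2 ->
  is_chdiv N g1 r1 -> is_chdiv M g2 r2 -> is_chdiv (tensmap N M) (g1 *t g2) r ->
  r1 + r2 <= r.
Proof.
move=> cN cM f1 f2 [_ h1] [_ h2] [h _]; rewrite -lerBrDr; apply: h1 => k1 psi1 s1.
rewrite lerBrDr addrC -lerBrDr; apply: h2 => k2 psi2 s2; rewrite lerBrDr addrC.
have [pr1 ps1 tr1 ts1 d1] := channel_pair cN f1 s1.
have [pr2 ps2 tr2 ts2 d2] := channel_pair cM f2 s2.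
rewrite -Dr_tens//.
have [lN _ _] := cN; have [lM _ _] := cM.
pose Psi := reix (@swap_ix k1 m1 k2 m2) (psi1 *t psi2).
have sPsi : is_state Psi.
  apply: (reix_state (@swap_ixK k1 m1 k2 m2) (@swap_ixK k1 k2 m1 m2)).
  have [p1 t1] := (is_stateE psi1).1 s1; have [p2 t2] := (is_stateE psi2).1 s2.
  apply/is_stateE; split; first exact: psd_tens.
  by rewrite (rtrace_tens p1.1 p2.1) t1 t2 mulr1.
apply: le_trans (h _ _ sPsi).
rewrite -tensmap_replacer (idtens_tensmap_swap lN lM) idtens_tensmap_swap; first last.
- exact: replacer_lin.
- exact: replacer_lin.
set A := idtens N psi1 *t _; set B := idtens (replacer g1) psi1 *t _.
(* The product pair is written as the inverse relabelling of the pair produced by the tensor product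
   channel, so [Dr_dpi] gives the inequality in the required direction. *)
rewrite -{1}(reixK A (@swap_ixK k1 k2 n1 n2)) -{1}(reixK B (@swap_ixK k1 k2 n1 n2)).
rewrite !(reix_kraus (@swap_ix k1 k2 n1 n2)).
have pA : psd A := psd_tens pr1 pr2.
have pB : psd B := psd_tens ps1 ps2.
have tA : rtrace A = 1 by rewrite (rtrace_tens pr1.1 pr2.1) tr1 tr2 mulr1.
have tB : rtrace B = 1 by rewrite (rtrace_tens ps1.1 ps2.1) ts1 ts2 mulr1.
have dAB : dom A B := dom_tens pr1 pr2 ps1 ps2 d1 d2.
have S1 := reix1 R (@swap_ixK k1 n1 k2 n2) (@swap_ixK k1 k2 n1 n2).
apply: Dr_dpi; first exact: (reix1 R (@swap_ixK k1 k2 n1 n2) (@swap_ixK k1 n1 k2 n2)).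
- by rewrite reix_kraus; exact: psd_kraus.
- by rewrite reix_kraus; exact: psd_kraus.
- by rewrite reix_kraus rtrace_kraus.
- by rewrite reix_kraus rtrace_kraus.
- by rewrite !reix_kraus; exact: dom_kraus.
Qed.

Lemma ptr_assoc k m1 m2 (X : 'M[C]_(k * (m1 * m2))) :
  ptr (ptr (reix (@assoc_inv k m1 m2) X)) = ptr X.
Proof.
move: X; apply: lin_tens3_ext.
- apply: lin_map_comp; first exact: kraus_lin.
  by apply: lin_map_comp; [exact: kraus_lin|exact: reix_lin].
- exact: kraus_lin.
move=> A B D; rewrite reix_assoc_inv ptr_tens /ptr krausZ -/(ptr _) ptr_tens.
by rewrite -/(ptr _) ptr_tens mxtrace_tens scalerA mulrC.
Qed.

Lemma tensmap_split m1 n1 m2 n2 (N : 'M[C]_m1 -> 'M[C]_n1) (M : 'M[C]_m2 -> 'M[C]_n2) :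
  lin_map N -> lin_map M ->
  tensmap N M = fun X => idtens M (tensmap N (fun Y => Y) X).
Proof.
move=> lN lM; apply/funext; apply: tensmap_unique.
  by apply: lin_map_comp; [exact: idtens_lin|exact: tensmap_lin].
by move=> A B; rewrite (tensmap_tens _ _ lN)// (idtens_tens _ _ lM).
Qed.

Lemma ptr_tensmap_id k m1 n1 m2 (N : 'M[C]_m1 -> 'M[C]_n1) : lin_map N ->
  forall X : 'M[C]_(k * (m1 * m2)),
  ptr (reix (@assoc_inv k n1 m2) (idtens (tensmap N (fun Y => Y)) X))
  = idtens N (ptr (reix (@assoc_inv k m1 m2) X)).
Proof.
move=> lN; apply: lin_tens3_ext.
- apply: lin_map_comp; first exact: kraus_lin.
  by apply: lin_map_comp; [exact: reix_lin|exact: idtens_lin].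
- apply: lin_map_comp; first exact: idtens_lin.
  by apply: lin_map_comp; [exact: kraus_lin|exact: reix_lin].
move=> A B D; rewrite (idtens_tens _ _ (tensmap_lin _ _)) (tensmap_tens _ _ lN)//.
rewrite !reix_assoc_inv !ptr_tens (lin_mapZ (idtens_lin _)) (idtens_tens _ _ lN).
by [].
Qed.

Lemma id_channel m : is_channel (fun X : 'M[C]_m => X).
Proof.
have -> : (fun X : 'M[C]_m => X) = kraus (fun _ : 'I_1 => 1%:M).
  by apply/funext => X; rewrite /kraus big_ord1 mul1mx adjmx1 mulmx1.
by apply: kraus_channel; rewrite big_ord1 adjmx1 mul1mx.
Qed.

Lemma dom_trans n (a b c : 'M[C]_n) : dom a b -> dom b c -> dom a c.
Proof.
move=> [x x0 ab] [y y0 bc]; exists (x * y); first exact: mulr_gt0.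
by apply: lep_trans ab _; rewrite -rCZ; exact: (lepZ (ltW x0) bc).
Qed.

(** Apply [N] first and treat its output, together with the reference, as reference for [M]. The
    state [xi] before [M] has marginal [idtens N psi1], so the chain property with [s1] as the
    comparison marginal separates the two channels, whatever the entanglement. *)
Lemma chdiv_subadd m1 n1 m2 n2 (N : 'M[C]_m1 -> 'M[C]_n1) (M : 'M[C]_m2 -> 'M[C]_n2)
  g1 g2 r1 r2 r : is_channel N -> is_channel M -> fstate g1 -> fstate g2 ->
  is_chdiv N g1 r1 -> is_chdiv M g2 r2 -> is_chdiv (tensmap N M) (g1 *t g2) r ->
  r <= r1 + r2.
Proof.
move=> cN cM f1 f2 [h1 _] [h2 _] [_ h]; apply: h => k psi sp.
have [lN _ _] := cN; have [lM _ _] := cM.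
pose psi1 := ptr (reix (@assoc_inv k m1 m2) psi).
pose xi := reix (@assoc_inv k n1 m2) (idtens (tensmap N (fun Y => Y)) psi).
have sp' := reix_state (@assoc_invK k m1 m2) (@assoc_ixK k m1 m2) sp.
have sp1 : is_state psi1.
  by have [pp tp] := (is_stateE _).1 sp'; apply/is_stateE; split; [exact: psd_ptr|rewrite rtrace_ptr].
have cNid := tensmap_channel cN (id_channel m2).
have sxi : is_state xi.
  apply: (reix_state (@assoc_invK k n1 m2) (@assoc_ixK k n1 m2)).
  by apply/is_stateE; exact: idtens_state.
have pxi : ptr xi = idtens N psi1 := ptr_tensmap_id lN psi.
pose w := idtens M xi; pose s1 := idtens (replacer g1) psi1.
have XE : idtens (tensmap N M) psi = reix (@assoc_ix k n1 n2) w.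
  rewrite (tensmap_split lN lM) (idtens_comp (idtens_lin _) (tensmap_lin _ _)).
  by rewrite (idtens_idtens lM).
have SE : idtens (replacer (g1 *t g2)) psi = reix (@assoc_ix k n1 n2) (s1 *t g2).
  by rewrite /s1 !idtens_replacer reix_assoc /psi1 ptr_assoc.
have [pN ps1 tN ts1 d1] := channel_pair cN f1 sp1.
have [pw pt2 tw tt2 d2] := channel_pair cM f2 sxi.
have [pg2 tg2 _] := f2.
have dw : dom w (s1 *t g2).
  apply: dom_trans d2 _; rewrite idtens_replacer pxi.
  exact: (dom_tens pN pg2 ps1 pg2 d1 (dom_refl _)).
have pS : psd (s1 *t g2) := psd_tens ps1 pg2.
have tS : rtrace (s1 *t g2) = 1 by rewrite (rtrace_tens ps1.1 pg2.1) ts1 tg2 mulr1.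
rewrite XE SE !reix_kraus.
have V1 := reix1 R (@assoc_ixK k n1 n2) (@assoc_invK k n1 n2).
apply: le_trans (Dr_dpi V1 pw pS tw tS dw) _.
have dxi : dom (ptr xi) s1 by rewrite pxi.
apply: le_trans (div_chain HD cM f2 sxi ps1 ts1 dxi (h2 _)) _.
by rewrite lerD2r pxi; exact: h1.
Qed.

Section LinMapAlgebra.
Variables (m n : nat) (F G : 'M[C]_m -> 'M[C]_n).

Lemma lin_add : lin_map F -> lin_map G -> lin_map (fun X => F X + G X).
Proof. by move=> lF lG c X Y; rewrite lF lG scalerDr addrACA. Qed.

Lemma lin_scale a : lin_map F -> lin_map (fun X => a *: F X).
Proof. by move=> lF c X Y; rewrite lF scalerDr !scalerA mulrC. Qed.

Lemma lin_opp : lin_map F -> lin_map (fun X => - F X).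
Proof. by move=> lF c X Y; rewrite lF opprD scalerN. Qed.
End LinMapAlgebra.

(** The difference [M + e T - N] is completely positive as soon as its Choi matrix is positive, so
    one inequality at the maximally entangled state serves all references. In the hypothesis on [d],
    the trace undoes the normalisation of that state and [l] compares the identity with [g]. *)
Lemma choi_lep m n (N M : 'M[C]_m -> 'M[C]_n) (g : 'M[C]_n) l e d : (0 < m)%N ->
  lin_map N -> lin_map M -> 0 < l -> lep (rC l *: 1%:M) g ->
  lep (idtens N (maxent_state m)) (idtens M (maxent_state m) + rC d *: 1%:M) ->
  0 <= e -> d * rtrace (maxent R m) <= e * l ->
  forall k (psi : 'M[C]_(k * m)), psd psi ->
  lep (idtens N psi) (idtens M psi + rC e *: idtens (replacer g) psi).
Proof.
move=> m0 lN lM l0 lg NM e0 de k psi pp.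
pose F X := (M X + rC e *: replacer g X) - N X.
have lF : lin_map F.
  exact: (lin_add (lin_add lM (lin_scale (rC e) (@replacer_lin m n g))) (lin_opp lN)).
have FE k' (X : 'M[C]_(k' * m)) :
    idtens F X = idtens M X + rC e *: idtens (replacer g) X - idtens N X.
  move: X; apply: tensmap_unique.
    apply: lin_add; last by apply: lin_opp; exact: idtens_lin.
    by apply: lin_add; [exact: idtens_lin|apply: lin_scale; exact: idtens_lin].
  move=> A B; rewrite !idtens_tens//; last exact: replacer_lin.
  by rewrite /F -tensmxZr -tensmxDr -scaleN1r -tensmxZr -tensmxDr scaleN1r.
have ptr1 : ptr (maxent R m) = 1%:M.
  apply/matrixP => i j; rewrite ptrE; under eq_bigr do rewrite maxentE.
  rewrite mxE (bigD1 i)//= eqxx big1 ?addr0 => [|b bi]; first by rewrite eq_sym.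
  by rewrite eq_sym (negbTE bi).
have t0 := rtrace_maxent_gt0 m0.
have pF : psd (idtens F (maxent R m)).
  have := lepZ (ltW t0) NM.
  rewrite scalerDr -!(lin_mapZ (idtens_lin _)) /maxent_state rCZ mulfV ?gt_eqF// rC1 scale1r.
  rewrite rCZ => h; rewrite FE; apply: lep_trans h _; apply: lepD; first exact: lep_refl.
  rewrite idtens_replacer ptr1.
  have h2 : lep (rC (rtrace (maxent R m) * d) *: 1%:M)
      (rC (e * l) *: (1%:M : 'M[C]_(m * n))).
    by rewrite /lep -scalerBl -rCB; apply: psdZ; [lra|exact: psd1].
  apply: lep_trans h2 _; rewrite -rCZ; apply: (lepZ e0).
  by rewrite -tens1mx1 -tensmxZr; exact: (lep_tensr (psd1 _ _) lg).
have [e' [V FV]] := choi_kraus lF pF.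
rewrite /lep -FE (funext FV) idtens_kraus.
exact: psd_kraus.
Qed.

End Generic.
End Divergence.

(** * Convexity and continuity of the relative entropy *)

Section Relent.
Variable R : realType.
Local Notation C := R[i].

Lemma relentE n (r s : 'M[C]_n) : psd r -> psd s -> dom r s -> relent r s = (relr r s)%:E.
Proof.
by move=> pr ps d; rewrite /relent (dom_sub pr ps d) /relr !fc.unlock.
Qed.

Lemma relr_dpi_dom e m n (V : 'I_e -> 'M[C]_(n, m)) (r s : 'M[C]_m) :
  \sum_i (V i)^h *m V i = 1%:M -> psd r -> psd s -> rtrace r = 1 -> rtrace s = 1 ->
  dom r s -> relr (kraus V r) (kraus V s) <= relr r s.
Proof.
move=> V1 pr ps _ _ d.
have kd := dom_sub (psd_kraus V pr) (psd_kraus V ps) (dom_kraus V d).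
exact: relr_dpi V1 pr ps (dom_sub pr ps d) kd.
Qed.

Lemma relr_bounded (K : R) : 0 < K -> exists B : R,
  forall n (r s : 'M[C]_n), psd r -> psd s -> rtrace r = 1 -> rtrace s = 1 ->
  lep r (rC K *: s) -> relr r s <= B.
Proof.
move=> K0; exists (- ln K^-1) => n r s pr ps tr _ rs.
have K1 : 0 < K^-1 by rewrite invr_gt0.
have h := lepZ (ltW K1) rs; rewrite rCZ mulVf ?gt_eqF// rC1 scale1r in h.
by have := relr_bound K1 pr ps h; rewrite tr mulr1.
Qed.

Lemma relr_ge0 n (r s : 'M[C]_n) : psd r -> psd s -> rtrace r = 1 ->
  rtrace s = 1 -> dom r s -> 0 <= relr r s.
Proof.
move=> pr ps tr ts d; have E : rtrace r = rtrace s by rewrite tr ts.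
by have [] := relr_klein pr ps (dom_sub pr ps d) E.
Qed.

Lemma relr_eq0 n (r s : 'M[C]_n) : psd r -> psd s -> rtrace r = 1 ->
  rtrace s = 1 -> dom r s -> relr r s = 0 -> r = s.
Proof.
move=> pr ps tr ts d; have E : rtrace r = rtrace s by rewrite tr ts.
by have [] := relr_klein pr ps (dom_sub pr ps d) E.
Qed.

Lemma relr_self n (r : 'M[C]_n) : psd r -> rtrace r = 1 -> relr r r = 0.
Proof.
move=> pr _; have := relr_scale ltr01 pr.
by rewrite rC1 scale1r ln1 oppr0 mul0r.
Qed.

Lemma relr_tens_dom m n (r1 s1 : 'M[C]_m) (r2 s2 : 'M[C]_n) :
  psd r1 -> psd s1 -> psd r2 -> psd s2 -> rtrace r1 = 1 -> rtrace s1 = 1 ->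
  rtrace r2 = 1 -> rtrace s2 = 1 -> dom r1 s1 -> dom r2 s2 ->
  relr (r1 *t r2) (s1 *t s2) = relr r1 s1 + relr r2 s2.
Proof.
move=> p1 q1 p2 q2 t1 _ t2 _ d1 d2.
exact: relr_tens p1 q1 p2 q2 (dom_sub p1 q1 d1) (dom_sub p2 q2 d2) t1 t2.
Qed.

(** Donald's identity: the entropy terms of the [A i] cancel, and what remains is linear in the
    first argument. It gives convexity by nonnegativity of the last sum, and it is needed as an
    exact identity in [relr_continuity]. *)
Lemma relr_mix n (I : finType) (w : I -> R) (A : I -> 'M[C]_n) (s : 'M[C]_n) :
  (forall i, hermitian (A i)) ->
  \sum_i w i * relr (A i) s
  = relr (\sum_i rC (w i) *: A i) s + \sum_i w i * relr (A i) (\sum_i rC (w i) *: A i).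
Proof.
move=> hA; set X := \sum_i rC (w i) *: A i.
have hX : hermitian X.
  by rewrite /hermitian /X adjmx_sum; apply: eq_bigr => i _; rewrite adjmxZ conj_rC hA.
have lin Y : \sum_i w i * relr (A i) Y
    = \sum_i w i * rtrace (fc (fun x => x * ln x) (A i)) - rtrace (X *m fc (@ln R) Y).
  rewrite /X mulmx_suml rtrace_sum -sumrB; apply: eq_bigr => i _.
  by rewrite -scalemxAl rtraceZ -mulrBr.
have EX : X *m fc (@ln R) X = fc (fun x => x * ln x) X.
  by rewrite -{1}(@fcalc_id _ _ id X hX)// (fcalcM _ _ hX).
by rewrite !lin /relr EX; ring.
Qed.

Lemma psd_mix n (I : finType) (w : I -> R) (A : I -> 'M[C]_n) :
  (forall i, 0 <= w i) -> (forall i, psd (A i)) -> psd (\sum_i rC (w i) *: A i).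
Proof. by move=> w0 pA; apply: psd_sum => i _; exact: psdZ. Qed.

Lemma rtrace_mix n (I : finType) (w : I -> R) (A : I -> 'M[C]_n) :
  \sum_i w i = 1 -> (forall i, rtrace (A i) = 1) -> rtrace (\sum_i rC (w i) *: A i) = 1.
Proof.
move=> w1 tA; rewrite rtrace_sum -w1; apply: eq_bigr => i _.
by rewrite rtraceZ tA mulr1.
Qed.

Lemma lep_mix n (I : finType) (w : I -> R) (A : I -> 'M[C]_n) i :
  (forall i, 0 <= w i) -> (forall i, psd (A i)) ->
  lep (rC (w i) *: A i) (\sum_i rC (w i) *: A i).
Proof.
move=> w0 pA; rewrite /lep (bigD1 i)//= addrAC subrr add0r.
by apply: psd_sum => j _; exact: psdZ.
Qed.

Lemma relr_convex n (I : finType) (w : I -> R) (A : I -> 'M[C]_n) (s : 'M[C]_n) :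
  (forall i, 0 <= w i) -> \sum_i w i = 1 -> (forall i, psd (A i)) ->
  (forall i, rtrace (A i) = 1) ->
  relr (\sum_i rC (w i) *: A i) s <= \sum_i w i * relr (A i) s.
Proof.
move=> w0 w1 pA tA; have hA i : hermitian (A i) := (pA i).1.
rewrite (relr_mix w s hA) lerDl; apply: sumr_ge0 => i _.
(* Zero weights are set aside because dominance by the mixture has constant [1 / w i]. *)
have [->|wi] := eqVneq (w i) 0; first by rewrite mul0r.
have wp : 0 < w i by rewrite lt_neqAle eq_sym wi w0.
apply: mulr_ge0 => //; apply: relr_ge0 => //.
- exact: psd_mix.
- exact: rtrace_mix.
exists (w i)^-1; first by rewrite invr_gt0.
exact: (lep_scaleV wp (lep_mix i w0 pA)).
Qed.

(** The left side is [1 + e] times the binary entropy of [1/(1+e)]. With [u] the square root of [e],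
    one has [(1+e)/e <= (1 + 1/u)^2], whence the logarithm is at most [2/u]. *)
Lemma ln_entropy_bound (e : R) : 0 < e ->
  ln (1 + e) + e * ln ((1 + e) / e) <= e + 2 * Num.sqrt e.
Proof.
move=> e0; apply: lerD; first by apply: le_ln1Dx; lra.
pose u := Num.sqrt e; have u0 : 0 < u by rewrite sqrtr_gt0.
have eE : e = u ^+ 2 by rewrite sqr_sqrtr ?ltW.
have h : ln ((1 + e) / e) <= 2 / u.
  have le1 : (1 + e) / e <= (1 + u^-1) ^+ 2.
    rewrite eE -subr_ge0.
    have -> : (1 + u^-1) ^+ 2 - (1 + u ^+ 2) / u ^+ 2 = 2 / u by field; rewrite gt_eqF.
    by rewrite divr_ge0 ?ltW.
  have pos : 0 < 1 + u^-1 by rewrite addr_gt0 ?invr_gt0.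
  have pos2 : 0 < (1 + e) / e by rewrite divr_gt0 ?addr_gt0.
  apply: le_trans (_ : ln ((1 + u^-1) ^+ 2) <= _).
    by rewrite ler_ln ?posrE// exprn_gt0.
  have uV : 0 < u^-1 by rewrite invr_gt0.
  have := @le_ln1Dx R u^-1; rewrite (lt_trans _ uV) ?ltrN10// => /(_ isT).
  by rewrite lnXn// mulr2n; lra.
apply: le_trans (ler_wpM2l (ltW e0) h) _.
by rewrite {1}eE expr2 -/u (mulrC 2) mulrA mulfK ?gt_eqF// mulrC.
Qed.

(** The mixture [X = p rM + (1-p) s] is decomposed a second time as [p rN + (1-p) tau]. Convexity
    bounds [relr X s] through the first decomposition, and the mixing identity for the second one
    extracts [relr rN s], up to divergences from [X] that are at most [- ln p] and [- ln (1-p)]. *)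
Lemma relr_continuity (e : R) n (rN rM s : 'M[C]_n) : 0 < e ->
  psd rN -> psd rM -> psd s -> rtrace rN = 1 -> rtrace rM = 1 -> rtrace s = 1 ->
  dom rM s -> lep rN (rM + rC e *: s) ->
  relr rN s <= relr rM s + (e + 2 * Num.sqrt e).
Proof.
move=> e0 pN pM ps tN tM ts [K K0 dM] le.
pose p := (1 + e)^-1; have e1 : 0 < 1 + e by lra.
have p0 : 0 < p by rewrite invr_gt0.
have pe : 1 - p = e * p by rewrite /p; field; rewrite gt_eqF.
have q0 : 0 < 1 - p by rewrite pe mulr_gt0.
have w0 (b : bool) : 0 <= (if b then p else 1 - p) by case: b; rewrite ltW.
have w1 : \sum_(b : bool) (if b then p else 1 - p) = 1 by rewrite big_bool /= addrC subrK.
pose A1 (b : bool) := if b then rM else s.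
pose X := rC p *: rM + rC (1 - p) *: s.
have XE : \sum_b rC (if b then p else 1 - p) *: A1 b = X by rewrite big_bool.
have pA1 b : psd (A1 b) by case: b.
have tA1 b : rtrace (A1 b) = 1 by case: b.
(* The remainder of [X] after removing [p rN]. It is positive because [X = p (rM + e s)] dominates
   [p rN], and it has unit trace. *)
pose tau := rC (1 - p)^-1 *: (X - rC p *: rN).
have ptau : psd tau.
  apply: psdZ; first by rewrite invr_ge0 ltW.
  have := lepZ (ltW p0) le; rewrite /lep scalerDr rCZ mulrC -pe -/X.
  by [].
have tau_E : rC (1 - p) *: tau = X - rC p *: rN.
  by rewrite /tau rCZ mulfV ?gt_eqF// rC1 scale1r.
have tX : rtrace X = 1 by rewrite /X rtraceD !rtraceZ tM ts; lra.
have ttau : rtrace tau = 1.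
  by rewrite /tau rtraceZ rtraceB rtraceZ tX tN mulr1 mulVf ?gt_eqF.
pose A2 (b : bool) := if b then rN else tau.
have pA2 b : psd (A2 b) by case: b.
have tA2 b : rtrace (A2 b) = 1 by case: b.
have XE2 : \sum_b rC (if b then p else 1 - p) *: A2 b = X.
  by rewrite big_bool /= tau_E addrC subrK.
have pX : psd X by rewrite -XE; exact: psd_mix.
have cvx := relr_convex s w0 w1 pA1 tA1; rewrite XE big_bool /= relr_self// mulr0 addr0 in cvx.
have hA2 b : hermitian (A2 b) := (pA2 b).1.
have mixE := relr_mix (fun b : bool => if b then p else 1 - p) s hA2.
rewrite XE2 !big_bool /= in mixE.
have lN : lep (rC p *: rN) X by have := lep_mix true w0 pA2; rewrite XE2.
have lT : lep (rC (1 - p) *: tau) X by have := lep_mix false w0 pA2; rewrite XE2.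
have bN := relr_bound p0 pN pX lN; have bT := relr_bound q0 ptau pX lT.
rewrite tN mulr1 in bN; rewrite ttau mulr1 in bT.
have gT : 0 <= relr tau s.
  apply: relr_ge0 => //; exists ((1 - p)^-1 * (p * K + (1 - p))).
    by rewrite mulr_gt0 ?invr_gt0// addr_gt0// mulr_gt0.
  apply: lep_trans (lep_scaleV q0 lT) _; rewrite -rCZ; apply: lepZ.
    by rewrite invr_ge0 ltW.
  rewrite rCD scalerDl -rCZ; apply: lepD; last exact: lep_refl.
  exact: lepZ (ltW p0) dM.
have main : p * relr rN s <= p * (relr rM s + (- ln p + e * - ln (1 - p))).
  have h1 := ler_wpM2l (ltW p0) bN; have h2 := ler_wpM2l (ltW q0) bT.
  have h3 := mulr_ge0 (ltW q0) gT.
  have E : p * (e * - ln (1 - p)) = (1 - p) * - ln (1 - p) by rewrite {2}pe; ring.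
  have -> : p * relr rN s = relr X s + (p * relr rN X + (1 - p) * relr tau X)
      - (1 - p) * relr tau s by rewrite -mixE addrK.
  have -> : p * (relr rM s + (- ln p + e * - ln (1 - p)))
      = p * relr rM s + (p * - ln p + (1 - p) * - ln (1 - p)) by rewrite -E; ring.
  apply: le_trans (lerD cvx (lerD h1 h2)).
  by rewrite lerBlDr lerDl.
have := ln_entropy_bound e0.
have -> : ln (1 + e) = - ln p by rewrite /p lnV ?posrE// opprK.
have -> : ln ((1 + e) / e) = - ln (1 - p).
  by rewrite pe -[(1 + e) / e]invrK lnV ?posrE ?invr_gt0 ?divr_gt0// invfM invrK mulrC.
move=> bnd; move: main; rewrite (ler_pM2l p0) => /le_trans; apply.
by rewrite lerD2l.
Qed.

End Relent.

(** * Sandwiched channel divergences *)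

Section SandwichedChannel.
Variable R : realType.
Local Notation C := R[i].
Variable al : R.
Hypothesis al1 : 1 < al.
Let al0 : 0 < al. Proof. exact: lt_trans ltr01 al1. Qed.
Let al10 : 0 < al - 1. Proof. by rewrite subr_gt0. Qed.

Definition sandr n (r s : 'M[C]_n) : R := (al - 1)^-1 * ln (qal al r s).

Lemma sandwichedE n (r s : 'M[C]_n) : psd r -> psd s -> dom r s ->
  sandwiched al r s = (sandr r s)%:E.
Proof.
move=> pr ps d.
by rewrite /sandwiched (dom_sub pr ps d) /sandr /qal /sandw /swexp !mp.unlock.
Qed.

Section Pair.
Variables (n : nat) (r s : 'M[C]_n).
Hypotheses (pr : psd r) (ps : psd s) (tr : rtrace r = 1) (ts : rtrace s = 1).
Hypothesis d : dom r s.

Lemma qal_dom_ge1 : 1 <= qal al r s.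
Proof. exact: (qal_ge1 al1 pr ps (dom_sub pr ps d) tr ts). Qed.

Lemma qal_dom_gt0 : 0 < qal al r s.
Proof. exact: lt_le_trans ltr01 qal_dom_ge1. Qed.

Lemma qalE : qal al r s = expR ((al - 1) * sandr r s).
Proof. by rewrite /sandr mulVKf ?gt_eqF// lnK ?posrE// qal_dom_gt0. Qed.

Lemma sandr_le B : (sandr r s <= B) = (qal al r s <= expR ((al - 1) * B)).
Proof. by rewrite qalE ler_expR ler_pM2l. Qed.

Lemma sandr_ge0 : 0 <= sandr r s.
Proof. by rewrite mulr_ge0 ?invr_ge0 ?ln_ge0 ?qal_dom_ge1// ltW. Qed.

Lemma sandr_eq0 : sandr r s = 0 -> r = s.
Proof.
move=> E; apply: (qal_eq1 al1 pr ps (dom_sub pr ps d) tr ts).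
by rewrite qalE E mulr0 expR0.
Qed.
End Pair.

Lemma sandr_dpi e m n (V : 'I_e -> 'M[C]_(n, m)) (r s : 'M[C]_m) :
  \sum_i (V i)^h *m V i = 1%:M -> psd r -> psd s -> rtrace r = 1 -> rtrace s = 1 ->
  dom r s -> sandr (kraus V r) (kraus V s) <= sandr r s.
Proof.
move=> V1 pr ps tr ts d; have kd := dom_kraus V d.
have pkr := psd_kraus V pr; have pks := psd_kraus V ps.
have tkr : rtrace (kraus V r) = 1 by rewrite rtrace_kraus.
have tks : rtrace (kraus V s) = 1 by rewrite rtrace_kraus.
rewrite sandr_le// -qalE//.
exact: (qal_dpi al1 V1 pr ps (dom_sub pr ps d) (dom_sub pkr pks kd)).
Qed.

Lemma sandr_bounded (K : R) : 0 < K -> exists B : R,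
  forall n (r s : 'M[C]_n), psd r -> psd s -> rtrace r = 1 -> rtrace s = 1 ->
  lep r (rC K *: s) -> sandr r s <= B.
Proof.
move=> K0; exists ((al - 1)^-1 * (al * ln K)) => n r s pr ps tr ts rs.
have d : dom r s by exists K.
rewrite sandr_le// mulVKf ?gt_eqF//.
have pKs := psdZ (ltW K0) ps.
apply: le_trans (qal_le al1 pr pKs ps rs) _.
by rewrite (qalZ al (ltW K0) ps ps) (qal_self al1 ps) ts mulr1 /powR gt_eqF.
Qed.

Lemma sandr_self n (r : 'M[C]_n) : psd r -> rtrace r = 1 -> sandr r r = 0.
Proof. by move=> pr tr; rewrite /sandr (qal_self al1 pr) tr ln1 mulr0. Qed.

Lemma sandr_tens m n (r1 s1 : 'M[C]_m) (r2 s2 : 'M[C]_n) :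
  psd r1 -> psd s1 -> psd r2 -> psd s2 -> rtrace r1 = 1 -> rtrace s1 = 1 ->
  rtrace r2 = 1 -> rtrace s2 = 1 -> dom r1 s1 -> dom r2 s2 ->
  sandr (r1 *t r2) (s1 *t s2) = sandr r1 s1 + sandr r2 s2.
Proof.
move=> p1 q1 p2 q2 t1 u1 t2 u2 d1 d2.
rewrite /sandr (qal_tens _ p1 q1 p2 q2) lnM ?posrE; first by rewrite mulrDr.
- exact: qal_dom_gt0.
- exact: qal_dom_gt0.
Qed.

(** [rN] lies below [1 + e] times a mixture [X] of [rM] and [s]. Homogeneity contributes [(1+e)^al];
    convexity gives [qal X s <= qal rM s], because [qal s s = 1] is the least possible value.
    Finally [ln (1+e) <= e]. *)
Lemma sandr_continuity (e : R) n (rN rM s : 'M[C]_n) : 0 < e ->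
  psd rN -> psd rM -> psd s -> rtrace rN = 1 -> rtrace rM = 1 -> rtrace s = 1 ->
  dom rN s -> dom rM s -> lep rN (rM + rC e *: s) ->
  sandr rN s <= sandr rM s + al / (al - 1) * e.
Proof.
move=> e0 pN pM ps tN tM ts dN dM le.
pose p := (1 + e)^-1; have e1 : 0 < 1 + e by lra.
have p0 : 0 < p by rewrite invr_gt0.
have pe : 1 - p = e * p by rewrite /p; field; rewrite gt_eqF.
have q0 : 0 < 1 - p by rewrite pe mulr_gt0.
have w0 (b : bool) : 0 <= (if b then p else 1 - p) by case: b; rewrite ltW.
have w1 : \sum_(b : bool) (if b then p else 1 - p) = 1 by rewrite big_bool /= addrC subrK.
pose A (b : bool) := if b then rM else s.
have pA b : psd (A b) by case: b.
have cvx := qal_convex al1 w0 w1 pA ps; rewrite !big_bool /= (qal_self al1 ps) ts in cvx.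
set X := _ + _ in cvx.
have XE : rM + rC e *: s = rC (1 + e) *: X.
  rewrite /X scalerDr !rCZ pe /p mulfV ?gt_eqF// rC1 scale1r.
  by rewrite (mulrC e) mulrA mulfV ?gt_eqF// mul1r.
have pX : psd X by apply: psdD; apply: psdZ => //; exact: ltW.
have h1 : qal al rN s <= (1 + e) `^ al * qal al X s.
  rewrite -(qalZ al (ltW e1) pX ps) -XE; apply: (qal_le al1 pN _ ps le).
  by rewrite XE; apply: psdZ => //; exact: ltW.
have h2 : qal al X s <= qal al rM s.
  have q1 := qal_dom_ge1 pM ps tM ts dM; apply: le_trans cvx _.
  have := ler_wpM2l (ltW q0) q1; lra.
have h3 : qal al rN s <= (1 + e) `^ al * qal al rM s.
  by apply: le_trans h1 _; rewrite ler_wpM2l ?powR_ge0.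
rewrite sandr_le// mulrDr expRD -qalE// mulrC; apply: le_trans h3 _.
rewrite ler_wpM2r ?(ltW (qal_dom_gt0 _ _ _ _ _))// /powR gt_eqF// ler_expR.
rewrite mulrA (mulrCA (al - 1)) mulfV ?gt_eqF// mulr1 ler_pM2l//.
by apply: le_ln1Dx; lra.
Qed.

Lemma scalemx3 m n p q (a b c : C) (P : 'M[C]_(m, n)) (W : 'M[C]_(n, p)) (Q : 'M[C]_(p, q)) :
  (a *: P) *m (b *: W) *m (c *: Q) = (c * a * b) *: (P *m W *m Q).
Proof. by rewrite -scalemxAr -!scalemxAl -scalemxAr -scalemxAl !scalerA. Qed.

Lemma idtens_conj k m n (N : 'M[C]_m -> 'M[C]_n) (A B : 'M[C]_k) : lin_map N ->
  forall Y : 'M[C]_(k * m),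
  idtens N ((A *t 1%:M) *m Y *m (B *t 1%:M)) = (A *t 1%:M) *m idtens N Y *m (B *t 1%:M).
Proof.
move=> lN; apply: lin_tens_ext.
- move=> c X Y; rewrite mulmxDr mulmxDl -scalemxAr -scalemxAl.
  exact: idtens_lin.
- move=> c X Y; rewrite (idtens_lin _ c) mulmxDr mulmxDl -scalemxAr -scalemxAl.
  by [].
move=> D E; rewrite !tensmx_mul (idtens_tens _ _ lN) (idtens_tens _ _ lN).
by rewrite !tensmx_mul !mul1mx !mulmx1.
Qed.

(* The substitution [psi = Y_R^((al-1)/2) Y Y_R^((al-1)/2)] turns the bound over
   states into a bound [|| gamma^s M(Y) gamma^s ||_al <= C || Y_R ||_al] for all
   [Y >= 0]; in this form it composes. *)
Lemma qal_amplify k m n (M : 'M[C]_m -> 'M[C]_n) (g : 'M[C]_n) c (Y : 'M[C]_(k * m)) :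
  is_channel M -> psd g -> psd Y ->
  (forall psi : 'M[C]_(k * m), is_state psi ->
    qal al (idtens M psi) (ptr psi *t g) <= c) ->
  rtrace (mp al ((1%:M *t mp (swexp al) g) *m idtens M Y *m (1%:M *t mp (swexp al) g)))
  <= c * rtrace (mp al (ptr Y)).
Proof.
move=> [lM cpM tpM] pg pY hc.
have pT := psd_ptr pY; set T := ptr Y in pT *; set G := 1%:M *t _.
have Gh : G^h = G by rewrite /G adjmx_tens adjmx1 (mpow_herm _ pg).
pose t := rtrace (mp al T).
(* The normalisation divides by [t]; if it vanishes, then so does [Y], and both sides are 0. *)
have [t0|tn0] := eqVneq t 0.
  have T0 : T = 0 := rtrace_mpow0 pT t0.
  have Y0 : Y = 0 by apply: psd_rtrace0 => //; rewrite -rtrace_ptr -/T T0 rtrace0.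
  rewrite -/t t0 mulr0 Y0 (lin_map0 (idtens_lin _)) mulmx0 mul0mx.
  have -> : (0 : 'M[C]_(k * n)) = rC 0 *: 0 by rewrite scaler0.
  rewrite mpowZ ?powR0 ?gt_eqF//; first by rewrite rtraceZ mul0r.
  exact: psd0.
have tp : 0 < t by rewrite lt_neqAle eq_sym tn0 rtrace_mpow_ge0.
have tV : 0 <= t^-1 by rewrite invr_ge0 ltW.
pose h := (al - 1) / 2; have hp : 0 < h by rewrite divr_gt0.
have h0 : h != 0 by rewrite gt_eqF.
pose A := mp h T; have hA : A^h = A := mpow_herm h pT.
pose psi := rC t^-1 *: ((A *t 1%:M) *m Y *m (A *t 1%:M)).
have ptr_psi : ptr psi = rC t^-1 *: mp al T.
  rewrite /ptr krausZ -/(ptr _) ptr_conj -/T; congr (_ *: _).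
  rewrite -[X in _ *m X *m _](mpow1 pT) /A mpowD//; last by rewrite gt_eqF// addr_gt0.
  rewrite mpowD//; last by rewrite gt_eqF// !addr_gt0.
  by congr mp; rewrite /h; field.
have spsi : is_state psi.
  apply/is_stateE; split.
    apply: psdZ => //; have := psd_conj (A *t (1%:M : 'M[C]_m)) pY.
    by rewrite adjmx_tens adjmx1 hA.
  by rewrite -rtrace_ptr ptr_psi rtraceZ mulVf.
have := hc _ spsi; rewrite ptr_psi /qal.
have pTa := psd_mpow al pT.
have pX := cpM _ _ pY.
have SE : sandw al (idtens M psi) ((rC t^-1 *: mp al T) *t g)
    = rC (t `^ - al^-1) *: (G *m idtens M Y *m G).
  (* Hence the power of the marginal [T^al] in the sandwich is [T^(-h)], which cancels [A = T^h] up
     to the support of [T], and [Y] is unaffected by that support. The scalars contribute [1/t] to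
     the power [1 + 2 swexp = 1/al]. *)
  have sE : al * swexp al = - h by rewrite /swexp /h; field; rewrite gt_eqF.
  have PE : mp (swexp al) ((rC t^-1 *: mp al T) *t g)
     = rC (t^-1 `^ swexp al) *: (mp (- h) T *t mp (swexp al) g).
    rewrite (mp_tens _ (psdZ tV pTa) pg) (mpowZ _ tV pTa) (mpow_mpow _ _ pT) sE.
    by rewrite tensmxZl.
  rewrite /sandw PE /psi (lin_mapZ (idtens_lin _)) (idtens_conj _ _ lM).
  rewrite scalemx3 -!rCM.
  have e1 : (mp (- h) T *t mp (swexp al) g) *m (A *t 1%:M) = G *m (supp T *t 1%:M).
    by rewrite !tensmx_mul mul1mx !mulmx1 mpowV// ?oppr_eq0// addNr.
  have e2 : (A *t 1%:M) *m (mp (- h) T *t mp (swexp al) g) = (supp T *t 1%:M) *m G.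
    by rewrite !tensmx_mul !mul1mx mulmx1 mpowV// subrr.
  have YS := mul_supp_tens pY pT (submx_refl _).
  have SYS : (supp T *t 1%:M) *m Y *m (supp T *t 1%:M) = Y.
    rewrite -mulmxA YS -[LHS]adjmxK adjmxM pY.1 adjmx_tens adjmx1.
    by rewrite (supp_herm pT.1) YS pY.1.
  have -> : (mp (- h) T *t mp (swexp al) g) *m ((A *t 1%:M) *m idtens M Y *m (A *t 1%:M))
      *m (mp (- h) T *t mp (swexp al) g) = G *m idtens M Y *m G.
    rewrite -{2}SYS (idtens_conj _ _ lM) !mulmxA e1 -!mulmxA e2.
    by rewrite !mulmxA.
  congr (rC _ *: _).
  have tE : t^-1 = t `^ (-1) by rewrite powR_inv1// ltW.
  rewrite tE -!powRrM -!powRD ?tn0 ?implybT//; congr (_ `^ _).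
  by rewrite /swexp; field; rewrite gt_eqF.
have pGXG : psd (G *m idtens M Y *m G) by have := psd_conj G pX; rewrite Gh.
rewrite SE (mpowZ _ (powR_ge0 _ _) pGXG) rtraceZ -powRrM mulNr mulVf ?gt_eqF//.
by rewrite powR_inv1 ?(ltW tp)// mulrC ler_pdivrMr.
Qed.

End SandwichedChannel.

(** * Gibbs states and the diamond norm *)

Section Instances.
Variable R : realType.
Local Notation C := R[i].

Lemma relr_divergence : divergence (fun n => @relent R n) (@relr R).
Proof.
split.
- exact: relentE.
- exact: relr_dpi_dom.
- exact: relr_bounded.
- exact: relr_ge0.
- exact: relr_eq0.
- exact: relr_self.
- exact: relr_tens_dom.
- move=> k m n M g xi s B cM fg sx ps ts d hB.
  have [pw tw] := idtens_state cM sx; have [lM _ tM] := cM.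
  have pE : ptr (idtens M xi) = ptr xi := ptr_idtens lM tM xi.
  have pp : psd (ptr xi) by apply: psd_ptr; case: sx.
  have sub : (ptr (idtens M xi) <= s)%MS by rewrite pE; exact: (dom_sub pp ps d).
  rewrite (relr_chain pw ps fg sub) pE addrC lerD2l -idtens_replacer.
  exact: hB.
(* With [e = u^2] the modulus [e + 2 sqrt e] is [u^2 + 2u], at most [3u] since [u <= 1]. *)
- move=> eps eps0; pose u := Num.min 1 (eps / 3).
  have u0 : 0 < u by rewrite lt_min ltr01 divr_gt0.
  have u1 : u <= 1 by rewrite ge_min lexx.
  have ue : u <= eps / 3 by rewrite ge_min lexx orbT.
  exists (u ^+ 2); first by rewrite exprn_gt0.
  move=> n rN rM s pN pM ps tN tM ts dN dM le.
  have e0 : 0 < u ^+ 2 by rewrite exprn_gt0.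
  apply: le_trans (relr_continuity e0 pN pM ps tN tM ts dM le) _.
  rewrite lerD2l sqrtr_sqr gtr0_norm//.
  have uu : u ^+ 2 <= u by rewrite expr2 ler_piMl// ltW.
  by lra.
Qed.

Lemma sandr_divergence (al : R) : 1 < al ->
  divergence (fun n => @sandwiched R n al) (@sandr R al).
Proof.
move=> al1; have al0 : 0 < al by apply: lt_trans al1.
have al10 : 0 < al - 1 by rewrite subr_gt0.
split.
- by move=> *; exact: sandwichedE.
- by move=> *; exact: sandr_dpi.
- by move=> *; exact: sandr_bounded.
- by move=> *; exact: sandr_ge0.
- by move=> n r s pr ps tr ts d; exact: sandr_eq0.
- by move=> *; exact: sandr_self.
- by move=> *; exact: sandr_tens.
- move=> k m n M g xi s B cM fg sx ps ts d hB.
  have [pw tw] := idtens_state cM sx; have [lM _ tM] := cM.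
  have [pg tg _] := fg; have [px tx] := (is_stateE xi).1 sx.
  have pp : psd (ptr xi) := psd_ptr px.
  have tp : rtrace (ptr xi) = 1 by rewrite rtrace_ptr.
  have [pa pb ta tb dab] := channel_pair cM fg sx.
  have dw : dom (idtens M xi) (s *t g).
    apply: dom_trans dab _; rewrite idtens_replacer.
    exact: (dom_tens pp pg ps pg d (dom_refl _)).
  have pS : psd (s *t g) := psd_tens ps pg.
  have tS : rtrace (s *t g) = 1 by rewrite (rtrace_tens ps.1 pg.1) ts tg mulr1.
  rewrite sandr_le// mulrDr expRD -(qalE al1 pp ps tp ts d) mulrC.
  pose A := mp (swexp al) s; have hA : A^h = A := mpow_herm _ ps.
  (* Conjugating the reference by the sandwiching power of [s] makes the marginal of [Y] the
     sandwiched matrix of [ptr xi] and [s], so [qal_amplify] yields the product bound, which is the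
     chain inequality after taking logarithms. *)
  pose Y := (A *t 1%:M) *m xi *m (A *t 1%:M).
  have pY : psd Y.
    by have := psd_conj (A *t (1%:M : 'M[C]_m)) px; rewrite adjmx_tens adjmx1 hA.
  have hc (psi : 'M[C]_(k * m)) : is_state psi ->
      qal al (idtens M psi) (ptr psi *t g) <= expR ((al - 1) * B).
    move=> sp; have [qa qb ua ub uab] := channel_pair cM fg sp.
    by have := hB _ sp; rewrite sandr_le// idtens_replacer.
  have := qal_amplify al1 cM pg pY hc.
  rewrite ptr_conj (idtens_conj _ _ lM) -/(sandw al (ptr xi) s) -/(qal al (ptr xi) s).
  rewrite [qal al (idtens M xi) _]/qal.
  suff -> : sandw al (idtens M xi) (s *t g) = (1%:M *t mp (swexp al) g) *m
      ((A *t 1%:M) *m idtens M xi *m (A *t 1%:M)) *m (1%:M *t mp (swexp al) g) by [].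
  rewrite /sandw (mp_tens _ ps pg) !mulmxA tensmx_mul mul1mx mulmx1 -!mulmxA.
  by rewrite tensmx_mul mul1mx mulmx1.
- move=> eps eps0; exists (eps * ((al - 1) / al)).
    by rewrite mulr_gt0// divr_gt0.
  move=> n rN rM s pN pM ps tN tM ts dN dM le.
  have e0 : 0 < eps * ((al - 1) / al) by rewrite mulr_gt0// divr_gt0.
  apply: le_trans (sandr_continuity al1 e0 pN pM ps tN tM ts dN dM le) _.
  rewrite lerD2l le_eqVlt; apply/orP; left; apply/eqP; field.
  by rewrite !gt_eqF.
Qed.

Lemma fcalc_fc n f (A : 'M[C]_n) : fcalc f A = fc f A.
Proof. by rewrite fc.unlock. Qed.

Lemma tnorm_specd n (Z : 'M[C]_n) U d : specd Z U d -> tnorm Z = \sum_i `|d 0 i|.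
Proof.
move=> Zd; have hZ := specd_herm Zd; rewrite /tnorm hZ.
have -> : Z *m Z = fc (fun x => x * x) Z.
  by rewrite -{1 2}(@fcalc_id _ _ id _ hZ)// (fcalcM _ _ hZ).
rewrite fcalc_fc (rtrace_fcalc _ (fcalc_specd _ Zd)).
by apply: eq_bigr => i _; rewrite mxE -expr2 sqrtr_sqr.
Qed.

Lemma lep_tnorm n (Z : 'M[C]_n) : hermitian Z ->
  lep Z (rC (tnorm Z) *: 1%:M) /\ lep (- Z) (rC (tnorm Z) *: 1%:M).
Proof.
move=> hZ; have [U [d Zd]] := spec_exists hZ; rewrite (tnorm_specd Zd).
have le i : `|d 0 i| <= \sum_i `|d 0 i|.
  by rewrite (bigD1 i)//= lerDl; apply: sumr_ge0.
split; first by apply: (lep_scalar Zd) => i; apply: le_trans (le i); exact: ler_norm.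
have NZ : - Z = fc (fun x => - x) Z.
  rewrite -{1}(@fcalc_id _ _ id _ hZ)// -scaleN1r -(rmorphN1 (@rC R)) fcalcZ//.
  by apply: (specd_ext Zd) => i; rewrite mulN1r.
rewrite NZ; apply: (lep_scalar (fcalc_specd _ Zd)) => i; apply: le_trans (le i).
by rewrite mxE -normrN; exact: ler_norm.
Qed.

Lemma tnorm_state n (X : 'M[C]_n) : is_state X -> tnorm X = 1.
Proof.
move=> /is_stateE[pX <-]; have [U [d [Xd d0]]] := psd_spec pX.
rewrite (tnorm_specd Xd) -{1}(@fcalc_id _ _ id _ pX.1)// (rtrace_fcalc _ Xd).
by apply: eq_bigr => i _; rewrite ger0_norm.
Qed.

Lemma diamond_choi m n (N M : 'M[C]_m -> 'M[C]_n) d : (0 < m)%N ->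
  is_channel N -> is_channel M ->
  (diamond (fun X => (N X - M X)%R) <= d%:E)%E ->
  lep (idtens N (maxent_state R m)) (idtens M (maxent_state R m) + rC d *: 1%:M) /\
  lep (idtens M (maxent_state R m)) (idtens N (maxent_state R m) + rC d *: 1%:M).
Proof.
move=> m0 cN cM dle; have sp := maxent_is_state R m0.
set psi := maxent_state R m in sp *.
(* The diamond norm enters only through one test input, the maximally entangled state with reference
   of dimension [m]. *)
have [lN _ _] := cN; have [lM _ _] := cM.
have ZE : idtens (fun X => (N X - M X)%R) psi = idtens N psi - idtens M psi.
  apply: (@tensmap_unique _ _ _ _ _ _ _ (fun X => idtens N X - idtens M X)).
    by apply: lin_add; [exact: idtens_lin|apply: lin_opp; exact: idtens_lin].
  move=> A B; rewrite !idtens_tens//.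
  by rewrite -scaleN1r -tensmxZr -tensmxDr scaleN1r.
set Z := idtens N psi - idtens M psi in ZE.
have tZ : tnorm Z <= d.
  rewrite -lee_fin; apply: le_trans dle; apply: ereal_sup_ubound.
  exists m, psi; rewrite ZE; split=> //.
  by rewrite (tnorm_state sp).
have [pN _] := idtens_state cN sp; have [pM _] := idtens_state cM sp.
have hZ : hermitian Z by rewrite /hermitian adjmxB pN.1 pM.1.
have [l1 l2] := lep_tnorm hZ.
have dd : lep (rC (tnorm Z) *: 1%:M) (rC d *: (1%:M : 'M[C]_(m * n))).
  by rewrite /lep -scalerBl -rCB; apply: psdZ; [rewrite subr_ge0|exact: psd1].
split.
- have := lep_trans l1 dd; rewrite /lep /Z opprB addrA => h.
  by rewrite (addrC (idtens M psi)).
- have := lep_trans l2 dd; rewrite /lep /Z opprK addrA => h.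
  by rewrite (addrC (idtens N psi)).
Qed.

Lemma specd_gibbs n (beta : R) (H : 'M[C]_n) U d : (0 < n)%N -> specd H U d ->
  specd (gibbs beta H) U
    (map_mx (fun x => (\sum_i expR (- beta * d 0 i))^-1 * expR (- beta * x)) d).
Proof.
move=> n0 Hd; have hH := specd_herm Hd.
rewrite /gibbs !fcalc_fc.
rewrite (rtrace_fcalc _ Hd) fcalcZ//.
exact: fcalc_specd.
Qed.

Lemma gibbs_fstate n (beta : R) (H : 'M[C]_n) : (0 < n)%N -> hermitian H ->
  fstate (gibbs beta H).
Proof.
move=> n0 hH; have [U [d Hd]] := spec_exists hH.
have := specd_gibbs beta n0 Hd; set Z := \sum_i _; set g := map_mx _ _ => Gg.
have Z0 : 0 < Z.
  rewrite /Z (bigD1 (Ordinal n0))//= ltr_wpDr ?expR_gt0//.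
  by apply: sumr_ge0 => i _; exact: expR_ge0.
have g0 i : 0 < g 0 i by rewrite mxE mulr_gt0 ?invr_gt0 ?expR_gt0.
split.
- by apply: (specd_psd Gg) => i; exact: ltW.
- rewrite -(@fcalc_id _ _ id _ (specd_herm Gg))// (rtrace_fcalc _ Gg).
  under eq_bigr do rewrite mxE.
  by rewrite -mulr_sumr mulVf ?gt_eqF.
(* The reciprocal of the sum of inverse eigenvalues is a positive lower bound for all eigenvalues
   that avoids choosing a minimum. *)
pose s := \sum_i (g 0 i)^-1; have s0 : 0 < s.
  rewrite /s (bigD1 (Ordinal n0))//= ltr_wpDr ?invr_gt0//.
  by apply: sumr_ge0 => i _; rewrite invr_ge0 ltW.
exists s^-1; first by rewrite invr_gt0.
have hG := specd_herm Gg.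
have E : gibbs beta H - rC s^-1 *: 1%:M = fc (fun x => x + - s^-1) (gibbs beta H).
  rewrite -(fcalcD id (fun=> - s^-1) hG) (@fcalc_cst _ _ (- s^-1) (fun=> - s^-1) _ hG)//.
  by rewrite (@fcalc_id _ _ id _ hG)// scalemx1 (rmorphN (@rC R)) raddfN.
rewrite /lep E; apply: (specd_psd (fcalc_specd _ Gg)) => i.
rewrite mxE subr_ge0 -[leRHS]invrK lef_pV2 ?posrE ?invr_gt0//.
rewrite /s (bigD1 i)//= lerDl.
by apply: sumr_ge0 => j _; rewrite invr_ge0 ltW.
Qed.

(** Eigenvalues of the two Hamiltonians add in a common product basis, so Boltzmann weights multiply
    and the partition function factorises. *)
Lemma gibbs_tens n1 n2 (beta : R) (H1 : 'M[C]_n1) (H2 : 'M[C]_n2) :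
  (0 < n1)%N -> (0 < n2)%N -> hermitian H1 -> hermitian H2 ->
  gibbs beta (H1 *t (1%:M : 'M[C]_n2) + (1%:M : 'M[C]_n1) *t H2)
  = gibbs beta H1 *t gibbs beta H2.
Proof.
move=> n10 n20 h1 h2; have [U1 [d1 D1]] := spec_exists h1.
have [U2 [d2 D2]] := spec_exists h2.
have D12 : specd (H1 *t (1%:M : 'M[C]_n2) + (1%:M : 'M[C]_n1) *t H2) (U1 *t U2)
    (tensrv +%R d1 d2).
  have [/= u1 e1] := D1; have [/= u2 e2] := D2.
  split=> /=; first exact: unitary_tens.
  have dE : diag_mx (map_mx (@rC R) (tensrv +%R d1 d2))
     = diag_mx (map_mx (@rC R) d1) *t 1%:M + 1%:M *t diag_mx (map_mx (@rC R) d2).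
    apply/matrixP => x y; case: (mxtens_indexP x) => i j; case: (mxtens_indexP y) => k l.
    rewrite mxE [RHS]mxE !tensmxE !mxE (can_eq (@mxtens_indexK _ _)) xpair_eqE !mxtens_indexK /=.
    case: eqP => _; case: eqP => _; rewrite /= ?mulr1n ?mulr0n ?(mul0r, mulr0, mul1r, mulr1, addr0)//.
    by rewrite rCD.
  rewrite dE mulmxDr mulmxDl adjmx_tens !tensmx_mul !mulmx1 u1 u2 -e1 -e2.
  by [].
have n12 : (0 < n1 * n2)%N by rewrite muln_gt0 n10.
have [_ /= ->] := specd_gibbs beta n12 D12.
have [_ /= ->] := specd_gibbs beta n10 D1; have [_ /= ->] := specd_gibbs beta n20 D2.
rewrite adjmx_tens -!tensmx_mul diag_tens; congr (_ *m diag_mx _ *m _).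
apply/rowP => x; case: (mxtens_indexP x) => i j.
rewrite !mxE !mxtens_indexK /=; congr rC.
have -> : \sum_x expR (- beta * tensrv +%R d1 d2 0 x)
    = (\sum_i expR (- beta * d1 0 i)) * (\sum_j expR (- beta * d2 0 j)).
  rewrite sum_mxtens mulr_suml; apply: eq_bigr => k _; rewrite mulr_sumr.
  by apply: eq_bigr => l _; rewrite tensrvE mulrDr expRD.
by rewrite invfM mulrDr expRD mulrACA.
Qed.

End Instances.

(** * Free energies *)

Section FreeEnergy.
Variables (R : realType) (beta : R).
Local Notation C := R[i].
Hypothesis beta0 : 0 < beta.
Variable Dv : forall n, 'M[C]_n -> 'M[C]_n -> \bar R.
Variable Dr : forall n, 'M[C]_n -> 'M[C]_n -> R.
Hypothesis HD : divergence (@Dv) (@Dr).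

(** Convertible to [Fch] and to [Fch_alpha] for the respective [Dv], so the shared properties
    transfer without rewriting. *)
Definition free_energy m n (H : 'M[C]_n) (N : 'M[C]_m -> 'M[C]_n) : \bar R :=
  ((beta^-1)%:E * chdiv (@Dv) N (thermal beta H))%E.

Let bV : 0 < beta^-1. Proof. by rewrite invr_gt0. Qed.
Let bE : (0 <= (beta^-1)%:E :> \bar R)%E. Proof. by rewrite lee_fin ltW. Qed.

Lemma free_energy_real m n (H : 'M[C]_n) (N : 'M[C]_m -> 'M[C]_n) :
  (0 < m)%N -> (0 < n)%N -> hermitian H -> is_channel N ->
  exists2 r, free_energy H N = (beta^-1 * r)%:E & is_chdiv Dr N (gibbs beta H) r.
Proof.
move=> m0 n0 hH cN; have fg := gibbs_fstate beta n0 hH.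
have [r rE hr] := chdiv_real HD m0 cN fg; exists r => //.
by rewrite /free_energy -[thermal beta H]/(replacer (gibbs beta H)) rE -EFinM.
Qed.

Lemma free_energy_A1 : prop_A1 free_energy beta.
Proof.
move=> m' m n' n HA HB m'0 m0 n'0 n0 hA hB e P Q cP cQ E N cN.
apply: (lee_wpmul2l bE).
exact: (chdiv_A1 HD m'0 (gibbs_fstate beta m0 hA) (gibbs_fstate beta n0 hB) cP cQ cN E).
Qed.

Lemma free_energy_A2 : prop_A2 free_energy (@Dv) beta.
Proof.
move=> m n H m0 n0 hH w sw; congr (_ * _)%E.
exact: (chdiv_A2 HD m0 sw (gibbs_fstate beta n0 hH)).
Qed.

Lemma free_energy_A3 : prop_A3 free_energy beta.
Proof.
move=> m n H m0 n0 hH N cN.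
have [h0 hE] := chdiv_A3 HD m0 cN (gibbs_fstate beta n0 hH).
split; first exact: mule_ge0.
rewrite -[thermal beta H]/(replacer (gibbs beta H)) -hE /free_energy.
rewrite -[thermal beta H]/(replacer (gibbs beta H)).
split=> [/eqP|->]; last by rewrite mule0.
rewrite mule_eq0 => /orP[|/eqP //].
by rewrite eqe gt_eqF.
Qed.

Lemma free_energy_A4 : prop_A4 free_energy.
Proof.
move=> m n H m0 n0 hH eps eps0; have fg := gibbs_fstate beta n0 hH.
have [pg _ [l l0 lg]] := fg.
(* The factor [beta] compensates the [1/beta] of the free energy. *)
have be : 0 < beta * eps by rewrite mulr_gt0.
have [e e0 he] := div_cont HD be.
have t0 := rtrace_maxent_gt0 R m0; set t := rtrace _ in t0.
(* Chosen so that the diamond bound [d = 2 delta] satisfies [d t = e l], the requirement of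
   [choi_lep]. *)
exists (e * l / (2 * t)); first by rewrite divr_gt0 ?mulr_gt0.
move=> N M cN cM dia.
have dE : 2 * (e * l / (2 * t)) * t = e * l by field; rewrite gt_eqF.
have [l1 l2] := diamond_choi m0 cN cM dia.
have [lN _ _] := cN; have [lM _ _] := cM.
have [rN -> [hN1 hN2]] := free_energy_real m0 n0 hH cN.
have [rM -> [hM1 hM2]] := free_energy_real m0 n0 hH cM.
have dle : 2 * (e * l / (2 * t)) * t <= e * l by rewrite dE.
have NM : rN <= rM + beta * eps.
  apply: hN2 => k psi sp; have pp : psd psi by case: sp.
  have [p1 q1 u1 v1 d1] := channel_pair cN fg sp.
  have [p2 q2 u2 v2 d2] := channel_pair cM fg sp.
  have le := choi_lep m0 lN lM l0 lg l1 (ltW e0) dle pp.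
  apply: le_trans (he _ _ _ _ p1 p2 q1 u1 u2 v1 d1 d2 le) _.
  by rewrite lerD2r; exact: hM1.
have MN : rM <= rN + beta * eps.
  apply: hM2 => k psi sp; have pp : psd psi by case: sp.
  have [p1 q1 u1 v1 d1] := channel_pair cN fg sp.
  have [p2 q2 u2 v2 d2] := channel_pair cM fg sp.
  have le := choi_lep m0 lM lN l0 lg l2 (ltW e0) dle pp.
  apply: le_trans (he _ _ _ _ p2 p1 q1 u2 u1 v1 d2 d1 le) _.
  by rewrite lerD2r; exact: hN1.
rewrite -EFinB abse_EFin lee_fin -mulrBr normrM (gtr0_norm bV).
by rewrite mulrC ler_pdivrMr// ler_norml mulrC; apply/andP; split; lra.
Qed.

Lemma free_energy_A5 : prop_A5 free_energy.
Proof.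
move=> m1 n1 m2 n2 H1 H2 m10 n10 m20 n20 h1 h2 N M cN cM.
have [r1 -> R1] := free_energy_real m10 n10 h1 cN.
have [r2 -> R2] := free_energy_real m20 n20 h2 cM.
have f1 := gibbs_fstate beta n10 h1; have f2 := gibbs_fstate beta n20 h2.
have m0 : (0 < m1 * m2)%N by rewrite muln_gt0 m10.
have [r rE hr] := chdiv_real HD m0 (tensmap_channel cN cM) (fstate_tens f1 f2).
rewrite /free_energy -[thermal beta _]/(replacer (gibbs beta _)) gibbs_tens// rE.
rewrite -EFinM -EFinD -mulrDr; congr (_ * _)%:E; apply/eqP; rewrite eq_le.
by rewrite (chdiv_subadd HD cN cM f1 f2 R1 R2 hr) (chdiv_superadd HD cN cM f1 f2 R1 R2 hr).
Qed.

End FreeEnergy.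

(** * Convex mixtures of channels *)

Section Mixtures.
Variables (R : realType) (beta : R).
Local Notation C := R[i].
Hypothesis beta0 : 0 < beta.

Section Mix.
Variables (m n : nat) (I : finType) (w : I -> R) (Ns : I -> 'M[C]_m -> 'M[C]_n).
Hypotheses (w0 : forall i, 0 <= w i) (w1 : \sum_i w i = 1).
Hypothesis cNs : forall i, is_channel (Ns i).

Definition mixmap (Y : 'M[C]_m) : 'M[C]_n := \sum_i rC (w i) *: Ns i Y.

Lemma idtens_mix k (psi : 'M[C]_(k * m)) :
  idtens mixmap psi = \sum_i rC (w i) *: idtens (Ns i) psi.
Proof.
apply: (@tensmap_unique _ _ _ _ _ _ _ (fun X => \sum_i rC (w i) *: idtens (Ns i) X)).
  move=> c X Y; rewrite scaler_sumr -big_split; apply: eq_bigr => i _ /=.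
  by rewrite (idtens_lin _ c) scalerDr !scalerA mulrC.
move=> A B; rewrite tensmx_sumr; apply: eq_bigr => i _.
by have [lN _ _] := cNs i; rewrite (idtens_tens _ _ lN) tensmxZr.
Qed.

Lemma mix_channel : is_channel mixmap.
Proof.
split=> [c X Y|k X pX|X].
- rewrite /mixmap scaler_sumr -big_split; apply: eq_bigr => i _ /=.
  by have [lN _ _] := cNs i; rewrite lN scalerDr !scalerA mulrC.
- rewrite idtens_mix; apply: psd_mix => // i.
  by have [_ cp _] := cNs i; exact: cp.
rewrite /mixmap raddf_sum /= -[RHS]mul1r -rC1 -w1 rmorph_sum mulr_suml.
by apply: eq_bigr => i _; have [_ _ tp] := cNs i; rewrite mxtraceZ tp.
Qed.
End Mix.

Lemma Fch_A6 : prop_A6 (@Fch R beta).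
Proof.
move=> m n H m0 n0 hH N M cN cM p /andP[p0 p1].
pose w (b : bool) := if b then p else 1 - p.
pose Ns (b : bool) := if b then N else M.
have w0 b : 0 <= w b by case: b => //=; rewrite subr_ge0.
have w1 : \sum_b w b = 1 by rewrite big_bool /= addrC subrK.
have cNs b : is_channel (Ns b) by case: b.
have -> : (fun X => rC p *: N X + rC (1 - p) *: M X) = mixmap w Ns.
  by apply/funext => X; rewrite /mixmap big_bool.
have HD := relr_divergence R; have fg := gibbs_fstate beta n0 hH.
rewrite -![@Fch R beta _ _ _ _]/(free_energy beta (fun k => @relent R k) _ _).
have [r -> [_ h]] := free_energy_real beta HD m0 n0 hH (mix_channel w0 w1 cNs).
have [rN -> [hN _]] := free_energy_real beta HD m0 n0 hH cN.
have [rM -> [hM _]] := free_energy_real beta HD m0 n0 hH cM.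
rewrite -!EFinM -EFinD lee_fin.
have -> : p * (beta^-1 * rN) + (1 - p) * (beta^-1 * rM)
   = beta^-1 * (p * rN + (1 - p) * rM) by ring.
rewrite ler_pM2l ?invr_gt0//; apply: h => k psi sp.
have P b := channel_pair (cNs b) fg sp.
rewrite (idtens_mix _ cNs).
have pA b : psd (idtens (Ns b) psi) by have [] := P b.
have tA b : rtrace (idtens (Ns b) psi) = 1 by have [] := P b.
apply: le_trans (relr_convex _ w0 w1 pA tA) _; rewrite big_bool /=.
apply: lerD; first by rewrite ler_wpM2l//; exact: hN.
by rewrite ler_wpM2l ?subr_ge0//; exact: hM.
Qed.

(** Convexity is available for [qal], not for its logarithm. A mixture of the [qal] values is at
    most the exponential bound for the largest free energy, and taking logarithms of this bound
    gives the maximum. *)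
Lemma Fch_alpha_quasiconvex (al : R) : 1 < al -> prop_quasiconvex (@Fch_alpha R al beta).
Proof.
move=> al1 m n H m0 n0 hH X w w0 w1 Ns cNs.
have HD := sandr_divergence al1; have fg := gibbs_fstate beta n0 hH.
have al10 : 0 < al - 1 by rewrite subr_gt0.
have [x0 _] : exists x0 : X, true.
  case: (pickP (fun _ : X => true)) => [x _|X0]; first by exists x.
  by move: w1; rewrite big_pred0// => /eqP; rewrite eq_sym oner_eq0.
pose f x := fine (Fch_alpha al beta H (Ns x)).
have [x _ xmax] := @Order.TotalTheory.arg_maxP _ _ _ x0 xpredT f isT.
apply: (@le_trans _ _ (Fch_alpha al beta H (Ns x))); last exact: le_bigmax.
have FE y : exists2 r, Fch_alpha al beta H (Ns y) = (beta^-1 * r)%:E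
    & is_chdiv (@sandr R al) (Ns y) (gibbs beta H) r.
  exact (free_energy_real beta HD m0 n0 hH (cNs y)).
have [r rE [_ h]] := free_energy_real beta HD m0 n0 hH (mix_channel w0 w1 cNs).
rewrite -[leLHS]/(free_energy beta (fun k => @sandwiched R k al) H (mixmap w Ns)) rE.
have [rx rxE _] := FE x; rewrite rxE lee_fin ler_pM2l ?invr_gt0//.
apply: h => k psi sp; rewrite (idtens_mix _ cNs).
have P y := channel_pair (cNs y) fg sp.
have pA y : psd (idtens (Ns y) psi) by have [] := P y.
have tA y : rtrace (idtens (Ns y) psi) = 1 by have [] := P y.
have [_ ps _ ts _] := P x.
have [p' _ t' _ d'] := channel_pair (mix_channel w0 w1 cNs) fg sp.
rewrite (idtens_mix _ cNs) in p' t' d'.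
rewrite (sandr_le al1 p' ps t' ts d').
apply: le_trans (qal_convex al1 w0 w1 pA ps) _.
rewrite -[leRHS]mul1r -[X in _ <= X * _]w1 mulr_suml; apply: ler_sum => y _.
rewrite ler_wpM2l//; have [_ _ _ _ dy] := P y.
rewrite -(sandr_le al1 (pA y) ps (tA y) ts dy).
have [ry ryE [hy _]] := FE y; apply: le_trans (hy _ _ sp) _.
have := xmax y isT; rewrite /f ryE rxE /= ler_pM2l// invr_gt0.
by [].
Qed.

End Mixtures.

Theorem theorem1 (R : realType) (beta : R) (hbeta : 0 < beta) :
  [/\ prop_A1 (@Fch R beta) beta,
      prop_A2 (@Fch R beta) (fun n => @relent R n) beta,
      prop_A3 (@Fch R beta) beta,
      prop_A4 (@Fch R beta)
    &
      prop_A5 (@Fch R beta) /\ prop_A6 (@Fch R beta)] /\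
  forall alpha : R, 1 < alpha ->
  [/\ prop_A1 (@Fch_alpha R alpha beta) beta,
      prop_A2 (@Fch_alpha R alpha beta) (fun n => @sandwiched R n alpha) beta,
      prop_A3 (@Fch_alpha R alpha beta) beta,
      prop_A4 (@Fch_alpha R alpha beta)
    &
      prop_A5 (@Fch_alpha R alpha beta) /\ prop_quasiconvex (@Fch_alpha R alpha beta)].
Proof.
split=> [|alpha alpha1].
  have HD := relr_divergence R; split; last split.
  - exact (free_energy_A1 hbeta HD).
  - exact (free_energy_A2 beta HD).
  - exact (free_energy_A3 hbeta HD).
  - exact (free_energy_A4 hbeta HD).
  - exact (free_energy_A5 beta HD).
  - exact: Fch_A6.
have HD := sandr_divergence alpha1; split; last split.
- exact (free_energy_A1 hbeta HD).
- exact (free_energy_A2 beta HD).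
- exact (free_energy_A3 hbeta HD).
- exact (free_energy_A4 hbeta HD).
- exact (free_energy_A5 beta HD).
- exact: Fch_alpha_quasiconvex.
Qed.
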